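(* Let $(u,\pi)$ be an axisymmetric suitable weak solution of the forced Navier-Stokes equations $\partial_t u+(u\cdot\nabla)u-\Delta u+\nabla\pi=f$, $\operatorname{div}u=0$ on $\mathcal Q=B(1)\times(-1,0)$, smooth on compact subsets of $\mathcal Q$, with a force satisfying $$M_f:=\sup_{-1<t<0}\|f(\cdot,t)\|_{C^2_x(B(1))}<\infty .$$ Let $0<h<1/2$, and suppose that there exists a constant $C_{\mathrm{axi}}>0$ such that $$|\partial_r^a\partial_z^b u_r(r,z,t)|\le C_{\mathrm{axi}}(-t)^{-1/2-a/2-(1/2-h)b},$$ $$|\partial_r^a\partial_z^b u_z(r,z,t)|+|\partial_r^a\partial_z^b u_\theta(r,z,t)|\le C_{\mathrm{axi}}(-t)^{-1/2-h-a/2-(1/2-h)b}$$ on $\mathcal Q$, for all nonnegative integers $a,b$ with $a+b\le2$. For $0<\rho<1$ and $-1<t<0$ define $$G_\rho(t):=\Big\|\,|\partial_ru_r(\cdot,t)|+|u_r(\cdot,t)/r|+|\partial_zu_z(\cdot,t)|+|\partial_zu_r(\cdot,t)|\,\Big\|_{L^\infty(B(\rho))},$$ where $u_r/r$ is extended continuously across the axis $r=0$. Then for every fixed $0<\rho<1$, $$\lim_{t\uparrow0}(-t)\,G_\rho(t)=0 .$$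
   Context: Notation: $B(\rho)=\{y\in\mathbb R^3:|y|<\rho\}$, $\mathcal Q=B(1)\times(-1,0)$. The unknowns are $u:\mathcal Q\to\mathbb R^3$ (velocity) and $\pi:\mathcal Q\to\mathbb R$ (pressure), and $f:\mathcal Q\to\mathbb R^3$ is the force. The norm $\|\cdot\|_{C^2_x(B(1))}$ is the supremum over $B(1)$ of all Cartesian spatial derivatives of order at most $2$. Suitable weak solution on $\mathcal Q$ (Caffarelli-Kohn-Nirenberg): $u\in L^\infty_tL^2_x(\mathcal Q)\cap L^2_tH^1_x(\mathcal Q)$, $\pi\in L^{3/2}_{x,t}(\mathcal Q)$, the equations hold in the sense of distributions on $\mathcal Q$, and the local energy inequality holds: for every nonnegative $\varphi\in C_c^\infty(\mathcal Q)$ and almost every $t\in(-1,0)$, $$\int|u|^2\varphi\,dx\Big|_{t}+2\int_{-1}^t\!\!\int|\nabla u|^2\varphi\,dx\,ds\le\int_{-1}^t\!\!\int\Big(|u|^2(\partial_s\varphi+\Delta\varphi)+(|u|^2+2\pi)\,u\cdot\nabla\varphi+2\,u\cdot f\,\varphi\Big)dx\,ds .$$ ''Smooth on compact subsets of $\mathcal Q$'' means that $(u,\pi)$ (hence also $f$) is $C^\infty$ on the open set $\mathcal Q$; no regularity is assumed at time $t=0$. Axisymmetry: write $x=(x',z)$, $r=|x'|$, with cylindrical frame $(e_r,e_\theta,e_z)$. The field $u$ is axisymmetric if $Q_\varphi u(Q_\varphi^{-1}x,t)=u(x,t)$ for every rotation $Q_\varphi$ about the $z$-axis; equivalently $u=u_re_r+u_\theta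 e_\theta+u_ze_z$ with $u_r,u_\theta,u_z$ depending only on $(r,z,t)$. $\partial_r,\partial_z$ act on these scalar coefficients. Smoothness in Cartesian coordinates gives $u_r=0$ at $r=0$. *)

(* Defs.v *)
From HB Require Import structures.
From mathcomp Require Import all_boot all_order all_algebra.
From mathcomp Require Import all_classical all_reals all_analysis.
Set Implicit Arguments.
Unset Strict Implicit.
Unset Printing Implicit Defensive.
Import Order.TTheory GRing.Theory Num.Theory.
Import numFieldNormedType.Exports.
Local Open Scope classical_set_scope.
Local Open Scope ring_scope.

(* Points of R^3 are triples (x, y, z) and points of space-time are pairs
   (x, t), so that Lebesgue measure is the iterated product measure.  The
   library norm of a product is the sup norm; Euclidean balls are therefore
   defined through [norm3]. *)
Notation R3 R := (R * R * R)%type.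
Notation ST R := (R * R * R * R)%type.

Section Smooth.
Context {R : realType} {V : normedModType R}.

Definition iterD (vs : seq V) (g : V -> R) : V -> R :=
  foldr (fun v k => fun p => 'D_v k p) g vs.

(* C^oo on an open set: the iterated directional derivatives of all orders
   exist and are continuous at every point of the set. *)
Definition smooth_on (A : set V) (g : V -> R) : Prop :=
  forall (vs : seq V) (p : V), A p ->
    {for p, continuous (iterD vs g)} /\
    forall v : V, derivable (iterD vs g) p v.

Definition test_function (A : set V) (phi : V -> R) : Prop :=
  smooth_on setT phi /\
  exists K : set V,
    [/\ compact K, K `<=` A & forall p, ~ K p -> phi p = 0].

End Smooth.

Lemma sigma_finite_product d1 d2 (T1 : measurableType d1)
    (T2 : measurableType d2) (R : realType)
    (m1 : {sigma_finite_measure set T1 -> \bar R})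
    (m2 : {sigma_finite_measure set T2 -> \bar R}) :
  sigma_finite setT (m1 \x m2)%E.
Proof.
have /sigma_finiteP[F [TF ndF Foo]] := sigma_finiteT m1.
have /sigma_finiteP[G [TG ndG Goo]] := sigma_finiteT m2.
exists (fun n => F n `*` G n).
  rewrite -setXTT TF TG predeqE => -[x y]; split.
    move=> [/= [n _ Fnx] [k _ Gky]]; exists (maxn n k) => //; split.
    - by move: x Fnx; exact/subsetPset/ndF/leq_maxl.
    - by move: y Gky; exact/subsetPset/ndG/leq_maxr.
  by move=> [n _ []/= ? ?]; split; exists n.
move=> k; have [? ?] := Foo k; have [? ?] := Goo k.
split; first exact: measurableX.
by rewrite product_measure1E// lte_mul_pinfty// ge0_fin_numE.
Qed.

Section NavierStokes.
Context {R : realType}.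
Implicit Types (u f : ST R -> R3 R) (pi : ST R -> R) (t rho : R).

Definition comp3 (i : 'I_3) (v : R3 R) : R :=
  match val i with 0%N => v.1.1 | 1%N => v.1.2 | _ => v.2 end.

Definition basis3 (i : 'I_3) : R3 R :=
  ((val i == 0%N)%:R, (val i == 1%N)%:R, (val i == 2%N)%:R).

Definition dot (v w : R3 R) : R := \sum_(i < 3) comp3 i v * comp3 i w.

Definition norm3 (v : R3 R) : R := Num.sqrt (dot v v).

Definition B rho : set (R3 R) := [set y | norm3 y < rho].

Definition Q : set (ST R) := [set p | B 1 p.1 /\ -1 < p.2 < 0].

(* Lebesgue measure lives on [measurableTypeR R], i.e. R with its Borel sets. *)
Let MR : measurableType _ := measurableTypeR R.

Definition leb1 : set MR -> \bar R := @lebesgue_measure R.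
HB.instance Definition _ := SigmaFiniteMeasure.on leb1.

Definition leb2 : set (MR * MR)%type -> \bar R := (leb1 \x leb1)%E.
HB.instance Definition _ := Measure.on leb2.
HB.instance Definition _ := Measure_isSigmaFinite.Build _ _ _ leb2
  (sigma_finite_product leb1 leb1).

Definition leb3 : set (MR * MR * MR)%type -> \bar R := (leb2 \x leb1)%E.
HB.instance Definition _ := Measure.on leb3.
HB.instance Definition _ := Measure_isSigmaFinite.Build _ _ _ leb3
  (sigma_finite_product leb2 leb1).

Definition leb4 : set (MR * MR * MR * MR)%type -> \bar R := (leb3 \x leb1)%E.
HB.instance Definition _ := Measure.on leb4.
HB.instance Definition _ := Measure_isSigmaFinite.Build _ _ _ leb4
  (sigma_finite_product leb3 leb1).

Definition measurable_on_Q (g : ST R -> R) : Prop :=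
  measurable_fun (Q : set (MR * MR * MR * MR)%type) (g : MR * MR * MR * MR -> R).

Definition dx (j : 'I_3) (g : ST R -> R) : ST R -> R :=
  fun p => 'D_((basis3 j, 0) : ST R) g p.

Definition dt (g : ST R -> R) : ST R -> R :=
  fun p => 'D_((0, 1) : ST R) g p.

Definition laplacian (g : ST R -> R) : ST R -> R :=
  fun p => \sum_(j < 3) dx j (dx j g) p.

Definition Linf_L2 u : Prop :=
  (forall i, measurable_on_Q (comp3 i \o u)) /\
  exists M : R, {ae leb1, forall t, -1 < t < 0 ->
    (\int[leb3]_(x in B 1) (dot (u (x, t)) (u (x, t)))%:E <= M%:E)%E}.

Definition weak_gradient (g : R3 R -> R) (G : 'I_3 -> R3 R -> R) : Prop :=
  forall (psi : R3 R -> R) (j : 'I_3), test_function (B 1) psi ->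
    (\int[leb3]_(x in B 1) (g x * 'D_(basis3 j) psi x)%:E =
     - \int[leb3]_(x in B 1) (G j x * psi x)%:E)%E.

(* [W i j] is the weak derivative of the [i]-th component of [u] in the
   [j]-th spatial direction. *)
Definition L2_H1 u (W : 'I_3 -> 'I_3 -> ST R -> R) : Prop :=
  [/\ forall i j, measurable_on_Q (W i j),
      {ae leb1, forall t, -1 < t < 0 -> forall i,
        weak_gradient (fun x => comp3 i (u (x, t)))
                      (fun j x => W i j (x, t))} &
      (\int[leb4]_(p in Q) (dot (u p) (u p) +
         \sum_(i < 3) \sum_(j < 3) W i j p ^+ 2)%:E < +oo)%E].

Definition L32 pi : Prop :=
  measurable_on_Q pi /\
  (\int[leb4]_(p in Q) (`|pi p| `^ (3 / 2))%:E < +oo)%E.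

(* The convection term is tested in divergence form, (u . grad) u being
   div (u (x) u) when div u = 0. *)
Definition momentum_distr u pi f : Prop :=
  forall (phi : ST R -> R) (i : 'I_3), test_function Q phi ->
    (\int[leb4]_(p in Q)
       (- (comp3 i (u p) * dt phi p)
        - \sum_(j < 3) comp3 j (u p) * comp3 i (u p) * dx j phi p
        - comp3 i (u p) * laplacian phi p
        - pi p * dx i phi p)%:E =
     \int[leb4]_(p in Q) (comp3 i (f p) * phi p)%:E)%E.

Definition divergence_free_distr u : Prop :=
  forall phi : ST R -> R, test_function Q phi ->
    (\int[leb4]_(p in Q) (\sum_(j < 3) comp3 j (u p) * dx j phi p)%:E = 0)%E.

Definition local_energy_inequality u (W : 'I_3 -> 'I_3 -> ST R -> R) pi f :
    Prop :=
  forall phi : ST R -> R, test_function Q phi -> (forall p, 0 <= phi p) ->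
  {ae leb1, forall t, -1 < t < 0 ->
    (\int[leb3]_(x in B 1) (dot (u (x, t)) (u (x, t)) * phi (x, t))%:E +
     2%:E * \int[leb4]_(p in Q `&` [set p | (p.2 < t)%R])
       ((\sum_(i < 3) \sum_(j < 3) W i j p ^+ 2) * phi p)%:E <=
     \int[leb4]_(p in Q `&` [set p | (p.2 < t)%R])
       (dot (u p) (u p) * (dt phi p + laplacian phi p) +
        (dot (u p) (u p) + 2 * pi p) * (\sum_(j < 3) comp3 j (u p) * dx j phi p)
        + 2 * dot (u p) (f p) * phi p)%:E)%E}.

Definition suitable_weak_solution u pi f : Prop :=
  (exists W : 'I_3 -> 'I_3 -> ST R -> R,
     [/\ Linf_L2 u, L2_H1 u W, L32 pi & local_energy_inequality u W pi f]) /\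
  momentum_distr u pi f /\ divergence_free_distr u.

(* The force is C^oo along with u and pi, the equations then hold pointwise. *)
Definition smooth_solution u pi f : Prop :=
  [/\ forall i, smooth_on Q (comp3 i \o u), smooth_on Q pi &
      forall i, smooth_on Q (comp3 i \o f)].

Definition C2norm (g : R3 R -> R3 R) : \bar R :=
  ereal_sup [set y | exists (i : 'I_3) (js : seq 'I_3) (x : R3 R),
    [/\ (size js <= 2)%N, B 1 x &
        y = `|iterD (map basis3 js) (comp3 i \o g) x|%:E]].

Definition Mforce f : \bar R :=
  ereal_sup [set C2norm (fun x => f (x, t)) | t in [set t : R | -1 < t < 0]].

Definition rotz (th : R) (x : R3 R) : R3 R :=
  (cos th * x.1.1 - sin th * x.1.2, sin th * x.1.1 + cos th * x.1.2, x.2).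

Definition axisymmetric u : Prop :=
  forall (th : R) (x : R3 R) t, Q (x, t) ->
    rotz th (u (rotz (- th) x, t)) = u (x, t).

(* The cylindrical coefficients of an axisymmetric field do not depend on the
   angle, so they are read off on the half plane y = 0, x >= 0, where the frame
   (e_r, e_theta, e_z) is the Cartesian one.  The formulas also make sense for
   r < 0, where they give the smooth odd (u_r, u_theta) or even (u_z)
   extension across the axis. *)
Definition u_r u (r z t : R) : R := (u (r, 0, z, t)).1.1.
Definition u_theta u (r z t : R) : R := (u (r, 0, z, t)).1.2.
Definition u_z u (r z t : R) : R := (u (r, 0, z, t)).2.

Definition drz (a b : nat) (g : R -> R -> R -> R) (r z t : R) : R :=
  derive1n a (fun r' => derive1n b (fun z' => g r' z' t) z) r.

Definition axi_bounds u (h C : R) : Prop :=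
  forall a b : nat, (a + b <= 2)%N ->
  forall r z t : R, 0 <= r -> Q (r, 0, z, t) ->
    `|drz a b (u_r u) r z t| <=
      C * (- t) `^ (- (1 / 2) - a%:R / 2 - (1 / 2 - h) * b%:R) /\
    `|drz a b (u_z u) r z t| + `|drz a b (u_theta u) r z t| <=
      C * (- t) `^ (- (1 / 2) - h - a%:R / 2 - (1 / 2 - h) * b%:R).

(* The limit is the continuous extension of u_r / r to the axis. *)
Definition u_r_over_r u (r z t : R) : R :=
  if r == 0 then lim (u_r u s z t / s @[s --> 0^'+]) else u_r u r z t / r.

Definition Gsum u t (x : R3 R) : R :=
  let r := Num.sqrt (x.1.1 ^+ 2 + x.1.2 ^+ 2) in
  let z := x.2 in
  `|drz 1 0 (u_r u) r z t| + `|u_r_over_r u r z t| +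
  `|drz 0 1 (u_z u) r z t| + `|drz 0 1 (u_r u) r z t|.

Definition G u rho t : \bar R :=
  ('N[leb3]_(+oo)[(EFin \o Gsum u t) \_ (B rho)])%E.

End NavierStokes.

(* Main.v *)
Require Import Defs.
From HB Require Import structures.
From mathcomp Require Import all_boot all_order all_algebra.
From mathcomp Require Import all_classical all_reals all_analysis.
From mathcomp Require Import measurable_realfun.
From mathcomp Require Import ring lra.
Import Order.TTheory GRing.Theory Num.Theory.
Import numFieldNormedType.Exports.
Local Open Scope classical_set_scope.
Local Open Scope ring_scope.

(** Write [tau = - t], [s = sqrt tau] and [e = tau ^ (h / 3)]. In the hypotheses
    [u_r] is of order [s^-1], [u_z] and [u_theta] are of order [s^-1 e^-3], each
    radial derivative costs a factor [s^-1] and each vertical one a factor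
    [e^3 / s]. Thus [tau * d_z u_r] is of order [e^3] and tends to zero, and
    incompressibility bounds [d_r u_r] and [u_r / r] by [d_z u_z] (lemma
    [strain_rate]). What has to be shown is [tau * d_z u_z --> 0], whereas the
    hypotheses only say that this quantity is bounded.

    Incompressibility also says that the mean of [d_z u_z], with weight [r], over
    a radial interval of length [L s] is a boundary term in [r u_r]; it is at most
    a multiple of [1 / (L tau)] ([flux_mean]), hence small for large [L]. So it
    suffices that [d_z u_z] varies little over such an interval. Its variation is a
    difference quotient in [z], with step [eps * s e^-3], of the variation of
    [u_z], up to an error of order [eps / tau] ([strain_variation]). With the
    hypothesis on [d_r u_z], of order [s^-2 e^-3], this is of order [1 / tau] and
    just fails to be small. Any gain in the bound on [d_r u_z] is enough, and since
    [d_z u_r] is small it may come from the angular vorticity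
    [d_z u_r - d_r u_z]; [vorticity_rate] gives [s^-2 e^-2].

    The gain comes from the swirl [r u_theta]. It satisfies a transport-diffusion
    equation without zero-order term, so by the maximum principle it stays bounded
    ([swirl_bounded]); comparison with its value at the radius [s e], where this
    bound balances the one on the second derivative, gives
    [|u_theta| <= K r s^-2 e^-2] ([swirl_rate]). The angular vorticity divided by
    [r] satisfies a similar equation, in dimension five, whose source is
    [d_z (u_theta^2) / r^2]. The two swirl bounds make this source smaller than what
    the barrier [s^-1 e^-2 / (r^2 + 16 C^2 tau)] produces ([forcing_le],
    [profile_lower]), and this barrier times [r] is at most a multiple of
    [s^-2 e^-2].

    Nothing is known about the flow on the boundary of the ball. Both maximum
    principles are localised by the barrier [(tau + kap * zeta^2)^-2], where
    [zeta = A t - |x|^2] and the sphere [|x|^2 = A t] moves inwards at the speed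
    [4 C s^-1 e^-3]. This exceeds the speed of the flow, so that transport helps;
    its integral in time is finite because [h < 1 / 2] ([moving_boundary]). On the
    sphere the barrier is [tau^-2], more than the hypotheses allow for the swirl and
    for the vorticity, and in a smaller ball it is bounded.

    The pointwise equations are obtained from their distributional form by testing
    with smooth bumps ([divergence_pointwise], [momentum_pointwise]). The maximum
    principles use them in Cartesian coordinates; axial symmetry enters through the
    angular derivative [dth], and on the half-plane [y = 0] it expresses the
    derivatives in [y] by those of the cylindrical coefficients. *)

Set Implicit Arguments.
Unset Strict Implicit.
Unset Printing Implicit Defensive.

(** * Directional derivatives and the symmetry of second derivatives *)

Section Lines.
Context {R : realType} {V : normedModType R}.
Implicit Types (g : V -> R) (p q v e : V) (A : set V).

Lemma line_quotient g p v (h : R) :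
  (fun k : R => k^-1 *: (((fun s : R => g (p + s *: v)) \o shift h) (k *: 1) -
     g (p + h *: v))) =
  (fun k : R => k^-1 *: ((g \o shift (p + h *: v)) (k *: v) - g (p + h *: v))).
Proof.
apply/funext => k /=; congr (_ *: (g _ - _)).
by rewrite [k *: 1]mulr1 scalerDl addrCA.
Qed.

Lemma derive_line g p v (h : R) :
  'D_1 (fun s : R => g (p + s *: v)) h = 'D_v g (p + h *: v).
Proof. by rewrite /derive line_quotient. Qed.

Lemma derivable_line g p v (h : R) :
  derivable g (p + h *: v) v <-> derivable (fun s : R => g (p + s *: v)) h 1.
Proof. by rewrite /derivable line_quotient. Qed.

Lemma is_derive_line g p v (h : R) : derivable g (p + h *: v) v ->
  is_derive h 1 (fun s : R => g (p + s *: v)) ('D_v g (p + h *: v)).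
Proof.
by move=> dg; split; [exact/derivable_line|exact: derive_line].
Qed.

Lemma MVT_line g q e (a : R) :
  (forall c : R, `|c| <= `|a| -> derivable g (q + c *: e) e) ->
  exists2 c : R, `|c| <= `|a| & g (q + a *: e) - g q = a * 'D_e g (q + c *: e).
Proof.
move=> dg; pose G (s : R) := g (q + s *: e).
have DG (s : R) : `|s| <= `|a| -> is_derive s 1 G ('D_e g (q + s *: e)).
  by move=> sa; apply: is_derive_line; exact: dg.
have contG (x y : R) : (forall s, s \in `[x, y]%R -> `|s| <= `|a|) ->
    {within `[x, y], continuous G}.
  move=> xy; apply: derivable_within_continuous => s sxy.
  by have [] := DG s (xy _ sxy).
have -> : g q = G 0 by rewrite /G scale0r addr0.
rewrite -/(G a); have [a0|a0] := leP 0 a.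
  have sub s : s \in `[0, a]%R -> `|s| <= `|a|.
    by rewrite in_itv/= => /andP[s0 sa]; rewrite !ger0_norm.
  have [c c0a] : exists2 c, c \in `[0, a]%R &
      G a - G 0 = 'D_e g (q + c *: e) * (a - 0).
    apply: MVT_segment => //; last exact: contG.
    move=> x x0a; apply: DG; apply: sub.
    by move: x0a; rewrite !in_itv/= => /andP[x1 x2]; rewrite !ltW.
  by rewrite subr0 mulrC => ->; exists c => //; exact: sub.
have sub s : s \in `[a, 0]%R -> `|s| <= `|a|.
  by rewrite in_itv/= => /andP[s0 sa]; rewrite !ler0_norm ?lerN2 // ltW.
have [c c0a] : exists2 c, c \in `[a, 0]%R &
    G 0 - G a = 'D_e g (q + c *: e) * (0 - a).
  apply: MVT_segment => //; [exact: ltW| |exact: contG].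
  move=> x x0a; apply: DG; apply: sub.
  by move: x0a; rewrite !in_itv/= => /andP[x1 x2]; rewrite !ltW.
rewrite sub0r mulrN => E; exists c; first exact: sub.
by rewrite -opprB E opprK mulrC.
Qed.

Lemma iterD_rcons vs v g : Defs.iterD (rcons vs v) g = Defs.iterD vs ('D_v g).
Proof. by rewrite /Defs.iterD foldr_rcons. Qed.

Lemma smooth_D A g v : smooth_on A g -> smooth_on A ('D_v g).
Proof. by move=> sg vs p Ap; rewrite -iterD_rcons; exact: sg. Qed.

Lemma smooth_continuous A g p : smooth_on A g -> A p -> {for p, continuous g}.
Proof. by move=> sg Ap; have [] := sg [::] p Ap. Qed.

Lemma smooth_derivable A g p v : smooth_on A g -> A p -> derivable g p v.
Proof. by move=> sg Ap; have [_] := sg [::] p Ap; apply. Qed.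

End Lines.
Arguments smooth_derivable {R V A g p v} _ _.

Section Schwarz.
Context {R : realType} {V : normedModType R}.
Implicit Types (g : V -> R) (p q v w e : V) (A : set V).

Lemma open_ball_in A p : open A -> A p ->
  exists2 d : R, 0 < d & forall q, `|q - p| < d -> A q.
Proof.
move=> oA Ap; have /nbhs_ballP[d /= d0 dA] := open_nbhs_nbhs (conj oA Ap).
exists d => // q qd; apply: dA; rewrite -ball_normE/= distrC; exact: qd.
Qed.

Lemma continuous_at_eps g p (eps : R) : {for p, continuous g} -> 0 < eps ->
  exists2 d : R, 0 < d & forall q, `|q - p| < d -> `|g q - g p| < eps.
Proof.
move=> cg e0; have /cvgrPdist_lt/(_ _ e0) := cg.
move=> /nbhs_ballP[d /= d0 dA]; exists d => // q qd.
by rewrite distrC; apply: dA; rewrite -ball_normE/= distrC.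
Qed.

(** The mean value theorem, used in one direction and then in the other, finds the
    mixed derivative near [p] in the second difference over a parallelogram. *)
Lemma second_difference A g p v w (d h : R) : open A -> smooth_on A g ->
  (forall q, `|q - p| < d -> A q) -> 0 < h ->
  h * (`|v| + `|w|) < d ->
  exists2 q, `|q - p| <= h * (`|v| + `|w|) &
    g (p + h *: v + h *: w) - g (p + h *: v) - (g (p + h *: w) - g p)
      = h * (h * 'D_w ('D_v g) q).
Proof.
move=> oA sg dA h0 hd.
have near0 (c c' : R) : `|c| <= h -> `|c'| <= h ->
    `|(p + c *: v + c' *: w) - p| <= h * (`|v| + `|w|).
  move=> ch c'h; rewrite -(addrA p) addrAC subrr add0r.
  by rewrite (le_trans (ler_normD _ _))// !normrZ mulrDr lerD// ler_wpM2r.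
have inA (c c' : R) : `|c| <= h -> `|c'| <= h -> A (p + c *: v + c' *: w).
  by move=> ch c'h; apply: dA; apply: le_lt_trans hd; exact: near0.
pose k := (fun q => g (q + h *: w) - g q).
have hh : `|h| <= h by rewrite gtr0_norm.
have n00 : `|0 : R| <= h by rewrite normr0 ltW.
have dk (c : R) : `|c| <= `|h| ->
    is_derive (p + c *: v) v k ('D_v g (p + c *: v + h *: w) - 'D_v g (p + c *: v)).
  rewrite (gtr0_norm h0) => ch.
  have D1 : is_derive (p + c *: v) v (fun q => g (q + h *: w))
     ('D_v g (p + c *: v + h *: w)).
    have E : (fun k0 : R => k0^-1 *: (((fun q : V => g (q + h *: w)) \o
         shift (p + c *: v)) (k0 *: v) - g (p + c *: v + h *: w))) =
       (fun k0 : R => k0^-1 *: ((g \o shift (p + c *: v + h *: w)) (k0 *: v)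
          - g (p + c *: v + h *: w))).
      by apply/funext => s /=; rewrite -!addrA.
    split; last by rewrite /derive [X in lim (X @ _) = _]E.
    rewrite /derivable [X in cvg (X @ _)]E.
    exact: (smooth_derivable sg (inA _ _ ch hh)).
  have D2 : is_derive (p + c *: v) v g ('D_v g (p + c *: v)).
    apply: derivableP; apply: (smooth_derivable sg).
    by have := inA _ _ ch n00; rewrite scale0r addr0.
  exact: is_deriveB.
have [c ch E] := MVT_line (fun c ch => @ex_derive _ _ _ _ _ _ _ (dk c ch)).
move: E; rewrite (@derive_val _ _ _ _ _ _ _ (dk c ch)) /k => ->.
rewrite (gtr0_norm h0) in ch.
have [c' c'h] : exists2 c' : R, `|c'| <= `|h| &
   'D_v g (p + c *: v + h *: w) - 'D_v g (p + c *: v) =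
   h * 'D_w ('D_v g) (p + c *: v + c' *: w).
  apply: (MVT_line (g := 'D_v g) (q := p + c *: v) (e := w)) => c'.
  rewrite (gtr0_norm h0) => c'h.
  by apply: (smooth_derivable (smooth_D v sg)); exact: inA.
rewrite (gtr0_norm h0) in c'h.
by move=> ->; exists (p + c *: v + c' *: w) => //; exact: near0.
Qed.

(** The second difference is symmetric in the two directions, so the two mixed
    derivatives agree at nearby points; continuity brings both to [p]. *)
Lemma derive_comm A g p v w : open A -> smooth_on A g -> A p ->
  'D_v ('D_w g) p = 'D_w ('D_v g) p.
Proof.
move=> oA sg Ap; apply/eqP; rewrite -subr_eq0 -normr_le0; apply/ler_addgt0Pr => e e0.
rewrite add0r.
have e20 : 0 < e / 2 by rewrite divr_gt0.
have [d0 d00 Hd0] := open_ball_in oA Ap.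
have [d1 d10 Hd1] := continuous_at_eps
  (smooth_continuous (smooth_D v (smooth_D w sg)) Ap) e20.
have [d2 d20 Hd2] := continuous_at_eps
  (smooth_continuous (smooth_D w (smooth_D v sg)) Ap) e20.
pose d := Num.min d0 (Num.min d1 d2).
have d_gt0 : 0 < d by rewrite !lt_min d00 d10 d20.
pose n := `|v| + `|w| + 1.
have n0 : 0 < n by rewrite ltr_wpDl// addr_ge0.
pose h := d / n.
have h0 : 0 < h by rewrite divr_gt0.
have hvw : h * (`|v| + `|w|) < d.
  by rewrite -[ltRHS](divfK (lt0r_neq0 n0)) ltr_pM2l// /n ltrDl.
have hwv : h * (`|w| + `|v|) < d by rewrite addrC.
have dA q : `|q - p| < d -> A q.
  by move=> qd; apply: Hd0; apply: lt_le_trans qd _; rewrite ge_min lexx.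
have [q1 Q1 E1] := second_difference oA sg dA h0 hvw.
have [q2 Q2 E2] := second_difference oA sg dA h0 hwv.
have E12 : 'D_w ('D_v g) q1 = 'D_v ('D_w g) q2.
  apply: (mulfI (lt0r_neq0 h0)); apply: (mulfI (lt0r_neq0 h0)).
  apply: (etrans (esym E1)); apply: (etrans _ E2).
  rewrite (addrAC p (h *: w)).
  by rewrite !opprB addrACA [RHS]addrACA (addrC (- g (p + h *: v))).
have := Hd2 q1 _; have := Hd1 q2 _.
rewrite E12; move: (le_lt_trans Q1 hvw) (le_lt_trans Q2 hwv).
rewrite !lt_min => /and3P[_ _ ->] /and3P[_ -> _] /(_ isT) H1 /(_ isT) H2.
rewrite (splitr e) -[X in `|X|](subrKA ('D_v ('D_w g) q2)).
apply: le_trans (ler_normD _ _) _; apply: lerD; apply: ltW; last exact: H2.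
by rewrite distrC; exact: H1.
Qed.

End Schwarz.

(** * Coordinates of space-time and differentiability *)

Lemma increment_differentiable (R : realType) (V W : normedModType R)
    (f : V -> W) (df : {linear V -> W}) (x : V) : continuous df ->
  (forall eps : R, 0 < eps -> exists2 d : R, 0 < d &
    forall w, `|w| < d -> `|f (x + w) - f x - df w| <= eps * `|w|) ->
  differentiable f x /\ 'd f x = df :> (V -> W).
Proof.
move=> cdf Hf.
have E : f \o shift x = cst (f x) + df +o_ 0 id.
  apply/eqaddoP => eps e0; have [d d0 Hd] := Hf eps e0.
  rewrite near_simpl; apply/nbhs_normP; exists d => //= w.
  rewrite /ball_/= sub0r normrN => /Hd; rewrite (addrC x w) -addrA -opprD; exact.
have dE := diff_unique cdf E; split=> //.
by apply/diff_locallyP; rewrite dE.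
Qed.

Section Coordinates.
Context {R : realType}.
Implicit Types (g : ST R -> R) (p q w : ST R) (A : set (ST R)).

Definition i0 : 'I_3 := @Ordinal 3 0 isT.
Definition i1 : 'I_3 := @Ordinal 3 1 isT.
Definition i2 : 'I_3 := @Ordinal 3 2 isT.

Lemma sum3 (V : nmodType) (F : 'I_3 -> V) :
  \sum_(j < 3) F j = F i0 + F i1 + F i2.
Proof.
by rewrite !big_ord_recr/= big_ord0 add0r; congr (F _ + F _ + F _); apply/val_inj.
Qed.

Lemma ord3P (P : 'I_3 -> Prop) : P i0 -> P i1 -> P i2 -> forall i, P i.
Proof.
move=> P0 P1 P2 [[|[|[|//]]] i3].
- by have -> : Ordinal i3 = i0 by exact: val_inj.
- by have -> : Ordinal i3 = i1 by exact: val_inj.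
- by have -> : Ordinal i3 = i2 by exact: val_inj.
Qed.

Definition ex : ST R := (1, 0, 0, 0).
Definition ey : ST R := (0, 1, 0, 0).
Definition ez : ST R := (0, 0, 1, 0).
Definition et : ST R := (0, 0, 0, 1).

Lemma addexE (x y z t h : R) : (x, y, z, t) + h *: ex = (x + h, y, z, t).
Proof. by congr (_, _, _, _); rewrite /= ?[h *: 1]mulr1 ?[h *: 0]mulr0 ?addr0. Qed.

Lemma addeyE (x y z t h : R) : (x, y, z, t) + h *: ey = (x, y + h, z, t).
Proof. by congr (_, _, _, _); rewrite /= ?[h *: 1]mulr1 ?[h *: 0]mulr0 ?addr0. Qed.

Lemma addezE (x y z t h : R) : (x, y, z, t) + h *: ez = (x, y, z + h, t).
Proof. by congr (_, _, _, _); rewrite /= ?[h *: 1]mulr1 ?[h *: 0]mulr0 ?addr0. Qed.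

Lemma addetE (x y z t h : R) : (x, y, z, t) + h *: et = (x, y, z, t + h).
Proof. by congr (_, _, _, _); rewrite /= ?[h *: 1]mulr1 ?[h *: 0]mulr0 ?addr0. Qed.

Lemma normSTE (a b c d : R) :
  `|(a, b, c, d) : ST R| = Num.max (Num.max (Num.max `|a| `|b|) `|c|) `|d|.
Proof. by []. Qed.

Lemma normST_lt (a b c d M : R) : `|a| < M -> `|b| < M -> `|c| < M ->
  `|d| < M -> `|(a, b, c, d) : ST R| < M.
Proof. by move=> a1 b1 c1 d1; rewrite normSTE !gt_max a1 b1 c1 d1. Qed.

Lemma leg_increment A g p e (d eta a : R) q : smooth_on A g ->
  (forall y, `|y - p| < d -> A y) ->
  (forall y, `|y - p| < d -> `|'D_e g y - 'D_e g p| < eta) ->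
  (forall c, `|c| <= `|a| -> `|q + c *: e - p| < d) ->
  `|g (q + a *: e) - g q - a * 'D_e g p| <= eta * `|a|.
Proof.
move=> sg dA dD qd.
have [c ca ->] : exists2 c, `|c| <= `|a| &
    g (q + a *: e) - g q = a * 'D_e g (q + c *: e).
  by apply: MVT_line => c ca; apply: (smooth_derivable sg); exact/dA/qd.
by rewrite -mulrBr normrM mulrC ler_wpM2r// ltW// dD// qd.
Qed.

(** Continuous partial derivatives give Frechet differentiability: telescope the
    increment along the coordinate axes and apply the mean value theorem on each
    leg. *)
Lemma smooth_increment A g p (eps : R) : open A -> smooth_on A g -> A p ->
  0 < eps -> exists2 d : R, 0 < d & forall a b c e : R,
    `|(a, b, c, e) : ST R| < d ->
    `|g (p + (a, b, c, e)) - g p - (a * 'D_ex g p + b * 'D_ey g p +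
       c * 'D_ez g p + e * 'D_et g p)| <= eps * `|(a, b, c, e) : ST R|.
Proof.
move=> oA sg Ap e0.
have e40 : 0 < eps / 4 by rewrite divr_gt0.
have [d0 d00 Hd0] := open_ball_in oA Ap.
have [d1 d10 Hd1] := continuous_at_eps (smooth_continuous (smooth_D ex sg) Ap) e40.
have [d2 d20 Hd2] := continuous_at_eps (smooth_continuous (smooth_D ey sg) Ap) e40.
have [d3 d30 Hd3] := continuous_at_eps (smooth_continuous (smooth_D ez sg) Ap) e40.
have [d4 d40 Hd4] := continuous_at_eps (smooth_continuous (smooth_D et sg) Ap) e40.
exists (Num.min d0 (Num.min (Num.min d1 d2) (Num.min d3 d4))).
  by rewrite !lt_min d00 d10 d20 d30 d40.
set d := Num.min _ _ => a b c e nd.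
have [dd0 [dd1 [dd2 [dd3 dd4]]]] :
    d <= d0 /\ d <= d1 /\ d <= d2 /\ d <= d3 /\ d <= d4.
  by rewrite /d; do ?split; rewrite !ge_min lexx ?orbT.
have := nd; rewrite normSTE !gt_max => /andP[/andP[/andP[ad bd] cd] ed].
have := lexx (`|(a, b, c, e) : ST R|).
rewrite {1}normSTE !ge_max => /andP[/andP[/andP[an bn] cn] en].
set n := `|_ : ST R| in an bn cn en *.
have z0 : `|0 : R| < d by rewrite normr0; exact: le_lt_trans ad.
case: p Ap Hd0 Hd1 Hd2 Hd3 Hd4 => [[[x y] z] t] Ap Hd0 Hd1 Hd2 Hd3 Hd4.
have dA q : `|q - (x, y, z, t)| < d -> A q.
  by move=> qd; apply: Hd0; exact: lt_le_trans qd dd0.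
have subE (x1 x2 x3 x4 y1 y2 y3 y4 : R) :
  (x1, x2, x3, x4) - (y1, y2, y3, y4) = (x1 - y1, x2 - y2, x3 - y3, x4 - y4) :> ST R.
  by [].
have leg q v k : `|k| <= n ->
    (forall r, `|r - (x, y, z, t)| < d -> `|'D_v g r - 'D_v g (x, y, z, t)| < eps / 4) ->
    (forall r : R, `|r| <= `|k| -> `|q + r *: v - (x, y, z, t)| < d) ->
    `|g (q + k *: v) - g q - k * 'D_v g (x, y, z, t)| <= eps / 4 * n.
  move=> kn Hv qd; apply: le_trans (leg_increment sg dA Hv qd) _.
  by rewrite ler_wpM2l// ltW.
have near_q v d' (H : forall r, `|r - (x, y, z, t)| < d' ->
    `|'D_v g r - 'D_v g (x, y, z, t)| < eps / 4) : d <= d' -> forall r,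
    `|r - (x, y, z, t)| < d -> `|'D_v g r - 'D_v g (x, y, z, t)| < eps / 4.
  by move=> dd r rd; apply: H; exact: lt_le_trans rd dd.
have L1 : `|g (x + a, y, z, t) - g (x, y, z, t) - a * 'D_ex g (x, y, z, t)| <= eps / 4 * n.
  rewrite -addexE; apply: (leg _ _ _ an (near_q _ _ Hd1 dd1)) => k ka.
  rewrite addexE subE; apply: normST_lt; rewrite ?subrr//;
    by rewrite addrC addKr// (le_lt_trans ka).
have L2 : `|g (x + a, y + b, z, t) - g (x + a, y, z, t) - b * 'D_ey g (x, y, z, t)| <= eps / 4 * n.
  rewrite -addeyE; apply: (leg _ _ _ bn (near_q _ _ Hd2 dd2)) => k ka.
  rewrite addeyE subE; apply: normST_lt; rewrite ?subrr//;
    by rewrite addrC addKr// (le_lt_trans ka).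
have L3 : `|g (x + a, y + b, z + c, t) - g (x + a, y + b, z, t) -
    c * 'D_ez g (x, y, z, t)| <= eps / 4 * n.
  rewrite -addezE; apply: (leg _ _ _ cn (near_q _ _ Hd3 dd3)) => k ka.
  rewrite addezE subE; apply: normST_lt; rewrite ?subrr//;
    by rewrite addrC addKr// (le_lt_trans ka).
have L4 : `|g (x + a, y + b, z + c, t + e) - g (x + a, y + b, z + c, t) -
    e * 'D_et g (x, y, z, t)| <= eps / 4 * n.
  rewrite -addetE; apply: (leg _ _ _ en (near_q _ _ Hd4 dd4)) => k ka.
  rewrite addetE subE; apply: normST_lt; rewrite ?subrr//;
    by rewrite addrC addKr// (le_lt_trans ka).
have -> : (x, y, z, t) + (a, b, c, e) = (x + a, y + b, z + c, t + e) :> ST R by [].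
move: L1 L2 L3 L4.
move: (g (x, y, z, t)) (g (x + a, y, z, t)) (g (x + a, y + b, z, t))
  (g (x + a, y + b, z + c, t)) (g (x + a, y + b, z + c, t + e)) => g0 g1 g2 g3 g4.
move: (a * _) (b * _) (c * _) (e * _) => m1 m2 m3 m4 L1 L2 L3 L4.
have -> : g4 - g0 - (m1 + m2 + m3 + m4) =
  (g1 - g0 - m1) + (g2 - g1 - m2) + (g3 - g2 - m3) + (g4 - g3 - m4) by ring.
have -> : eps * n = eps / 4 * n + eps / 4 * n + eps / 4 * n + eps / 4 * n by field.
by do 3 (apply: le_trans (ler_normD _ _) _; apply: lerD => //).
Qed.

Definition partial_diff g p : ST R -> R := fun w =>
  w.1.1.1 * 'D_ex g p + w.1.1.2 * 'D_ey g p + w.1.2 * 'D_ez g p + w.2 * 'D_et g p.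

Lemma partial_diff_linear g p : linear (partial_diff g p).
Proof.
move=> k [[[a b] c] e] [[[a' b'] c'] e']; rewrite /partial_diff.
have -> : k *: ((a, b, c, e) : ST R) + (a', b', c', e') =
  (k * a + a', k * b + b', k * c + c', k * e + e') by [].
move: ('D_ex g p) ('D_ey g p) ('D_ez g p) ('D_et g p) => d1 d2 d3 d4.
rewrite /= /GRing.scale /=; ring.
Qed.

Lemma partial_diff_bound g p w : `|partial_diff g p w| <=
  (`|'D_ex g p| + `|'D_ey g p| + `|'D_ez g p| + `|'D_et g p|) * `|w|.
Proof.
case: w => [[[a b] c] e]; rewrite /partial_diff/=.
have := lexx (`|(a, b, c, e) : ST R|).
rewrite {1}normSTE !ge_max => /andP[/andP[/andP[an bn] cn] en].
move: ('D_ex g p) ('D_ey g p) ('D_ez g p) ('D_et g p) an bn cn en => d1 d2 d3 d4.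
move: `|(a, b, c, e) : ST R| => n an bn cn en.
rewrite !mulrDl; do 3 (apply: le_trans (ler_normD _ _) _; apply: lerD;
  last by rewrite normrM mulrC ler_wpM2l).
by rewrite normrM mulrC ler_wpM2l.
Qed.

Lemma smooth_differentiable A g p : open A -> smooth_on A g -> A p ->
  differentiable g p /\ forall w, 'd g p w = partial_diff g p w.
Proof.
move=> oA sg Ap.
pose L := GRing.isLinear.Build _ _ _ _ _ (partial_diff_linear g p).
pose D : {linear ST R -> R} := HB.pack (partial_diff g p : ST R -> R) L.
have cD : continuous D.
  apply/(@linear_bounded_continuous R (ST R) R D).
  apply/linear_boundedP; near=> M => w; apply: le_trans (partial_diff_bound _ _ _) _.
  apply: ler_wpM2r => //; near: M; exact: nbhs_pinfty_ge.
have [dg dE] : differentiable g p /\ 'd g p = D :> (ST R -> R).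
  apply: increment_differentiable => // eps e0.
  have [d d0 Hd] := smooth_increment oA sg Ap e0; exists d => // w.
  by case: w => [[[a b] c] e] wd; exact: Hd.
by split=> // w; rewrite dE.
Unshelve. all: by end_near. Qed.

(** The chain rule along horizontal curves, as needed for rotations about the
    axis. *)
Lemma chain_xy A g (X Y : R -> R) (s dX dY z t : R) : open A -> smooth_on A g ->
  is_derive s 1 X dX -> is_derive s 1 Y dY -> A (X s, Y s, z, t) ->
  is_derive s 1 (fun s => g (X s, Y s, z, t))
    (dX * 'D_ex g (X s, Y s, z, t) + dY * 'D_ey g (X s, Y s, z, t)).
Proof.
move=> oA sg [X1 X2] [Y1 Y2] As.
have [dg dgE] := smooth_differentiable oA sg As.
have dfX : differentiable X s by exact/derivable1_diffP.
have dfY : differentiable Y s by exact/derivable1_diffP.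
pose c := fun s : R => (X s, Y s, z, t) : ST R.
have dXY : differentiable (fun s : R => (X s, Y s) : R * R) s.
  exact: differentiable_pair.
have dXYz : differentiable (fun s : R => (X s, Y s, z) : R * R * R) s.
  by apply: differentiable_pair => //; exact: differentiable_cst.
have dc : differentiable c s.
  by apply: differentiable_pair => //; exact: differentiable_cst.
have dcE : 'd c s 1 = (dX, dY, 0, 0).
  rewrite (diff_pair dXYz (differentiable_cst _ _)) /=.
  rewrite (diff_pair dXY (differentiable_cst _ _)) /=.
  rewrite (diff_pair dfX dfY) /= !diff_cst.
  by rewrite -!deriveE// X2 Y2.
have dgc : differentiable (g \o c) s by exact: differentiable_comp.
split; first by apply: diff_derivable.
rewrite -[LHS]/('D_1 (g \o c) s) deriveE// diff_comp//= dcE dgE /partial_diff/=.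
by rewrite !mul0r !addr0.
Qed.

End Coordinates.

(** * Partial derivatives and axial symmetry *)

Section Curves.
Context {R : realType}.
Implicit Types (g h : ST R -> R) (p q v : ST R) (A : set (ST R)) (x y z t : R).

Lemma is_derive_of_line g p v (d : R) :
  is_derive (0 : R) 1 (fun s : R => g (p + s *: v)) d -> is_derive p v g d.
Proof.
move=> [D1 D2]; have p0 : p + 0 *: v = p by rewrite scale0r addr0.
split; first by have := (@derivable_line _ _ g p v 0).2 D1; rewrite p0.
by rewrite -D2 derive_line p0.
Qed.

Lemma is_derive_affine (a b s : R) : is_derive s 1 (fun s : R => a + s * b) b.
Proof.
have D : is_derive s 1 (fun s : R => cst a s + b *: id s) (0 + b *: 1).
  exact: is_deriveD.
rewrite (_ : (fun s : R => a + s * b) = (fun s : R => cst a s + b *: id s)).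
  by apply: is_derive_eq; rewrite add0r [LHS]mulr1.
by apply/funext => k /=; rewrite mulrC.
Qed.

Lemma is_derive_x p v : is_derive p v (fun q : ST R => q.1.1.1) v.1.1.1.
Proof. exact/is_derive_of_line/is_derive_affine. Qed.

Lemma is_derive_y p v : is_derive p v (fun q : ST R => q.1.1.2) v.1.1.2.
Proof. exact/is_derive_of_line/is_derive_affine. Qed.

End Curves.

(** The coordinate derivatives are sealed: comparing two of them never unfolds
    the underlying limits. *)
Inductive axis := aX | aY | aZ | aT.

Definition vec {R : realType} (d : axis) : ST R :=
  match d with aX => ex | aY => ey | aZ => ez | aT => et end.

Fact pd_key : unit. Proof. exact: tt. Qed.

Definition pd {R : realType} (d : axis) (g : ST R -> R) (p : ST R) : R :=
  locked_with pd_key (derive g p (vec d)).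

Section Partial.
Context {R : realType}.
Implicit Types (g h : ST R -> R) (p q : ST R) (A : set (ST R)) (x y z t : R).
Implicit Types (d : axis).

Lemma pdE d g p : pd d g p = 'D_(vec d) g p.
Proof. by rewrite /pd unlock. Qed.

Lemma pdEfun d g : pd d g = 'D_(vec d) g.
Proof. by apply/funext => p; rewrite pdE. Qed.

Lemma dxE (i : 'I_3) g p : dx i g p =
  pd (match val i with 0%N => aX | 1%N => aY | _ => aZ end) g p.
Proof. by rewrite pdE; move: i; apply: ord3P. Qed.

Lemma dtE' g p : dt g p = pd aT g p.
Proof. by rewrite pdE. Qed.

Lemma pd_smooth A d g : smooth_on A g -> smooth_on A (pd d g).
Proof. by move=> sg; rewrite pdEfun; exact: smooth_D. Qed.

Lemma is_derive_pd A d g p : smooth_on A g -> A p ->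
  is_derive p (vec d) g (pd d g p).
Proof.
by move=> sg Ap; rewrite pdE; apply: derivableP; exact: (smooth_derivable sg Ap).
Qed.

Lemma is_derive_pdE d g p (l : R) : is_derive p (vec d) g l -> pd d g p = l.
Proof. by move=> D; rewrite pdE; exact: derive_val. Qed.

Lemma pd_comm A d e g p : open A -> smooth_on A g -> A p ->
  pd d (pd e g) p = pd e (pd d g) p.
Proof. by move=> oA sg Ap; rewrite !pdE !pdEfun; exact: derive_comm oA sg Ap. Qed.

Lemma near_open A p : open A -> A p -> \forall q \near p, A q.
Proof. by move=> oA Ap; exact: open_nbhs_nbhs. Qed.

Lemma eq_pd A d g h p : open A -> (forall q, A q -> g q = h q) -> A p ->
  pd d g p = pd d h p.
Proof.
move=> oA gh Ap; rewrite !pdE; apply: near_eq_derive.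
by near=> q; apply: gh; near: q; exact: near_open.
Unshelve. all: by end_near. Qed.

(** Coordinate lines: [upd aX (x, y, z, t) s] computes to [(s, y, z, t)], so a
    statement about [upd] specialises to each coordinate by conversion. *)
Definition upd d p (s : R) : ST R :=
  match d with aX => (s, p.1.1.2, p.1.2, p.2) | aY => (p.1.1.1, s, p.1.2, p.2)
  | aZ => (p.1.1, s, p.2) | aT => (p.1, s) end.

Lemma upd_line d p s : upd d p s = upd d p 0 + s *: vec d.
Proof.
by case: p => [[[x y] z] t]; case: d => /=;
  rewrite ?addexE ?addeyE ?addezE ?addetE add0r.
Qed.

Lemma is_derive_upd d p h (l : R) s :
  is_derive (upd d p s) (vec d) h l -> is_derive s 1 (fun s => h (upd d p s)) l.
Proof.
move=> [D1 <-].
rewrite (_ : (fun s => h (upd d p s)) = (fun s => h (upd d p 0 + s *: vec d))).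
  have := @is_derive_line _ _ h (upd d p 0) (vec d) s.
  by rewrite -upd_line; exact.
by apply/funext => k; rewrite upd_line.
Qed.

Lemma is_derive_X A g x y z t : smooth_on A g -> A (x, y, z, t) ->
  is_derive x 1 (fun s : R => g (s, y, z, t)) (pd aX g (x, y, z, t)).
Proof.
by move=> sg Ap; exact: (@is_derive_upd aX (x, y, z, t) _ _ _ (is_derive_pd aX sg Ap)).
Qed.

Lemma is_derive_Y A g x y z t : smooth_on A g -> A (x, y, z, t) ->
  is_derive y 1 (fun s : R => g (x, s, z, t)) (pd aY g (x, y, z, t)).
Proof.
by move=> sg Ap; exact: (@is_derive_upd aY (x, y, z, t) _ _ _ (is_derive_pd aY sg Ap)).
Qed.

Lemma is_derive_Z A g x y z t : smooth_on A g -> A (x, y, z, t) ->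
  is_derive z 1 (fun s : R => g (x, y, s, t)) (pd aZ g (x, y, z, t)).
Proof.
by move=> sg Ap; exact: (@is_derive_upd aZ (x, y, z, t) _ _ _ (is_derive_pd aZ sg Ap)).
Qed.

Lemma is_derive_T A g x y z t : smooth_on A g -> A (x, y, z, t) ->
  is_derive t 1 (fun s : R => g (x, y, z, s)) (pd aT g (x, y, z, t)).
Proof.
by move=> sg Ap; exact: (@is_derive_upd aT (x, y, z, t) _ _ _ (is_derive_pd aT sg Ap)).
Qed.

Lemma chain_pd A g (X Y : R -> R) (s dX dY z t : R) : open A -> smooth_on A g ->
  is_derive s 1 X dX -> is_derive s 1 Y dY -> A (X s, Y s, z, t) ->
  is_derive s 1 (fun s => g (X s, Y s, z, t))
    (dX * pd aX g (X s, Y s, z, t) + dY * pd aY g (X s, Y s, z, t)).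
Proof. by move=> oA sg DX DY As; rewrite !pdE; exact: (chain_xy oA sg). Qed.

Lemma smooth_sub A g h : open A -> smooth_on A g -> smooth_on A h ->
  smooth_on A (fun p => g p - h p).
Proof.
move=> oA sg sh.
have E vs p : A p -> Defs.iterD vs (fun p => g p - h p) p =
    Defs.iterD vs g p - Defs.iterD vs h p.
  elim: vs p => [//|v vs IH] p Ap /=.
  rewrite -deriveB; [|exact: (sg vs p Ap).2|exact: (sh vs p Ap).2].
  apply: near_eq_derive; near=> q; rewrite IH//; near: q; exact: near_open.
move=> vs p Ap; have [cg dg] := sg vs p Ap; have [ch dh] := sh vs p Ap.
have nE : \near p, Defs.iterD vs g p - Defs.iterD vs h p =
    Defs.iterD vs (fun p => g p - h p) p.
  by near=> q; rewrite E//; near: q; exact: near_open.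
split.
  rewrite /prop_for /continuous_at E//.
  by apply: cvg_trans (cvgB cg ch); apply: near_eq_cvg.
move=> v; apply: near_eq_derivable nE _.
exact: derivableB.
Unshelve. all: by end_near. Qed.

(** The angular derivative about the [z]-axis. *)
Definition dth g : ST R -> R := fun p =>
  p.1.1.1 * pd aY g p - p.1.1.2 * pd aX g p.

Lemma derive_dth A d g p : open A -> smooth_on A g -> A p ->
  pd d (dth g) p = dth (pd d g) p +
    ((vec d : ST R).1.1.1 * pd aY g p - (vec d : ST R).1.1.2 * pd aX g p).
Proof.
move=> oA sg Ap; apply: is_derive_pdE.
have Dy := is_derive_pd d (pd_smooth aY sg) Ap.
have Dx := is_derive_pd d (pd_smooth aX sg) Ap.
have D := is_deriveB (is_deriveM (is_derive_x p (vec d)) Dy)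
                     (is_deriveM (is_derive_y p (vec d)) Dx).
apply: is_derive_eq D _.
rewrite /dth (pd_comm aY d oA sg Ap) (pd_comm aX d oA sg Ap).
generalize (pd d (pd aY g) p) (pd d (pd aX g) p) (pd aY g p) (pd aX g p).
move=> a b c e; rewrite /GRing.scale/=; ring.
Qed.

(** The angular derivative commutes with a coordinate derivative up to the
    rotation of the direction of the latter. *)
Lemma dth_pd A d g h p : open A -> smooth_on A g ->
  (forall q, A q -> dth g q = h q) -> A p ->
  dth (pd d g) p = pd d h p -
   ((vec d : ST R).1.1.1 * pd aY g p - (vec d : ST R).1.1.2 * pd aX g p).
Proof.
move=> oA sg gh Ap.
by rewrite -(eq_pd d oA gh Ap) (derive_dth d oA sg Ap) addrK.
Qed.

End Partial.

Section Axisymmetry.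
Context {R : realType}.
Implicit Types (u : ST R -> R3 R) (x y z t : R).

Lemma normsq_lt1 (v : R3 R) :
  B 1 v <-> v.1.1 ^+ 2 + v.1.2 ^+ 2 + v.2 ^+ 2 < 1.
Proof.
rewrite /B/= /norm3 /dot sum3 /comp3/= -!expr2.
have n0 : 0 <= v.1.1 ^+ 2 + v.1.2 ^+ 2 + v.2 ^+ 2.
  by rewrite !addr_ge0// sqr_ge0.
by rewrite -[X in _ < X <-> _]sqrtr1 ltr_sqrt.
Qed.

Lemma QE x y z t :
  Q (x, y, z, t) <-> x ^+ 2 + y ^+ 2 + z ^+ 2 < 1 /\ -1 < t < 0.
Proof. by rewrite /Q/= normsq_lt1. Qed.

Lemma open_lt_fun (T : topologicalType) (f : T -> R) (a : R) :
  continuous f -> open [set p | f p < a].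
Proof.
move=> cf; rewrite (_ : [set p | _] = f @^-1` [set s | s < a])//.
by apply: open_comp => [p _|]; [exact: cf|exact: open_lt].
Qed.

Lemma open_gt_fun (T : topologicalType) (f : T -> R) (a : R) :
  continuous f -> open [set p | a < f p].
Proof.
move=> cf; rewrite (_ : [set p | _] = f @^-1` [set s | a < s])//.
by apply: open_comp => [p _|]; [exact: cf|exact: open_gt].
Qed.

Lemma continuous_x : continuous (fun p : ST R => p.1.1.1).
Proof.
move=> p.
have c1 : (fun p : ST R => p.1) @ p --> p.1 by exact: cvg_fst.
have c2 : (fun p : R3 R => p.1) @ p.1 --> p.1.1 by exact: cvg_fst.
have c3 : (fun p : R * R => p.1) @ p.1.1 --> p.1.1.1 by exact: cvg_fst.
exact: (cvg_comp _ _ (cvg_comp _ _ c1 c2) c3).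
Qed.

Lemma continuous_y : continuous (fun p : ST R => p.1.1.2).
Proof.
move=> p.
have c1 : (fun p : ST R => p.1) @ p --> p.1 by exact: cvg_fst.
have c2 : (fun p : R3 R => p.1) @ p.1 --> p.1.1 by exact: cvg_fst.
have c3 : (fun p : R * R => p.2) @ p.1.1 --> p.1.1.2 by exact: cvg_snd.
exact: (cvg_comp _ _ (cvg_comp _ _ c1 c2) c3).
Qed.

Lemma continuous_z : continuous (fun p : ST R => p.1.2).
Proof.
move=> p.
have c1 : (fun p : ST R => p.1) @ p --> p.1 by exact: cvg_fst.
have c2 : (fun p : R3 R => p.2) @ p.1 --> p.1.2 by exact: cvg_snd.
exact: (cvg_comp _ _ c1 c2).
Qed.

Lemma continuous_t : continuous (fun p : ST R => p.2).
Proof. by move=> p; exact: cvg_snd. Qed.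

Definition normsq (p : ST R) : R := p.1.1.1 ^+ 2 + p.1.1.2 ^+ 2 + p.1.2 ^+ 2.

Lemma continuous_normsq : continuous normsq.
Proof.
have sq (f : ST R -> R) : continuous f -> continuous (fun p => f p ^+ 2).
  by move=> cf p; exact: (cvgM (cf p) (cf p)).
move=> p; apply: cvgD; [apply: cvgD|].
- exact: (sq _ continuous_x).
- exact: (sq _ continuous_y).
- exact: (sq _ continuous_z).
Qed.

Lemma open_Q : open (@Q R).
Proof.
have -> : @Q R = [set p | normsq p < 1] `&`
    ([set p : ST R | -1 < p.2] `&` [set p : ST R | p.2 < 0]).
  apply/seteqP; split => -[[[x y] z] t] /=.
    by move/QE => [n /andP[t1 t0]].
  by move=> [n [t1 t0]]; apply/QE; rewrite t1 t0.
apply: openI; first exact/open_lt_fun/continuous_normsq.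
apply: openI; [exact/open_gt_fun/continuous_t|exact/open_lt_fun/continuous_t].
Qed.

Lemma rotzK (th : R) (v : R3 R) : rotz (- th) (rotz th v) = v.
Proof.
case: v => [[x y] z]; rewrite /rotz /= cosN sinN.
have E := cos2Dsin2 th.
congr (_, _, _).
  transitivity ((cos th ^+ 2 + sin th ^+ 2) * x); first by ring.
  by rewrite E mul1r.
transitivity ((cos th ^+ 2 + sin th ^+ 2) * y); first by ring.
by rewrite E mul1r.
Qed.

Lemma rot_normsq (th x y z t : R) :
  normsq (cos th * x - sin th * y, sin th * x + cos th * y, z, t) =
  normsq (x, y, z, t).
Proof.
rewrite /normsq/=.
transitivity ((cos th ^+ 2 + sin th ^+ 2) * (x ^+ 2 + y ^+ 2) + z ^+ 2).
  by ring.
by rewrite cos2Dsin2 mul1r.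
Qed.

Lemma rot_Q (th x y z t : R) : Q (x, y, z, t) ->
  Q (cos th * x - sin th * y, sin th * x + cos th * y, z, t).
Proof.
move=> /QE[n tt]; apply/QE; split=> //.
by have := rot_normsq th x y z t; rewrite /normsq/= => ->.
Qed.

Section Field.
Variable u : ST R -> R3 R.
Hypothesis u_axi : axisymmetric u.

Definition F i : ST R -> R := comp3 i \o u.

Lemma axi_rot (th x y z t : R) : Q (x, y, z, t) ->
  let p' := (cos th * x - sin th * y, sin th * x + cos th * y, z, t) in
  [/\ F i0 p' = cos th * F i0 (x, y, z, t) - sin th * F i1 (x, y, z, t),
      F i1 p' = sin th * F i0 (x, y, z, t) + cos th * F i1 (x, y, z, t) &
      F i2 p' = F i2 (x, y, z, t)].
Proof.
move=> Qp p'.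
have := u_axi th (rot_Q th Qp).
have -> : (rotz (- th) (cos th * x - sin th * y, sin th * x + cos th * y, z)) =
   (x, y, z) by exact: (rotzK th (x, y, z)).
rewrite /F /p' /comp3/= => <-; rewrite /rotz.
by case: (u (x, y, z, t)) => [[a b] c].
Qed.

Lemma cos_is_derive0 (a b : R) :
  is_derive (0 : R) 1 (fun s => cos s * a - sin s * b) (- b).
Proof.
have D : is_derive (0 : R) 1 (fun s => cos s * a - sin s * b)
   (cos 0 *: (0 : R) + a *: - sin 0 - (sin 0 *: (0 : R) + b *: cos 0)).
  exact: is_deriveB.
by apply: is_derive_eq D _; rewrite sin0 cos0 /GRing.scale/=; ring.
Qed.

Lemma sin_is_derive0 (a b : R) :
  is_derive (0 : R) 1 (fun s => sin s * a + cos s * b) a.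
Proof.
have D : is_derive (0 : R) 1 (fun s => sin s * a + cos s * b)
   (sin 0 *: (0 : R) + a *: cos 0 + (cos 0 *: (0 : R) + b *: - sin 0)).
  exact: is_deriveD.
by apply: is_derive_eq D _; rewrite sin0 cos0 /GRing.scale/=; ring.
Qed.

Lemma dth_rot (g : ST R -> R) x y z t : smooth_on Q g -> Q (x, y, z, t) ->
  is_derive (0 : R) 1 (fun s => g (cos s * x - sin s * y,
     sin s * x + cos s * y, z, t)) (dth g (x, y, z, t)).
Proof.
move=> sg Qp.
have := chain_pd (z := z) (t := t) open_Q sg (cos_is_derive0 x y) (sin_is_derive0 x y).
rewrite sin0 cos0 !mul0r !mul1r subr0 add0r => /(_ Qp) D.
apply: is_derive_eq D _; rewrite /dth/=.
by generalize (pd aX g (x, y, z, t)) (pd aY g (x, y, z, t)) => a b; ring.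
Qed.

Hypothesis u_sm : forall i, smooth_on Q (F i).

(** Axial symmetry differentiated at the angle zero: the angular derivative acts
    on the Cartesian components as the infinitesimal rotation. *)
Lemma dthF0 p : Q p -> dth (F i0) p = - F i1 p.
Proof.
case: p => [[[x y] z] t] Qp.
rewrite -(@derive_val _ _ _ _ _ _ _ (dth_rot (u_sm i0) Qp)).
under eq_fun do rewrite (let: And3 E _ _ := axi_rot _ Qp in E).
exact: (@derive_val _ _ _ _ _ _ _ (cos_is_derive0 _ _)).
Qed.

Lemma dthF1 p : Q p -> dth (F i1) p = F i0 p.
Proof.
case: p => [[[x y] z] t] Qp.
rewrite -(@derive_val _ _ _ _ _ _ _ (dth_rot (u_sm i1) Qp)).
under eq_fun do rewrite (let: And3 _ E _ := axi_rot _ Qp in E).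
exact: (@derive_val _ _ _ _ _ _ _ (sin_is_derive0 _ _)).
Qed.

Lemma dthF2 p : Q p -> dth (F i2) p = 0.
Proof.
case: p => [[[x y] z] t] Qp.
rewrite -(@derive_val _ _ _ _ _ _ _ (dth_rot (u_sm i2) Qp)).
under eq_fun do rewrite (let: And3 _ _ E := axi_rot _ Qp in E).
exact: derive_cst.
Qed.

End Field.
End Axisymmetry.

(** * Smooth cut-off functions *)

Section Bump.
Context {R : realType}.

(** Derivatives of [exp (- 1 / x)] on the positive half-line are combinations of
    these functions, and extending them by zero keeps them differentiable. *)
Definition flat (n : nat) (x : R) : R :=
  if 0 < x then x ^- n * expR (- x^-1) else 0.

Lemma flat_le0 n x : x <= 0 -> flat n x = 0.
Proof. by move=> x0; rewrite /flat ltNge x0. Qed.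

Lemma flat_gt0 n x : 0 < x -> 0 < flat n x.
Proof. by move=> x0; rewrite /flat x0 mulr_gt0 ?expR_gt0// invr_gt0 exprn_gt0. Qed.

Lemma flat_bound n x : `|flat n x| <= n.+1`!%:R * `|x|.
Proof.
have [x0|x0] := leP x 0; first by rewrite flat_le0// normr0 mulr_ge0.
rewrite gtr0_norm ?flat_gt0// gtr0_norm// /flat x0 expRN.
have xV0 : 0 < x^-1 by rewrite invr_gt0.
have e1 : x^-1 ^+ n.+1 / n.+1`!%:R <= expR x^-1.
  apply: le_trans (expR_ge1Dxn n (ltW xV0)); by rewrite lerDr.
have f0 : 0 < n.+1`!%:R :> R by rewrite ltr0n fact_gt0.
rewrite ler_pdivrMr ?expR_gt0//; apply: le_trans (_ : n.+1`!%:R * x *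
    (x^-1 ^+ n.+1 / n.+1`!%:R) <= _); last by rewrite ler_wpM2l// mulr_ge0 ?ltW.
rewrite exprVn exprSr invfM le_eqVlt; apply/orP; left; apply/eqP.
by field; rewrite !gt_eqF// exprn_gt0.
Qed.

(** At the origin the difference quotient of [flat n] is [flat n.+1], which tends
    to zero. *)
Lemma is_derive_flat n (x : R) :
  is_derive x 1 (flat n) (flat n.+2 x - n%:R * flat n.+1 x).
Proof.
have [x0|x0|->] := ltgtP x 0.
- rewrite !flat_le0 ?(ltW x0)// mulr0 subr0.
  apply: (@near_eq_is_derive R R R (cst 0)).
  near=> y; rewrite flat_le0//= ltW//; near: y; exact: lt_nbhsl.
- have xn0 : x != 0 by rewrite gt_eqF.
  have DV : is_derive x 1 (fun y : R => y^-1) (- x ^- 2 *: (1 : R)).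
    exact: is_deriveV.
  have DX : is_derive x 1 (fun y : R => y^-1 ^+ n)
      (n%:R * x^-1 ^+ n.-1 *: (- x ^- 2 *: (1 : R))).
    have -> : (fun y : R => y^-1 ^+ n) = (fun y : R => y^-1) ^+ n.
      by apply/funext => y; rewrite exprfctE.
    exact: is_deriveX.
  have DE : is_derive x 1 (fun y : R => expR (- y^-1))
      (expR (- x^-1) * - (- x ^- 2 *: (1 : R))).
    have DN := is_deriveN DV.
    exact: (is_derive1_comp (is_derive_expR _) DN).
  have D := is_deriveM DX DE.
  have nE : \near x, ((fun y : R => y^-1 ^+ n) * (fun y : R => expR (- y^-1))) x =
      flat n x.
    near=> y; rewrite /flat ifT; last by near: y; exact: lt_nbhsr.
    by rewrite -exprVn.
  apply: (near_eq_is_derive nE); apply: is_derive_eq D _; rewrite /flat x0 /GRing.scale/=.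
  clear -xn0; case: n => [|n] /=.
    by rewrite !expr0; field.
  rewrite -!exprVn !exprS; move: (expR _) => E.
  by field.
- rewrite !flat_le0// mulr0 subr0.
  have E : (fun h : R => h^-1 *: ((flat n \o shift 0) (h *: 1) - flat n 0)) =
      flat n.+1.
    apply/funext => h /=; rewrite [h *: 1]mulr1 addr0 [flat n 0]flat_le0// subr0.
    rewrite /flat; case: ifP => h0; last by rewrite [LHS]mulr0.
    by rewrite [LHS]mulrA exprS invfM.
  have L : flat n.+1 @ (0 : R)^' --> (0 : R).
    apply/cvgrPdist_le => eps e0.
    have f0 : 0 < n.+2`!%:R :> R by rewrite ltr0n fact_gt0.
    near=> h; rewrite sub0r normrN; apply: le_trans (flat_bound _ _) _.
    rewrite -ler_pdivlMl//; near: h.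
    apply: cvg_within; apply/nbhs_normP; exists (n.+2`!%:R^-1 * eps).
      by rewrite /= mulr_gt0// invr_gt0.
    by move=> h; rewrite /ball_/= sub0r normrN => /ltW.
  split; first by rewrite /derivable E; apply/cvg_ex; exists 0.
  by rewrite /derive E; apply: cvg_lim.
Unshelve. all: by end_near. Qed.

End Bump.

Section BumpAlgebra.
Context {R : realType}.

(** A class closed under all directional derivatives, hence of smooth functions,
    by induction on the number of derivatives. *)
Inductive bump_alg : (ST R -> R) -> Prop :=
| bump_flat n (l L : ST R -> R) : continuous l ->
    (forall p v h, l (p + h *: v) = l p + h * L v) ->
    bump_alg (fun p => flat n (l p))
| bump_cst c : bump_alg (fun=> c)
| bump_add f g : bump_alg f -> bump_alg g -> bump_alg (fun p => f p + g p)
| bump_mul f g : bump_alg f -> bump_alg g -> bump_alg (fun p => f p * g p).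

Lemma flat_continuous n : continuous (@flat R n).
Proof.
move=> x; apply: differentiable_continuous; apply/derivable1_diffP.
by have [] := is_derive_flat n x.
Qed.

Lemma bump_continuous f : bump_alg f -> continuous f.
Proof.
elim=> {f} [n l L cl _|c|f g _ cf _ cg|f g _ cf _ cg] p.
- exact: (@continuous_comp _ _ _ l (flat n) p (cl p) (@flat_continuous n _)).
- exact: cvg_cst.
- exact: (cvgD (cf p) (cg p)).
- exact: (cvgM (cf p) (cg p)).
Qed.

Lemma bump_derive f v : bump_alg f ->
  exists2 f', bump_alg f' & forall p, is_derive p v f (f' p).
Proof.
elim=> {f} [n l L cl lL|c|f g bf [f' bf' Df] bg [g' bg' Dg]|
    f g bf [f' bf' Df] bg [g' bg' Dg]].
- exists (fun p => L v * (flat n.+2 (l p) + (- n%:R) * flat n.+1 (l p))).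
    apply: bump_mul; first exact: bump_cst.
    apply: bump_add; first exact: bump_flat lL.
    by apply: bump_mul; [exact: bump_cst|exact: bump_flat lL].
  move=> p; apply: is_derive_of_line.
  have -> : (fun s : R => flat n (l (p + s *: v))) =
      flat n \o (fun s : R => l p + s * L v).
    by apply/funext => s /=; rewrite lL.
  have D0 : is_derive (l p + 0 * L v) 1 (@flat R n)
     (flat n.+2 (l p) - n%:R * flat n.+1 (l p)).
    by rewrite mul0r addr0; exact: is_derive_flat.
  have D := @is_derive1_comp R (flat n) (fun s : R => l p + s * L v) 0 _ _ D0
    (is_derive_affine (l p) (L v) 0).
  by apply: is_derive_eq D _; rewrite mulrC mulNr.
- exists (fun=> 0); first exact: bump_cst.
  by move=> p; exact: is_derive_cst.
- exists (fun p => f' p + g' p); first exact: bump_add.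
  by move=> p; exact: (is_deriveD (Df p) (Dg p)).
- exists (fun p => f p * g' p + g p * f' p).
    by apply: bump_add; apply: bump_mul.
  by move=> p; exact: (is_deriveM (Df p) (Dg p)).
Qed.

Lemma bump_iterD f vs : bump_alg f -> bump_alg (Defs.iterD vs f).
Proof.
move=> bf; elim: vs => [//|v vs IH] /=.
have [f' bf' Df] := bump_derive v IH.
suff -> : 'D_v (Defs.iterD vs f) = f' by [].
by apply/funext => p; apply: derive_val.
Qed.

Lemma bump_smooth f : bump_alg f -> smooth_on setT f.
Proof.
move=> bf vs p _; have b := bump_iterD vs bf; split.
  exact: (bump_continuous b).
by move=> v; have [f' _ Df] := bump_derive v b; have [] := Df p.
Qed.

Definition box (p : ST R) (e : R) : set (ST R) := [set q |
  [/\ `|q.1.1.1 - p.1.1.1| <= e, `|q.1.1.2 - p.1.1.2| <= e,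
      `|q.1.2 - p.1.2| <= e & `|q.2 - p.2| <= e]].

Lemma boxP (p q : ST R) (e : R) : box p e q <-> `|q - p| <= e.
Proof.
case: p q => [[[x y] z] t] [[[x' y'] z'] t'].
have -> : (x', y', z', t') - (x, y, z, t) = (x' - x, y' - y, z' - z, t' - t) :> ST R by [].
rewrite normSTE !ge_max /box/=; split.
  by move=> [-> -> -> ->].
by move=> /andP[/andP[/andP[-> ->] ->] ->].
Qed.

(** A smooth nonnegative cut-off, positive at [p] and supported in a cube. *)
Definition bump1 (l : ST R -> R) (c e : R) (q : ST R) : R :=
  flat 0 (e - c + l q) * flat 0 (e + c - l q).

Definition bump (p : ST R) (e : R) (q : ST R) : R :=
  bump1 (fun q => q.1.1.1) p.1.1.1 e q * bump1 (fun q => q.1.1.2) p.1.1.2 e q *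
  (bump1 (fun q => q.1.2) p.1.2 e q * bump1 (fun q => q.2) p.2 e q).

Lemma bump1_alg (l : ST R -> R) c e : continuous l ->
  (forall p v h, l (p + h *: v) = l p + h * l v) -> bump_alg (bump1 l c e).
Proof.
move=> cl lL; apply: bump_mul.
  apply: (@bump_flat 0 (fun q => e - c + l q) l).
    by move=> q; apply: cvgD; [exact: cvg_cst|exact: cl].
  by move=> p v h; rewrite lL addrA.
apply: (@bump_flat 0 (fun q => e + c - l q) (fun q => - l q)).
  by move=> q; apply: cvgB; [exact: cvg_cst|exact: cl].
by move=> p v h; rewrite lL; ring.
Qed.

Lemma bump_bump_alg p e : bump_alg (bump p e).
Proof.
apply: bump_mul; apply: bump_mul; apply: bump1_alg => //.
- exact: continuous_x.
- exact: continuous_y.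
- exact: continuous_z.
- exact: continuous_t.
Qed.

Lemma flat_ge0 n (x : R) : 0 <= flat n x.
Proof.
by have [x0|x0] := leP x 0; [rewrite flat_le0|rewrite ltW// flat_gt0].
Qed.

Lemma bump_ge0 p e q : 0 <= bump p e q.
Proof. by rewrite !mulr_ge0// flat_ge0. Qed.

Lemma bump_gt0 p e : 0 < e -> 0 < bump p e p.
Proof. by move=> e0; rewrite !mulr_gt0// flat_gt0// ?subrK// ?addrK. Qed.

Lemma bump1_out l c e q : ~ (`|l q - c| <= e) -> bump1 l c e q = 0.
Proof.
move=> /negP; rewrite -ltNge lter_normr => /orP[h|h]; rewrite /bump1.
  by rewrite [X in _ * X]flat_le0 ?mulr0//; lra.
by rewrite [X in X * _]flat_le0 ?mul0r//; lra.
Qed.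

Lemma bump_out p e q : ~ box p e q -> bump p e q = 0.
Proof.
move=> nb; rewrite /bump.
have [h1|h1] := pselect (`|q.1.1.1 - p.1.1.1| <= e); last first.
  by rewrite bump1_out ?mul0r.
have [h2|h2] := pselect (`|q.1.1.2 - p.1.1.2| <= e); last first.
  by rewrite [X in _ * X * _]bump1_out ?mulr0 ?mul0r.
have [h3|h3] := pselect (`|q.1.2 - p.1.2| <= e); last first.
  by rewrite [X in _ * (X * _)]bump1_out ?mul0r ?mulr0.
have [h4|h4] := pselect (`|q.2 - p.2| <= e); last first.
  by rewrite [X in _ * (_ * X)]bump1_out ?mulr0.
by case: nb.
Qed.

Lemma box_itv (x c e : R) : (`|x - c| <= e) = (x \in `[c - e, c + e]%R).
Proof. by rewrite ler_distl in_itv. Qed.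

Lemma box_compact p e : compact (box p e).
Proof.
have -> : box p e = `[p.1.1.1 - e, p.1.1.1 + e] `*` `[p.1.1.2 - e, p.1.1.2 + e] `*`
    `[p.1.2 - e, p.1.2 + e] `*` `[p.2 - e, p.2 + e].
  apply/seteqP; split=> q /=; rewrite /box/= !box_itv.
    by move=> [].
  by move=> [[[]]].
by do 3 (apply: compact_setX; last exact: segment_compact); exact: segment_compact.
Qed.

Lemma bump_test p e : box p e `<=` Q -> test_function Q (bump p e).
Proof.
move=> bQ; split; first exact/bump_smooth/bump_bump_alg.
exists (box p e); split=> //; first exact: box_compact.
exact: bump_out.
Qed.

End BumpAlgebra.

(** * Integration of continuous functions of compact support *)

Section Measurability.
Context {R : realType}.
Let MR : measurableType _ := measurableTypeR R.
Local Notation M2 := (MR * MR)%type.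
Local Notation M3 := (MR * MR * MR)%type.
Local Notation M4 := (MR * MR * MR * MR)%type.

Definition ratbox (i : rat * rat * rat * rat * nat) : set (ST R) :=
  let I (q : rat) := `](ratr q - i.2.+1%:R^-1), (ratr q + i.2.+1%:R^-1)[%classic : set R in
  I i.1.1.1.1 `*` I i.1.1.1.2 `*` I i.1.1.2 `*` I i.1.2.

Lemma measurable_ratbox i : measurable (ratbox i : set M4).
Proof.
by rewrite /ratbox/=; do 3 (apply: measurableX; last exact: measurable_itv);
  exact: measurable_itv.
Qed.

(** The product sigma-algebra contains the open sets because rational boxes form
    a countable base. *)
Lemma measurable_open (U : set (ST R)) : open U -> measurable (U : set M4).
Proof.
move=> oU.
have -> : U = \bigcup_i (if `[< ratbox i `<=` U >] then ratbox i else set0).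
  apply/seteqP; split => [p Up|p [i _]]; last first.
    by case: ifPn => // /asboolP; apply.
  have [e e0 He] := open_ball_in oU Up.
  have /ltr_add_invr : 0 < e / 2 by rewrite divr_gt0.
  move=> [n]; rewrite add0r => ne.
  have n0 : 0 < n.+1%:R^-1 :> R by rewrite invr_gt0.
  have rq (x : R) : exists q : rat, `|ratr q - x| < n.+1%:R^-1.
    have xn : x - n.+1%:R^-1 < x + n.+1%:R^-1 by rewrite ltrBlDr -addrA ltrDl addr_gt0.
    have [q] := rat_in_itvoo xn; rewrite in_itv/= => /andP[q1 q2].
    by exists q; rewrite ltr_distl q1 q2.
  case: p Up He => [[[x y] z] t] Up He.
  have [q1 h1] := rq x; have [q2 h2] := rq y.
  have [q3 h3] := rq z; have [q4 h4] := rq t.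
  have subU : ratbox (q1, q2, q3, q4, n) `<=` U.
    move=> [[[x' y'] z'] t'] [[[/= a1 a2] a3] a4]; apply: He.
    move: a1 a2 a3 a4; rewrite !in_itv/= -!ltr_distl => a1 a2 a3 a4.
    have H (a b c : R) : `|a - b| < n.+1%:R^-1 -> `|b - c| < n.+1%:R^-1 -> `|a - c| < e.
      move=> ab bc; have -> : a - c = (a - b) + (b - c) by ring.
      apply: le_lt_trans (ler_normD _ _) _.
      by rewrite (splitr e) ltrD// (lt_trans _ ne).
    by apply: normST_lt => /=; [exact: H a1 h1|exact: H a2 h2|exact: H a3 h3|exact: H a4 h4].
  exists (q1, q2, q3, q4, n) => //; rewrite asboolT//.
  by do ?split; rewrite /= in_itv/= -ltr_distl distrC.
apply: countable_bigcupT_measurable => // i.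
by case: ifP => // _; exact: measurable_ratbox.
Qed.

Lemma continuous_measurable4 (g : ST R -> R) : continuous g ->
  measurable_fun setT (g : M4 -> R).
Proof.
move=> /continuousP cg; apply: (measurability _ (measurable_realfun.RGenOpens.measurableE R)) => //.
move=> _ [_ [a [b ->] <-]]; rewrite setTI; apply: measurable_open; apply: cg.
exact: interval_open.
Qed.

End Measurability.

Section Integration.
Context {R : realType}.
Let MR : measurableType _ := measurableTypeR R.
Local Notation M2 := (MR * MR)%type.
Local Notation M3 := (MR * MR * MR)%type.
Local Notation M4 := (MR * MR * MR * MR)%type.

Lemma integrable_bounded d (T : measurableType d) (m : {measure set T -> \bar R})
    (K : T -> R) (A : set T) (M : R) : measurable A -> (m A < +oo)%E ->
  measurable_fun setT K -> (forall x, `|K x| <= M * \1_A x) ->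
  m.-integrable setT (EFin \o K).
Proof.
move=> mA Aoo mK KM.
have iA : m.-integrable setT (fun x => M%:E * (\1_A x)%:E)%E.
  apply: integrableZl => //; apply/integrableP; split.
    exact/measurable_EFinP.
  rewrite (eq_integral (fun x => (\1_A x)%:E)); last first.
    by move=> x _; rewrite gee0_abs// lee_fin.
  by rewrite integral_indic// setIT.
apply: (le_integrable measurableT _ _ iA); first exact/measurable_EFinP.
move=> x _ /=; rewrite lee_fin.
exact: le_trans (KM x) (ler_norm _).
Qed.

Section ZeroFubini.
Context d1 d2 (T1 : measurableType d1) (T2 : measurableType d2).
Variables (m1 : {sigma_finite_measure set T1 -> \bar R})
  (m2 : {sigma_finite_measure set T2 -> \bar R}) (K : T1 * T2 -> \bar R).
Hypothesis iK : (m1 \x m2)%E.-integrable setT K.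

Lemma integral_zero_fst : (forall y, \int[m1]_x K (x, y) = 0)%E ->
  (\int[m1 \x m2]_p K p = 0)%E.
Proof.
move=> K0; rewrite -(integral21_prod_meas1 iK) /=.
by apply: integral0_eq => y _; exact: K0.
Qed.

Lemma integral_zero_snd : (forall x, \int[m2]_y K (x, y) = 0)%E ->
  (\int[m1 \x m2]_p K p = 0)%E.
Proof.
move=> K0; rewrite -(integral12_prod_meas1 iK) /=.
by apply: integral0_eq => y _; exact: K0.
Qed.

End ZeroFubini.

Lemma integral_derivative0 (H K : R -> R) : continuous K ->
  (forall x : R, is_derive x 1 H (K x)) ->
  (forall x : R, 1 < `|x| -> H x = 0 /\ K x = 0) ->
  (\int[leb1]_x (K x)%:E = 0)%E.
Proof.
move=> cK HK out.
have E : (\int[leb1]_(x in `[(-2)%R, 2%R]) (K x)%:E = (H 2)%:E - (H (-2))%:E)%E.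
  apply: continuous_FTC2.
  - lra.
  - exact: continuous_subspaceT.
  - have dH x : derivable H x 1 by have [] := HK x.
    split; first by move=> x _; exact: dH.
      apply: cvg_at_right_filter; apply: differentiable_continuous.
      exact/derivable1_diffP.
    apply: cvg_at_left_filter; apply: differentiable_continuous.
    exact/derivable1_diffP.
  - by move=> x _; rewrite derive1E; exact: derive_val.
have [H2 _] := out 2 (ltac:(by rewrite gtr0_norm//; lra)).
have [Hm2 _] := out (-2) (ltac:(by rewrite normrN gtr0_norm//; lra)).
move: E; rewrite H2 Hm2 subee// => <-.
rewrite [RHS]integral_mkcond; apply: eq_integral => x _.
rewrite patchE; case: ifPn => // /negP; rewrite inE/= in_itv/= => /negP xn.
have [|_ ->//] := out x.
rewrite lter_normr; move: xn; rewrite negb_and -!ltNge => /orP[h|h]; apply/orP.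
  by right; lra.
by left; lra.
Qed.

Definition cube1 : set MR := [set x : R | `|x| <= 1].
Definition cube2 : set M2 := cube1 `*` cube1.
Definition cube3 : set M3 := cube2 `*` cube1.
Definition cube4 : set M4 := cube3 `*` cube1.

Lemma cube1E : cube1 = `[(-1)%R, 1%R]%classic.
Proof. by apply/seteqP; split=> x; rewrite /cube1 /= in_itv/= ler_norml. Qed.

Lemma mcube1 : measurable cube1.
Proof. by rewrite cube1E; exact: measurable_itv. Qed.
Lemma mcube2 : measurable cube2. Proof. by apply: measurableX; exact: mcube1. Qed.
Lemma mcube3 : measurable cube3.
Proof. by apply: measurableX; [exact: mcube2|exact: mcube1]. Qed.
Lemma mcube4 : measurable cube4.
Proof. by apply: measurableX; [exact: mcube3|exact: mcube1]. Qed.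

Lemma cube1_fin : (leb1 cube1 < +oo)%E.
Proof.
by rewrite cube1E /leb1 lebesgue_measure_itv/=; case: ifP => _; rewrite ?ltry// -EFinD ltry.
Qed.
Lemma cube2_fin : (leb2 cube2 < +oo)%E.
Proof.
rewrite /leb2 product_measure1E; [|exact: mcube1..].
by rewrite lte_mul_pinfty// ?cube1_fin// ge0_fin_numE// cube1_fin.
Qed.
Lemma cube3_fin : (leb3 cube3 < +oo)%E.
Proof.
rewrite /leb3 product_measure1E; [|exact: mcube2|exact: mcube1].
by rewrite lte_mul_pinfty// ?cube1_fin// ge0_fin_numE// cube2_fin.
Qed.
Lemma cube4_fin : (leb4 cube4 < +oo)%E.
Proof.
rewrite /leb4 product_measure1E; [|exact: mcube3|exact: mcube1].
by rewrite lte_mul_pinfty// ?cube1_fin// ge0_fin_numE// cube3_fin.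
Qed.

(** The class in which integrals are iterated: every slice is again integrable.
    The unit cube is chosen because it contains [Q]. *)
Definition cc (K : ST R -> R) : Prop :=
  continuous K /\ forall p, ~ box (0, 0, 0, 0) 1 p -> K p = 0.

Lemma box_cube p : box (0, 0, 0, 0) 1 p <-> cube4 p.
Proof.
case: p => [[[x y] z] t]; rewrite /box /cube4 /cube3 /cube2 /cube1/= !subr0.
by split=> [[]|[[[]]]].
Qed.

Lemma cc_bounded K : cc K -> exists M, forall p, `|K p| <= M.
Proof.
move=> [cK K0].
have : compact (K @` box (0, 0, 0, 0) 1).
  apply: continuous_compact; last exact: box_compact.
  exact: continuous_subspaceT.
move=> /compact_bounded [M0 [M0r HM]].
exists (`|M0| + 1) => p; have [bp|/K0 ->] := pselect (box (0, 0, 0, 0) 1 p).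
  by apply: HM; [rewrite ltr_pwDr// ler_norm|exists p].
by rewrite normr0 addr_ge0.
Qed.

Lemma cc_bound K : cc K -> exists M, forall x y z t,
  `|K (x, y, z, t)| <= M * (\1_cube1 x * \1_cube1 y * \1_cube1 z * \1_cube1 t).
Proof.
move=> cK; have [M HM] := cc_bounded cK; exists M => x y z t.
have [bp|nb] := pselect (cube4 (x, y, z, t)).
  have [[[/= h1 h2] h3] h4] := bp.
  by rewrite !indicE !mem_set// !mulr1.
rewrite (cK.2 _ (fun b => nb ((box_cube _).1 b))) normr0.
by rewrite mulr_ge0 ?(le_trans _ (HM (0,0,0,0)))// !mulr_ge0.
Qed.

Lemma indicX (T1 T2 : Type) (A : set T1) (C : set T2) x y :
  \1_(A `*` C) (x, y) = \1_A x * \1_C y :> R.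
Proof. by rewrite !indicE in_setX; case: (x \in A); case: (y \in C); rewrite ?mulr1 ?mulr0. Qed.

Lemma cc_int4 K : cc K -> leb4.-integrable setT (EFin \o (K : M4 -> R)).
Proof.
move=> cK; have [M HM] := cc_bound cK.
apply: (integrable_bounded (M := M) mcube4 cube4_fin).
  by apply: continuous_measurable4; exact: cK.1.
by move=> [[[x y] z] t]; rewrite !indicX; exact: HM.
Qed.

Lemma cc_int3 K t : cc K ->
  leb3.-integrable setT (EFin \o (fun x : M3 => K (x, t))).
Proof.
move=> cK; have [M HM] := cc_bound cK.
apply: (integrable_bounded (M := M) mcube3 cube3_fin).
  have mK := continuous_measurable4 cK.1.
  by apply: (measurableT_comp mK); exact: pair2_measurable.
move=> [[x y] z]; rewrite !indicX; apply: le_trans (HM x y z t) _.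
have M0 : 0 <= M.
  by have := HM 0 0 0 0; rewrite !indicE !mem_set ?mulr1 /cube1/= ?normr0//; apply: le_trans.
by rewrite ler_wpM2l// ler_piMr ?mulr_ge0// indicE.
Qed.

Lemma cc_int2 K z t : cc K ->
  leb2.-integrable setT (EFin \o (fun x : M2 => K (x, z, t))).
Proof.
move=> cK; have [M HM] := cc_bound cK.
apply: (integrable_bounded (M := M) mcube2 cube2_fin).
  have mK := continuous_measurable4 cK.1.
  have m1 : measurable_fun setT (fun x : M3 => K (x, t)).
    by apply: (measurableT_comp mK); exact: pair2_measurable.
  by apply: (measurableT_comp m1); exact: pair2_measurable.
move=> [x y]; rewrite !indicX; apply: le_trans (HM x y z t) _.
have M0 : 0 <= M.
  by have := HM 0 0 0 0; rewrite !indicE !mem_set ?mulr1 /cube1/= ?normr0//; apply: le_trans.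
by rewrite -!mulrA ler_wpM2l// mulrA ler_piMr ?mulr_ge0// mulr_ile1.
Qed.

End Integration.

Section IntegrationByParts.
Context {R : realType}.
Let MR : measurableType _ := measurableTypeR R.
Local Notation M2 := (MR * MR)%type.
Local Notation M3 := (MR * MR * MR)%type.
Local Notation M4 := (MR * MR * MR * MR)%type.

Lemma continuous_upd d p : continuous (upd d p : R -> ST R).
Proof.
have -> : upd d p = (fun s => upd d p 0 + s *: vec d).
  by apply/funext => k; rewrite upd_line.
move=> s; apply: cvgD; first exact: cvg_cst.
by apply: cvgZr_tmp; exact: cvg_id.
Qed.

Lemma integral_pd_slice d p (H K : ST R -> R) : cc K ->
  (forall q, ~ box (0, 0, 0, 0) 1 q -> H q = 0) ->
  (forall q, is_derive q (vec d) H (K q)) ->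
  (\int[leb1]_s (K (upd d p s))%:E = 0)%E.
Proof.
move=> [cK K0] H0 HK; apply: (@integral_derivative0 _ (fun s => H (upd d p s))).
- by move=> s; apply: continuous_comp; [exact: continuous_upd|exact: cK].
- by move=> s; apply: is_derive_upd; exact: HK.
- move=> s s1; suff nb : ~ box (0, 0, 0, 0) 1 (upd d p s).
    by split; [exact: H0|exact: K0].
  by rewrite /box; case: d {HK} => /= -[a1 a2 a3 a4];
    [move: a1|move: a2|move: a3|move: a4]; rewrite subr0 leNgt s1.
Qed.

(** With Fubini's theorem the integral is first taken along the direction of
    differentiation, where it vanishes by the fundamental theorem of calculus. *)
Lemma integral_pd0 d (H K : ST R -> R) : cc K ->
  (forall q, ~ box (0, 0, 0, 0) 1 q -> H q = 0) ->
  (forall q, is_derive q (vec d) H (K q)) ->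
  (\int[leb4]_p (K p)%:E = 0)%E.
Proof.
move=> cK H0 HK; have S := integral_pd_slice _ cK H0 HK.
case: d {HK} S => S.
- apply: (integral_zero_fst (cc_int4 cK)) => t.
  apply: (integral_zero_fst (cc_int3 t cK)) => z.
  apply: (integral_zero_fst (cc_int2 z t cK)) => y.
  exact: (S (0, y, z, t)).
- apply: (integral_zero_fst (cc_int4 cK)) => t.
  apply: (integral_zero_fst (cc_int3 t cK)) => z.
  apply: (integral_zero_snd (cc_int2 z t cK)) => x.
  exact: (S (x, 0, z, t)).
- apply: (integral_zero_fst (cc_int4 cK)) => t.
  apply: (integral_zero_snd (cc_int3 t cK)) => -[x y].
  exact: (S (x, y, 0, t)).
- apply: (integral_zero_snd (cc_int4 cK)) => -[[x y] z].
  exact: (S (x, y, z, 0)).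
Qed.

Lemma leb1_itv (c e : R) : 0 < e -> leb1 `[c - e, c + e]%classic = (2 * e)%:E.
Proof.
move=> e0; rewrite /leb1 lebesgue_measure_itv/= lte_fin ifT; last by lra.
by rewrite -EFinD; congr EFin; ring.
Qed.

Lemma integral_pos (K : ST R -> R) p : cc K -> (forall q, 0 <= K q) ->
  0 < K p -> (\int[leb4]_q (K q)%:E <> 0)%E.
Proof.
move=> cK K_ge0 Kp I0.
have Kp2 : 0 < K p / 2 by rewrite divr_gt0.
have [e e0 He] := continuous_at_eps (cK.1 p) Kp2.
case: p Kp Kp2 He => [[[x y] z] t] Kp Kp2 He.
pose J (c : R) : set MR := `[c - e / 2, c + e / 2]%classic.
have mJ c : measurable (J c) by exact: measurable_itv.
pose D : set M4 := J x `*` J y `*` J z `*` J t.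
have mJ2 : measurable (J x `*` J y : set M2) by apply: measurableX.
have mJ3 : measurable (J x `*` J y `*` J z : set M3) by apply: measurableX.
have mD : measurable D by apply: measurableX.
have e20 : 0 < e / 2 by rewrite divr_gt0.
have leb4D : leb4 D = (2 * (e / 2) * (2 * (e / 2)) * (2 * (e / 2)) * (2 * (e / 2)))%:E.
  rewrite [LHS](product_measure1E leb3 leb1 mJ3 (mJ t)).
  rewrite [X in (X * _)%E](product_measure1E leb2 leb1 mJ2 (mJ z)).
  rewrite [X in (X * _ * _)%E](product_measure1E leb1 leb1 (mJ x) (mJ y)).
  by rewrite ![in RHS]EFinM; congr (_ * _ * _ * _)%E; exact: leb1_itv.
have : (\int[leb4]_q (K (x, y, z, t) / 2 * \1_D q)%:E <= \int[leb4]_q (K q)%:E)%E.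
  apply: ge0_le_integral => //.
  - by move=> q _; rewrite lee_fin mulr_ge0// ltW.
  - by apply/measurable_EFinP; apply: measurable_funM => //.
  - by apply/measurable_EFinP; apply: continuous_measurable4; exact: cK.1.
  move=> q _; rewrite lee_fin indicE; case: (boolP (q \in D)) => [|_]; last first.
    by rewrite mulr0.
  rewrite inE => Dq; rewrite mulr1.
  have qd : `|q - (x, y, z, t)| < e.
    case: q Dq => [[[x' y'] z'] t'] [[[/= h1 h2] h3] h4].
    move: h1 h2 h3 h4; rewrite /J/= !in_itv/= -!ler_distl => h1 h2 h3 h4.
    have ee : e / 2 < e by rewrite ltr_pdivrMr// ltr_pMr// ltr1n.
    by apply: normST_lt => /=; apply: le_lt_trans ee.
  have := He q qd; rewrite ltr_distl => /andP[h _]; apply: le_trans (ltW h).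
  by rewrite {2}[K (x, y, z, t)]splitr addrK.
rewrite I0; under eq_integral do rewrite EFinM.
rewrite ge0_integralZl//; last 2 first.
- exact/measurable_EFinP.
- by rewrite lee_fin ltW.
rewrite integral_indic// setIT [X in (_ * X)%E]leb4D -EFinM lee_fin leNgt.
by rewrite !mulr_gt0.
Qed.

(** A function continuous on [Q] times a continuous function supported in a
    small cube inside [Q] is a globally continuous function of compact support. *)
Lemma cc_mul p e (a chi : ST R -> R) : box p e `<=` Q ->
  (forall q, Q q -> {for q, continuous a}) -> continuous chi ->
  (forall q, ~ box p e q -> chi q = 0) -> cc (fun q => a q * chi q).
Proof.
move=> bQ ca cchi chi0.
have closed_box : closed (box p e).
  by apply: compact_closed; [exact: norm_hausdorff|exact: box_compact].
split=> q.
  have [bq|nb] := pselect (box p e q).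
    exact: (cvgM (ca _ (bQ _ bq)) (cchi q)).
  have nq : \forall r \near q, 0 = a r * chi r.
    near=> r; rewrite chi0 ?mulr0//; near: r.
    by apply: (near_open (A := ~` box p e)) => //; exact: closed_openC.
  rewrite /continuous_at chi0// mulr0; apply: cvg_trans (near_eq_cvg nq) _.
  exact: cvg_cst.
move=> nb; rewrite chi0 ?mulr0// => bq; apply: nb.
have := bQ _ bq; case: q bq => [[[x y] z] t] _ /QE[n /andP[t1 t0]].
rewrite /box/= !subr0 (ltr0_norm t0); split; last by lra.
- rewrite -[leRHS]normr1 -ler_sqr ?nnegrE// !real_normK ?num_real//; nra.
- rewrite -[leRHS]normr1 -ler_sqr ?nnegrE// !real_normK ?num_real//; nra.
- rewrite -[leRHS]normr1 -ler_sqr ?nnegrE// !real_normK ?num_real//; nra.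
Unshelve. all: by end_near. Qed.

End IntegrationByParts.

(** * From distributions to pointwise equations *)

Section Pointwise.
Context {R : realType}.
Implicit Types (p q : ST R) (g : ST R -> R).

Lemma cc_add (K L : ST R -> R) : cc K -> cc L -> cc (fun p => K p + L p).
Proof.
move=> [cK K0] [cL L0]; split=> p; first exact: (cvgD (cK p) (cL p)).
by move=> nb; rewrite K0// L0// addr0.
Qed.

Lemma cc_opp (K : ST R -> R) : cc K -> cc (fun p => - K p).
Proof.
move=> [cK K0]; split=> p; first exact: (cvgN (cK p)).
by move=> nb; rewrite K0// oppr0.
Qed.

Definition null (K : ST R -> R) := cc K /\ (\int[leb4]_p (K p)%:E = 0)%E.

Lemma integral_cc_add (K L : ST R -> R) : cc K -> cc L ->
  (\int[leb4]_p (K p + L p)%:E = \int[leb4]_p (K p)%:E + \int[leb4]_p (L p)%:E)%E.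
Proof.
move=> cK cL; rewrite -(integralD_EFin measurableT (cc_int4 cK) (cc_int4 cL)).
by apply: eq_integral => p _; rewrite EFinD.
Qed.

Lemma integral_cc_opp (K : ST R -> R) : cc K ->
  (\int[leb4]_p (- K p)%:E = - \int[leb4]_p (K p)%:E)%E.
Proof.
move=> cK; have := integralZl measurableT (cc_int4 cK) (-1).
rewrite EFinN mulN1e => <-; apply: eq_integral => p _.
by rewrite mulN1e -EFinN.
Qed.

Lemma null_add (K L : ST R -> R) : null K -> null L -> null (fun p => K p + L p).
Proof.
move=> [cK K0] [cL L0]; split; first exact: cc_add.
by rewrite integral_cc_add// K0 L0 adde0.
Qed.

Lemma null_opp (K : ST R -> R) : null K -> null (fun p => - K p).
Proof.
move=> [cK K0]; split; first exact: cc_opp.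
by rewrite integral_cc_opp// K0 oppe0.
Qed.

Lemma null_eq (K L : ST R -> R) : null K -> (forall p, K p = L p) -> null L.
Proof. by move=> nK /funext <-. Qed.

Lemma integral_Q_cc p e (K : ST R -> R) : box p e `<=` Q ->
  (forall q, ~ box p e q -> K q = 0) ->
  (\int[leb4]_(q in Q) (K q)%:E = \int[leb4]_q (K q)%:E)%E.
Proof.
move=> bQ K0; rewrite integral_mkcond; apply: eq_integral => q _.
rewrite patchE; case: ifPn => // /negP; rewrite inE => nq.
by rewrite K0// => /bQ.
Qed.

Definition cut p e (chi : ST R -> R) :=
  bump_alg chi /\ forall q, ~ box p e q -> chi q = 0.

Lemma cut_is_derive d p e chi q : cut p e chi ->
  is_derive q (vec d) chi (pd d chi q).
Proof.
move=> [b _]; have [f' _ Df] := bump_derive (vec d) b.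
by rewrite (is_derive_pdE (Df q)).
Qed.

Lemma box_closed p e : closed (box p e).
Proof. by apply: compact_closed; [exact: norm_hausdorff|exact: box_compact]. Qed.

Lemma cut_pd d p e chi : cut p e chi -> cut p e (pd d chi).
Proof.
move=> [b c0]; split.
  have [f' bf' Df] := bump_derive (vec d) b.
  suff -> : pd d chi = f' by [].
  by apply/funext => q; exact: is_derive_pdE.
move=> q nb; rewrite (@eq_pd _ (~` box p e) d chi (fun=> 0))//.
- by apply: is_derive_pdE; exact: is_derive_cst.
- exact/closed_openC/box_closed.
Qed.

Lemma cc_cut p e (a chi : ST R -> R) : box p e `<=` Q ->
  (forall q, Q q -> {for q, continuous a}) -> cut p e chi ->
  cc (fun q => a q * chi q).
Proof.
by move=> bQ ca [b c0]; apply: (cc_mul bQ) => //; exact: bump_continuous.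
Qed.

Lemma integration_by_parts d p e (a a' chi : ST R -> R) : box p e `<=` Q ->
  (forall q, Q q -> is_derive q (vec d) a (a' q)) ->
  (forall q, Q q -> {for q, continuous a}) ->
  (forall q, Q q -> {for q, continuous a'}) -> cut p e chi ->
  null (fun q => a q * pd d chi q + chi q * a' q).
Proof.
move=> bQ Da ca ca' cchi.
have c1 := cc_cut bQ ca cchi.
have cK : cc (fun q => a q * pd d chi q + chi q * a' q).
  apply: cc_add; first by apply: (cc_cut bQ) => //; exact: cut_pd.
  rewrite (_ : (fun p => _) = (fun p => a' p * chi p)); first exact: cc_cut cchi.
  by apply/funext => q; rewrite mulrC.
split=> //; apply: (integral_pd0 (d := d) cK c1.2) => q.
have [bq|nb] := pselect (box p e q).
  exact: (is_deriveM (Da q (bQ _ bq)) (cut_is_derive d q cchi)).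
rewrite (cut_pd d cchi).2// cchi.2// mulr0 mul0r addr0.
have nE : \near q, 0 = a q * chi q.
  near=> r; rewrite cchi.2 ?mulr0//; near: r.
  by apply: (near_open (A := ~` box p e)) => //; exact/closed_openC/box_closed.
by apply: (near_eq_is_derive nE); exact: is_derive_cst.
Unshelve. all: by end_near. Qed.

(** The fundamental lemma of the calculus of variations: a continuous function
    that is positive at a point has a positive integral against a bump there. *)
Lemma variations g : (forall q, Q q -> {for q, continuous g}) ->
  (forall p e, 0 < e -> box p e `<=` Q -> null (fun q => g q * bump p e q)) ->
  forall p, Q p -> g p = 0.
Proof.
have P (h : ST R -> R) : (forall q, Q q -> {for q, continuous h}) ->
  (forall p e, 0 < e -> box p e `<=` Q -> null (fun q => h q * bump p e q)) ->
  forall p, Q p -> h p <= 0.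
  move=> ch nh p Qp; rewrite leNgt; apply/negP => hp.
  have hp2 : 0 < h p / 2 by rewrite divr_gt0.
  have [d1 d10 H1] := open_ball_in open_Q Qp.
  have [d2 d20 H2] := continuous_at_eps (ch p Qp) hp2.
  pose e := Num.min d1 d2 / 2.
  have m0 : 0 < Num.min d1 d2 by rewrite lt_min d10.
  have e0 : 0 < e by rewrite divr_gt0.
  have em : e < Num.min d1 d2 by rewrite ltr_pdivrMr// ltr_pMr// ltr1n.
  have bQ : box p e `<=` Q.
    move=> q /boxP qe; apply: H1; apply: le_lt_trans qe _.
    by apply: lt_le_trans em _; rewrite ge_min lexx.
  have [cK K0] := nh p e e0 bQ.
  apply: (integral_pos (p := p) cK _ _ K0).
    move=> q; have [/boxP qe|nb] := pselect (box p e q); last by rewrite bump_out// mulr0.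
    rewrite mulr_ge0 ?bump_ge0//.
    have := H2 q (le_lt_trans qe (lt_le_trans em _)).
    rewrite ge_min lexx orbT => /(_ isT); rewrite ltr_distl => /andP[+ _].
    by rewrite {1}[h p]splitr addrK => /(lt_trans hp2)/ltW.
  by rewrite mulr_gt0// bump_gt0.
move=> cg ng p Qp; apply/eqP; rewrite eq_le (P g)//=.
have := P (fun q => - g q) _ _ p Qp; rewrite oppr_le0; apply.
  by move=> q Qq; exact: (cvgN (cg q Qq)).
move=> p' e e0 bQ; apply: null_eq (null_opp (ng p' e e0 bQ)) _ => q.
by rewrite mulNr.
Qed.

End Pointwise.

Section ContinuityAt.
Context {R : realType} {T : topologicalType}.
Implicit Types (g h : T -> R) (q : T).

Lemma cont_add g h q : {for q, continuous g} -> {for q, continuous h} ->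
  {for q, continuous (fun p => g p + h p)}.
Proof. by move=> cg ch; exact: (cvgD cg ch). Qed.

Lemma cont_sub g h q : {for q, continuous g} -> {for q, continuous h} ->
  {for q, continuous (fun p => g p - h p)}.
Proof. by move=> cg ch; exact: (cvgB cg ch). Qed.

Lemma cont_mul g h q : {for q, continuous g} -> {for q, continuous h} ->
  {for q, continuous (fun p => g p * h p)}.
Proof. by move=> cg ch; exact: (cvgM cg ch). Qed.

End ContinuityAt.

Lemma is_derive_mul {R : realType} (g h : ST R -> R) (q v : ST R) (dg dh : R) :
  is_derive q v g dg -> is_derive q v h dh ->
  is_derive q v (fun p => g p * h p) (g q * dh + h q * dg).
Proof. by move=> Dg Dh; exact: (is_deriveM Dg Dh). Qed.

Section Equations.
Context {R : realType}.
Variables (u : ST R -> R3 R) (pi : ST R -> R) (f : ST R -> R3 R).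
Hypothesis u_sm : smooth_solution u pi f.

Let smF i : smooth_on Q (F u i). Proof. by have [H _ _] := u_sm; exact: H. Qed.
Let smpi : smooth_on Q pi. Proof. by have [] := u_sm. Qed.
Let smf i : smooth_on Q (F f i). Proof. by have [_ _ H] := u_sm; exact: H. Qed.

Definition ax (i : 'I_3) : axis :=
  match val i with 0%N => aX | 1%N => aY | _ => aZ end.

Let cont (g : ST R -> R) : smooth_on Q g -> forall q, Q q -> {for q, continuous g}.
Proof. by move=> sg q Qq; exact: smooth_continuous sg Qq. Qed.

Lemma divergence_pointwise : divergence_free_distr u -> forall p, Q p ->
  pd aX (F u i0) p + pd aY (F u i1) p + pd aZ (F u i2) p = 0.
Proof.
move=> H p Qp; move: p Qp; apply: variations.
  have c d i q : Q q -> {for q, continuous (pd d (F u i))}.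
    by move=> Qq; apply: cont Qq; apply: pd_smooth.
  by move=> q Qq; apply: cont_add; [apply: cont_add|]; apply: c.
move=> p e e0 bQ; have cphi : cut p e (bump p e).
  by split; [exact: bump_bump_alg|exact: bump_out].
have N d i := integration_by_parts bQ (fun q Qq => is_derive_pd d (smF i) Qq)
  (cont (smF i)) (cont (pd_smooth d (smF i))) cphi.
have N1 : null (fun q => F u i0 q * pd aX (bump p e) q +
   F u i1 q * pd aY (bump p e) q + F u i2 q * pd aZ (bump p e) q).
  have c d i : cc (fun q => F u i q * pd d (bump p e) q).
    exact: (cc_cut bQ (cont (smF i)) (cut_pd d cphi)).
  split; first by apply: cc_add; [apply: cc_add|].
  have := H _ (bump_test bQ); rewrite (integral_Q_cc bQ).
    move=> <-; apply: eq_integral => q _; congr EFin.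
    by rewrite sum3 !dxE.
  move=> q nb; rewrite sum3 !dxE /=.
  by rewrite !(cut_pd _ cphi).2// !mulr0 !addr0.
have := null_add (null_add (N aX i0) (N aY i1)) (null_add (N aZ i2) (null_opp N1)).
move=> NN; apply: null_eq NN _ => q.
move: (F u i0 q) (F u i1 q) (F u i2 q) => a b c.
generalize (pd aX (bump p e) q) (pd aY (bump p e) q) (pd aZ (bump p e) q).
generalize (pd aX (F u i0) q) (pd aY (F u i1) q) (pd aZ (F u i2) q) (bump p e q).
by move=> *; ring.
Qed.

Definition conv (i : 'I_3) (q : ST R) : R :=
  F u i0 q * pd aX (F u i) q + F u i1 q * pd aY (F u i) q +
  F u i2 q * pd aZ (F u i) q.

Definition lap (g : ST R -> R) (q : ST R) : R :=
  pd aX (pd aX g) q + pd aY (pd aY g) q + pd aZ (pd aZ g) q.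

(** All derivatives are moved off the test function; incompressibility turns the
    divergence form of the convective term into its usual form. *)
Lemma momentum_pointwise (i : 'I_3) : momentum_distr u pi f ->
  divergence_free_distr u -> forall p, Q p ->
  pd aT (F u i) p + conv i p - lap (F u i) p + pd (ax i) pi p = F f i p.
Proof.
move=> H Hdiv.
pose E q := pd aT (F u i) q +
  ((F u i0 q * pd aX (F u i) q + F u i q * pd aX (F u i0) q) +
   (F u i1 q * pd aY (F u i) q + F u i q * pd aY (F u i1) q) +
   (F u i2 q * pd aZ (F u i) q + F u i q * pd aZ (F u i2) q))
  - lap (F u i) q + pd (ax i) pi q - F f i q.
suff E0 : forall p, Q p -> E p = 0.
  move=> p Qp; have := E0 p Qp; have := divergence_pointwise Hdiv Qp.
  rewrite /E /conv.
  generalize (pd aX (F u i0) p) (pd aY (F u i1) p) (pd aZ (F u i2) p).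
  generalize (pd aX (F u i) p) (pd aY (F u i) p) (pd aZ (F u i) p).
  generalize (pd aT (F u i) p) (lap (F u i) p) (pd (ax i) pi p) (F f i p).
  generalize (F u i0 p) (F u i1 p) (F u i2 p) (F u i p).
  move=> a b c d t l pp ff x y z dx dy dz D0 D1.
  have D2 : d * (dx + dy + dz) = 0 by rewrite D0 mulr0.
  by lra.
apply: variations.
  move=> q Qq.
  have cF j : {for q, continuous (F u j)} by exact: (cont (smF j) Qq).
  have c d j : {for q, continuous (pd d (F u j))}.
    by exact: (cont (pd_smooth d (smF j)) Qq).
  have cc2 d j : {for q, continuous (pd d (pd d (F u j)))}.
    by exact: (cont (pd_smooth d (pd_smooth d (smF j))) Qq).
  apply: cont_sub; last exact: (cont (smf i) Qq).
  apply: cont_add; last exact: (cont (pd_smooth (ax i) smpi) Qq).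
  apply: cont_sub; last by apply: cont_add; [apply: cont_add|]; exact: cc2.
  apply: cont_add; first exact: c.
  apply: cont_add; [apply: cont_add|]; apply: cont_add; apply: cont_mul;
    by [exact: cF|exact: c].
move=> p e e0 bQ; have cphi : cut p e (bump p e).
  by split; [exact: bump_bump_alg|exact: bump_out].
set phi := bump p e in cphi *.
have c0 (g chi : ST R -> R) : smooth_on Q g -> cut p e chi -> cc (fun q => g q * chi q).
  by move=> sg cchi; exact: (cc_cut bQ (cont sg) cchi).
have c2 (g h chi : ST R -> R) : smooth_on Q g -> smooth_on Q h -> cut p e chi ->
    cc (fun q => g q * h q * chi q).
  move=> sg sh cchi; apply: (cc_cut bQ) => // q Qq.
  by apply: cont_mul; [exact: (cont sg Qq)|exact: (cont sh Qq)].
have N (d : axis) (g chi : ST R -> R) : smooth_on Q g -> cut p e chi ->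
    null (fun q => g q * pd d chi q + chi q * pd d g q).
  move=> sg cchi; apply: (integration_by_parts bQ) => //.
  - by move=> q Qq; exact: (is_derive_pd d sg Qq).
  - exact: (cont sg).
  - exact: (cont (pd_smooth d sg)).
have N2 (d : axis) (g h chi : ST R -> R) : smooth_on Q g -> smooth_on Q h ->
    cut p e chi -> null (fun q => (g q * h q) * pd d chi q +
      chi q * (g q * pd d h q + h q * pd d g q)).
  move=> sg sh cchi; apply: (integration_by_parts bQ) => //.
  - by move=> q Qq; exact: (is_derive_mul (is_derive_pd d sg Qq) (is_derive_pd d sh Qq)).
  - by move=> q Qq; apply: cont_mul; [exact: (cont sg Qq)|exact: (cont sh Qq)].
  - move=> q Qq; apply: cont_add; apply: cont_mul.
    + exact: (cont sg Qq).
    + exact: (cont (pd_smooth d sh) Qq).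
    + exact: (cont sh Qq).
    + exact: (cont (pd_smooth d sg) Qq).
pose T q := - (F u i q * pd aT phi q)
  - (F u i0 q * F u i q * pd aX phi q + F u i1 q * F u i q * pd aY phi q +
     F u i2 q * F u i q * pd aZ phi q)
  - (F u i q * pd aX (pd aX phi) q + F u i q * pd aY (pd aY phi) q +
     F u i q * pd aZ (pd aZ phi) q)
  - pi q * pd (ax i) phi q.
have cA := c0 _ _ (smF i) (cut_pd aT cphi).
have cB j d := c2 _ _ _ (smF j) (smF i) (cut_pd d cphi).
have cC d := c0 _ _ (smF i) (cut_pd d (cut_pd d cphi)).
have cP := c0 _ _ smpi (cut_pd (ax i) cphi).
have cT : cc T.
  exact: (cc_add (cc_add (cc_add (cc_opp cA)
    (cc_opp (cc_add (cc_add (cB i0 aX) (cB i1 aY)) (cB i2 aZ))))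
    (cc_opp (cc_add (cc_add (cC aX) (cC aY)) (cC aZ)))) (cc_opp cP)).
have cS : cc (fun q => F f i q * phi q) by exact: c0.
have axE g q : dx i g q = pd (ax i) g q by rewrite dxE.
have TS : null (fun q => T q - F f i q * phi q).
  split; first by apply: cc_add => //; exact: cc_opp.
  rewrite integral_cc_add//; last exact: cc_opp.
  rewrite integral_cc_opp//.
  have fS := integrable_fin_num measurableT (cc_int4 cS).
  suff -> : (\int[leb4]_q (T q)%:E = \int[leb4]_q (F f i q * phi q)%:E)%E.
    exact: subee.
  have := H _ i (bump_test bQ).
  rewrite [X in _ = X -> _](integral_Q_cc bQ); last first.
    by move=> q nb; rewrite -/phi cphi.2// mulr0.
  move=> <-; rewrite -(integral_Q_cc bQ (K := T)).
    apply: eq_integral => q _; congr EFin.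
    rewrite /T sum3 /laplacian sum3 dtE' axE !dxE /=.
    have lE (j : 'I_3) : dx j (bump p e) = pd (ax j) phi.
      by apply/funext => r; rewrite dxE.
    rewrite !lE /= /ax /=.
    by rewrite !mulrDr.
  move=> q nb.
  have z d : pd d phi q = 0 by exact: (cut_pd d cphi).2.
  have zz d d' : pd d (pd d' phi) q = 0 by exact: (cut_pd d (cut_pd d' cphi)).2.
  by rewrite /T !z !zz !mulr0 !addr0 !subr0 oppr0.
have A1 := null_add TS (N aT _ _ (smF i) cphi).
have A2 := null_add A1 (N2 aX _ _ _ (smF i0) (smF i) cphi).
have A3 := null_add A2 (N2 aY _ _ _ (smF i1) (smF i) cphi).
have A4 := null_add A3 (N2 aZ _ _ _ (smF i2) (smF i) cphi).
have A5 := null_add A4 (N aX _ _ (smF i) (cut_pd aX cphi)).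
have A6 := null_add A5 (N aY _ _ (smF i) (cut_pd aY cphi)).
have A7 := null_add A6 (N aZ _ _ (smF i) (cut_pd aZ cphi)).
have A8 := null_add A7 (null_opp (N aX _ _ (pd_smooth aX (smF i)) cphi)).
have A9 := null_add A8 (null_opp (N aY _ _ (pd_smooth aY (smF i)) cphi)).
have A10 := null_add A9 (null_opp (N aZ _ _ (pd_smooth aZ (smF i)) cphi)).
have A11 := null_add A10 (N (ax i) _ _ smpi cphi).
apply: null_eq A11 _ => q; rewrite /T /E /lap.
generalize (pd aX (pd aX phi) q) (pd aY (pd aY phi) q) (pd aZ (pd aZ phi) q).
generalize (pd aX (pd aX (F u i)) q) (pd aY (pd aY (F u i)) q) (pd aZ (pd aZ (F u i)) q).
generalize (pd (ax i) phi q) (pd (ax i) pi q) (pi q).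
generalize (pd aT phi q) (pd aX phi q) (pd aY phi q) (pd aZ phi q) (phi q).
generalize (pd aT (F u i) q) (pd aX (F u i) q) (pd aY (F u i) q) (pd aZ (F u i) q).
generalize (pd aX (F u i0) q) (pd aY (F u i1) q) (pd aZ (F u i2) q).
generalize (F f i q) (F u i q) (F u i0 q) (F u i1 q) (F u i2 q).
by move=> *; ring.
Qed.

End Equations.

(** * The hypotheses in terms of two small parameters *)

Section Translation.
Context {R : realType}.
Implicit Types (g : ST R -> R) (x y z t : R).

Lemma derive1_X g y z t : derive1 (fun s : R => g (s, y, z, t)) = fun x => pd aX g (x, y, z, t).
Proof.
apply/funext => x; rewrite derive1E pdE.
have := @derive_line _ _ g (0, y, z, t) ex x; rewrite addexE add0r => <-.
by congr ('D_1 _ x); apply/funext => s; rewrite addexE add0r.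
Qed.

Lemma derive1_Z g x y t : derive1 (fun s : R => g (x, y, s, t)) = fun z => pd aZ g (x, y, z, t).
Proof.
apply/funext => z; rewrite derive1E pdE.
have := @derive_line _ _ g (x, y, 0, t) ez z; rewrite addezE add0r => <-.
by congr ('D_1 _ z); apply/funext => s; rewrite addezE add0r.
Qed.

Lemma derive1n_X n g y z t :
  derive1n n (fun s : R => g (s, y, z, t)) = fun x => iter n (pd aX) g (x, y, z, t).
Proof. by elim: n => [//|n IH]; rewrite derive1nS IH derive1_X. Qed.

Lemma derive1n_Z n g x y t :
  derive1n n (fun s : R => g (x, y, s, t)) = fun z => iter n (pd aZ) g (x, y, z, t).
Proof. by elim: n => [//|n IH]; rewrite derive1nS IH derive1_Z. Qed.

(** Derivatives of the cylindrical coefficients are Cartesian partial derivatives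
    at points with [y = 0]. *)
Lemma drzE a b g r z t : drz a b (fun r z t => g (r, 0, z, t)) r z t =
  iter a (pd aX) (iter b (pd aZ) g) (r, 0, z, t).
Proof.
transitivity (derive1n a (fun s : R => iter b (pd aZ) g (s, 0, z, t)) r).
  by rewrite /drz; congr (derive1n a _ r); apply/funext => s; rewrite derive1n_Z.
by rewrite derive1n_X.
Qed.

Lemma derive_slice (g : ST R -> R) (j : 'I_3) (x : R3 R) t :
  'D_(basis3 j) (fun x : R3 R => g (x, t)) x = pd (ax j) g (x, t).
Proof.
have L1 := derive_line (fun x : R3 R => g (x, t)) x (basis3 j) 0.
have L2 := derive_line g (x, t) (vec (ax j)) 0.
rewrite !scale0r !addr0 in L1 L2; rewrite pdE -L1 -L2.
suff -> : (fun s : R => g (x + s *: basis3 j, t)) =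
  (fun s : R => g ((x, t) + s *: vec (ax j))) by [].
apply/funext => s; congr (g _); move: x {L1 L2} => [[x1 x2] x3].
have E3 (a b c a' b' c' : R) : ((a', b', c') : R3 R) + s *: ((a, b, c) : R3 R) =
  (a' + s * a, b' + s * b, c' + s * c) by [].
have E4 (a b c d a' b' c' d' : R) : ((a', b', c', d') : ST R) + s *: ((a, b, c, d) : ST R) =
  (a' + s * a, b' + s * b, c' + s * c, d' + s * d) by [].
by move: j; apply: ord3P; rewrite /basis3 /= /ex /ey /ez E3 E4 !mulr0 !addr0.
Qed.

Lemma force_bounds (f : ST R -> R3 R) : (Mforce f < +oo)%E ->
  exists2 M : R, 0 <= M & forall i p, Q p -> `|F f i p| <= M /\
    forall j, `|pd (ax j) (F f i) p| <= M.
Proof.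
move=> Moo.
have ub (i : 'I_3) (js : seq 'I_3) (x : R3 R) t : (size js <= 2)%N -> B 1 x ->
    -1 < t < 0 ->
    (`|Defs.iterD (map basis3 js) (fun x : R3 R => comp3 i (f (x, t))) x|%:E <= Mforce f)%E.
  move=> js2 Bx tt; apply: (@le_trans _ _ (C2norm (fun x : R3 R => f (x, t)))).
    by apply: ereal_sup_ubound; exists i, js, x.
  by apply: ereal_sup_ubound; exists t.
have M0 : (0 <= Mforce f)%E.
  apply: le_trans (ub i0 [::] (0, 0, 0) (- (1 / 2)) _ _ _) => //.
  - by apply/normsq_lt1 => /=; rewrite expr0n/= !addr0.
  - by apply/andP; split; lra.
have Mfin : Mforce f = (fine (Mforce f))%:E by rewrite fineK// ge0_fin_numE.
exists (fine (Mforce f)); first exact: fine_ge0.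
move=> i [x t] [Bx tt]; split.
  by have := ub i [::] x t isT Bx tt; rewrite Mfin lee_fin.
move=> j; have := ub i [:: j] x t isT Bx tt; rewrite Mfin lee_fin /=.
by rewrite (derive_slice (F f i)).
Qed.

End Translation.

Section Powers.
Context {R : realType}.
Variable h : R.
Hypothesis h_range : 0 < h < 1 / 2.
Implicit Types t : R.

(** With [s = sqrt (- t)] and [e = (- t)^(h / 3)] every bound below is a monomial
    with integer exponents in [s] and [e]. *)
Definition ss t : R := (- t) `^ (1 / 2).
Definition ee t : R := (- t) `^ (h / 3).

Lemma ss_gt0 t : t < 0 -> 0 < ss t.
Proof. by move=> t0; rewrite powR_gt0// oppr_gt0. Qed.

Lemma ee_gt0 t : t < 0 -> 0 < ee t.
Proof. by move=> t0; rewrite powR_gt0// oppr_gt0. Qed.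

Lemma ss_sqr t : t < 0 -> ss t ^+ 2 = - t.
Proof.
move=> t0; rewrite /ss -powR_mulrn ?powR_ge0// -powRrM.
by rewrite (_ : 1 / 2 * 2%:R = 1) ?powRr1 ?oppr_ge0 ?ltW//; field.
Qed.

Lemma ee_cube t : t < 0 -> ee t ^+ 3 = (- t) `^ h.
Proof.
move=> t0; rewrite /ee -powR_mulrn ?powR_ge0// -powRrM.
by congr (_ `^ _); field.
Qed.

Lemma powR_le1 (x a : R) : 0 < x -> x <= 1 -> 0 <= a -> x `^ a <= 1.
Proof.
by move=> x0 x1 a0; rewrite -[leRHS](powRr0 x) ger_powR// x0.
Qed.

Lemma ss_le1 t : -1 <= t < 0 -> ss t <= 1.
Proof. by move=> /andP[t1 t0]; rewrite powR_le1//; lra. Qed.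

Lemma ee_le1 t : -1 <= t < 0 -> ee t <= 1.
Proof.
move=> /andP[t1 t0]; rewrite powR_le1//; try lra.
by have /andP[h0 _] := h_range; rewrite divr_ge0// ltW.
Qed.

(** The vertical length scale [s * e^-3] is at most one because [h < 1 / 2]. *)
Lemma ss_le_ee3 t : -1 <= t < 0 -> ss t <= ee t ^+ 3.
Proof.
move=> /andP[t1 t0]; rewrite ee_cube// /ss ger_powR//; first by apply/andP; split; lra.
by have /andP[_ h1] := h_range; exact: ltW.
Qed.

Lemma power_bound t (a b : nat) (k : R) : t < 0 ->
  (- t) `^ (- (1 / 2) - k - a%:R / 2 - (1 / 2 - h) * b%:R) =
  (ss t)^-1 * (- t) `^ (- k) * (ss t) ^- a * ((ss t)^-1 * ee t ^+ 3) ^+ b.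
Proof.
move=> t0; have tp : 0 < - t by rewrite oppr_gt0.
have tn : - t != 0 by rewrite gt_eqF.
have D (x y : R) : (- t) `^ (x + y) = (- t) `^ x * (- t) `^ y.
  by rewrite powRD// tn implybT.
rewrite ee_cube//.
have -> : (ss t)^-1 = (- t) `^ (- (1 / 2)) by rewrite powRN.
have -> : ss t ^- a = (- t) `^ (- (a%:R / 2)).
  rewrite powRN /ss -powR_mulrn ?powR_ge0// -powRrM; congr (_ ^-1).
  by congr (_ `^ _); field.
rewrite -D -D -D -powR_mulrn ?powR_ge0// -powRrM -D.
by congr (_ `^ _); field.
Qed.

End Powers.

(** * Interior maxima *)

Section LocalMax.
Context {R : realType}.
Implicit Types (f : R -> R) (x d l : R).

Lemma local_max_derive f x d l : 0 < d ->
  (forall s : R, `|s - x| < d -> derivable f s 1) ->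
  (forall s, `|s - x| < d -> f s <= f x) -> is_derive x 1 f l -> l = 0.
Proof.
move=> d0 df fmax [_ <-].
have itv t : t \in `]x - d, x + d[%R = (`|t - x| < d) by rewrite in_itv/= ltr_distl.
suff [_ ->] : is_derive x 1 f 0 by [].
apply: (@derive1_at_max _ f (x - d) (x + d)).
- lra.
- by move=> t; rewrite itv; exact: df.
- by rewrite itv subrr normr0.
- by move=> t; rewrite itv; exact: fmax.
Qed.

Lemma pos_derive_right f x l : is_derive x 1 f l -> 0 < l ->
  exists2 d, 0 < d & forall s, x < s < x + d -> f x < f s.
Proof.
move=> [df dl] l0.
have : (fun k : R => k^-1 *: ((f \o shift x) (k *: 1) - f x)) @ 0^' --> l.
  by rewrite -dl; exact: df.
move=> /cvgrPdist_lt/(_ l l0); rewrite near_withinE => /nbhs_normP[d /= d0 H].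
exists d => // s /andP[xs sd].
have := H (s - x); rewrite /ball_/= sub0r normrN gtr0_norm ?subr_gt0//.
have sx : s - x != 0 by rewrite gt_eqF// subr_gt0.
rewrite ltrBlDl => /(_ sd sx); rewrite [(s - x) *: 1]mulr1 subrK.
rewrite ltr_distlC => /andP[+ _]; rewrite subrr.
by rewrite pmulr_rgt0 ?invr_gt0 ?subr_gt0.
Qed.

Lemma local_max_derive2 f (f1 : R -> R) x d l : 0 < d ->
  (forall s : R, `|s - x| < d -> is_derive s 1 f (f1 s)) ->
  (forall s, `|s - x| < d -> f s <= f x) -> is_derive x 1 f1 l ->
  f1 x = 0 /\ l <= 0.
Proof.
move=> d0 Df fmax D1.
have xx : `|x - x| < d by rewrite subrr normr0.
have f1x : f1 x = 0.
  apply: (local_max_derive d0 _ fmax (Df x xx)).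
  by move=> s sd; have [] := Df s sd.
split=> //; rewrite leNgt; apply/negP => l0.
have [d1 d10 H] := pos_derive_right D1 l0.
pose s := x + Num.min d d1 / 2.
have m0 : 0 < Num.min d d1 by rewrite lt_min d0.
have m1 : Num.min d d1 <= d by rewrite ge_min lexx.
have m2 : Num.min d d1 <= d1 by rewrite ge_min lexx orbT.
have xs : x < s by rewrite /s; lra.
have near_x c : x <= c <= s -> `|c - x| < d.
  by move=> /andP[c1 c2]; rewrite ger0_norm ?subr_ge0//; move: c2; rewrite /s; lra.
have [c cxs E] : exists2 c, c \in `]x, s[%R & f s - f x = f1 c * (s - x).
  apply: MVT => //.
    move=> c; rewrite in_itv/= => /andP[c1 c2]; apply: Df; apply: near_x.
    by rewrite !ltW.
  apply: derivable_within_continuous => c; rewrite in_itv/= => cc.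
  by have [] := Df c (near_x c cc).
move: cxs; rewrite in_itv/= => /andP[c1 c2].
have f1c : 0 < f1 c by rewrite -f1x H// c1 /=; move: c2; rewrite /s; lra.
have := fmax s (near_x s _); rewrite (ltW xs) lexx => /(_ isT).
by rewrite -subr_le0 E leNgt mulr_gt0// subr_gt0.
Qed.

Lemma left_max_derive f x d l : 0 < d ->
  (forall s, x - d < s <= x -> f s <= f x) -> is_derive x 1 f l -> 0 <= l.
Proof.
move=> d0 fmax Df; rewrite leNgt; apply/negP => l0.
have D : is_derive (- x) 1 (fun s => f (- s)) (- l).
  have Df' : is_derive (- - x) 1 f l by rewrite opprK.
  have := @is_derive1_comp _ f (@GRing.opp R) (- x) l _ Df' _.
  by move=> /(_ _ (is_deriveNid _ _)); rewrite mulrN1.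
have [|d1 d10 H] := pos_derive_right D; first by rewrite oppr_gt0.
pose k := Num.min d d1 / 2.
have m0 : 0 < Num.min d d1 by rewrite lt_min d0.
have m1 : Num.min d d1 <= d by rewrite ge_min lexx.
have m2 : Num.min d d1 <= d1 by rewrite ge_min lexx orbT.
have := H (- x + k); rewrite opprK opprD opprK.
have -> : - x < - x + k < - x + d1 by rewrite /k; apply/andP; split; lra.
move=> /(_ isT); rewrite ltNge fmax// /k; apply/andP; split; lra.
Qed.

End LocalMax.

Section CompactMax.
Context {R : realType}.
Implicit Types (p q : ST R).

(** Compactness part of the parabolic maximum principle in a region with the
    lateral boundary [normsq = A t]; the closed set [S] serves for a reduction by
    symmetry. *)
Lemma interior_max (S : set (ST R)) (A : R -> R) (t1 t0 : R) (H : ST R -> R) p0 :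
  closed S -> -1 < t1 -> t0 < 0 ->
  continuous A -> (forall s t, t1 <= s -> s <= t -> t <= t0 -> A t <= A s) ->
  (forall t, t1 <= t <= t0 -> A t < 1) ->
  (forall q, S q -> t1 <= q.2 <= t0 -> normsq q < 1 -> {for q, continuous H}) ->
  (forall q, S q -> q.2 = t1 -> normsq q <= A t1 -> H q <= 0) ->
  (forall q, S q -> t1 <= q.2 <= t0 -> normsq q = A q.2 -> H q <= 0) ->
  S p0 -> t1 <= p0.2 <= t0 -> normsq p0 <= A p0.2 -> 0 < H p0 ->
  exists p, [/\ S p, t1 < p.2 <= t0, normsq p < A p.2, 0 < H p &
   forall q, S q -> t1 <= q.2 <= t0 -> normsq q <= A q.2 -> H q <= H p].
Proof.
move=> cS t1m t00 cA decA A1 cH bot lat Sp0 tp0 np0 Hp0.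
pose K := S `&` [set q : ST R | t1 <= q.2] `&` [set q : ST R | q.2 <= t0] `&`
  [set q | normsq q - A q.2 <= 0].
have cAq : continuous (fun q : ST R => normsq q - A q.2).
  move=> q; apply: cont_sub; first exact: continuous_normsq.
  exact: (@continuous_comp _ _ _ (fun q : ST R => q.2) A q (@continuous_t R q) (cA q.2)).
have closedle (g : ST R -> R) a : continuous g -> closed [set q | g q <= a].
  move=> cg; rewrite (_ : [set q | g q <= a] = g @^-1` [set s | s <= a])//.
  by apply: preimage_closed; [move=> q _; exact: cg|exact: closed_le].
have closedge (g : ST R -> R) a : continuous g -> closed [set q | a <= g q].
  move=> cg; rewrite (_ : [set q | a <= g q] = g @^-1` [set s | a <= s])//.
  by apply: preimage_closed; [move=> q _; exact: cg|exact: closed_ge].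
have KE q : K q <-> [/\ S q, t1 <= q.2 <= t0 & normsq q <= A q.2].
  rewrite /K/= subr_le0; split; first by move=> [[[? ->] ->] ?].
  by move=> [? /andP[? ?] ?].
have n1 q : K q -> normsq q < 1.
  by move=> /KE[_ tq nq]; apply: le_lt_trans nq (A1 _ tq).
have cK : compact K.
  apply: (@subclosed_compact _ _ (box (0, 0, 0, 0) 1)); last first.
  - move=> q Kq; have := n1 q Kq; have /KE[_ /andP[q1 q2] _] := Kq.
    case: q q1 q2 {Kq} => [[[x y] z] t] /= q1 q2; rewrite /normsq /box/= !subr0 => n.
    have sq (a : R) : a ^+ 2 <= 1 -> `|a| <= 1.
      by move=> a1; rewrite -[leRHS]normr1 -ler_sqr ?nnegrE// !real_normK ?num_real// expr1n.
    split; [apply: sq|apply: sq|apply: sq|]; try nra.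
    by rewrite ltr0_norm; lra.
  - exact: box_compact.
  - apply: closedI; last exact: closedle.
    apply: closedI; last exact/closedle/continuous_t.
    by apply: closedI => //; exact/closedge/continuous_t.
have K0 : K !=set0 by exists p0; apply/KE.
have wH : {within K, continuous H}.
  apply: continuous_in_subspaceT => q; rewrite inE => Kq.
  by have /KE[Sq tq _] := Kq; apply: cH => //; exact: n1.
have [p /set_mem Kp pmax] := compact_EVT_max K0 cK wH.
have {}pmax q : K q -> H q <= H p by move=> Kq; apply: pmax; exact: mem_set.
have /KE[Sp /andP[t1p tpt0] np] := Kp.
have Hp : 0 < H p by apply: lt_le_trans Hp0 _; apply: pmax; apply/KE.
have np' : normsq p < A p.2.
  rewrite lt_neqAle np andbT; apply/eqP => E.
  by have := lat p Sp _ E; rewrite t1p tpt0 => /(_ isT); rewrite leNgt Hp.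
have tp : t1 < p.2.
  rewrite lt_neqAle t1p andbT; apply/eqP => E.
  by have := bot p Sp (esym E); rewrite {1}E => /(_ np); rewrite leNgt Hp.
exists p; split=> //; first by rewrite tp.
by move=> q Sq tq nq; apply: pmax; apply/KE.
Qed.

Lemma interior_near (A : R -> R) (t1 t0 : R) p :
  (forall s t, t1 <= s -> s <= t -> t <= t0 -> A t <= A s) ->
  t1 < p.2 <= t0 -> normsq p < A p.2 ->
  exists2 d : R, 0 < d & forall q, `|q - p| < d -> q.2 <= p.2 ->
    t1 <= q.2 <= t0 /\ normsq q <= A q.2.
Proof.
move=> decA /andP[tp tpt0] np.
have oU : open ([set q : ST R | t1 < q.2] `&` [set q | normsq q < A p.2]).
  by apply: openI; [exact/open_gt_fun/continuous_t|exact/open_lt_fun/continuous_normsq].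
have [d d0 Hd] := open_ball_in oU (conj tp np).
exists d => // q qd qp; have [/= tq nq] := Hd q qd.
split; first by rewrite (ltW tq) (le_trans qp).
by apply: le_trans (ltW nq) _; apply: decA => //; exact: ltW.
Qed.

End CompactMax.

(** * The localising barrier *)

Section Rules.
Context {R : realType}.
Implicit Types (f g : R -> R) (x a b : R).

Lemma d_eq f x a b : is_derive x 1 f a -> a = b -> is_derive x 1 f b.
Proof. by move=> Df <-. Qed.

Lemma d_cst c x : is_derive x 1 (fun=> c : R) (0 : R).
Proof. exact: is_derive_cst. Qed.

Lemma d_id x : is_derive x 1 (fun s : R => s) (1 : R).
Proof. exact: is_derive_id. Qed.

Lemma d_add f g x a b : is_derive x 1 f a -> is_derive x 1 g b ->
  is_derive x 1 (fun s : R => f s + g s) (a + b).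
Proof. by move=> Df Dg; exact: (is_deriveD Df Dg). Qed.

Lemma d_sub f g x a b : is_derive x 1 f a -> is_derive x 1 g b ->
  is_derive x 1 (fun s : R => f s - g s) (a - b).
Proof. by move=> Df Dg; exact: (is_deriveB Df Dg). Qed.

Lemma d_mul f g x a b : is_derive x 1 f a -> is_derive x 1 g b ->
  is_derive x 1 (fun s : R => f s * g s) (f x * b + g x * a).
Proof. by move=> Df Dg; exact: (is_deriveM Df Dg). Qed.

Lemma d_cmul c f x a : is_derive x 1 f a ->
  is_derive x 1 (fun s : R => c * f s) (c * a).
Proof.
move=> Df; apply: d_eq (d_mul (d_cst c x) Df) _.
by rewrite mulr0 addr0.
Qed.

Lemma d_inv f x a : f x != 0 -> is_derive x 1 f a ->
  is_derive x 1 (fun s : R => (f s)^-1) (- a * ((f x)^-1 * (f x)^-1)).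
Proof.
move=> fx Df; apply: is_derive_eq (is_deriveV fx Df) _.
by rewrite /GRing.scale/= expr2 invfM mulrC mulNr mulrN.
Qed.

Lemma d_powR (k t : R) : t < 0 ->
  is_derive t 1 (fun s : R => (- s) `^ k) (- (k * (- t) `^ (k - 1))).
Proof.
move=> t0.
have tp : - t \in `]0, +oo[%R by rewrite in_itv/= andbT oppr_gt0.
have D : is_derive (- t) 1 (fun y : R => y `^ k) (k * (- t) `^ (k - 1)).
  split; first exact: derivable_powR.
  by rewrite -derive1E powR_derive1.
by have := is_derive1_comp D (is_deriveNid t 1); rewrite mulrN1.
Qed.

End Rules.

Section Barrier.
Context {R : realType}.
Implicit Types (x y z t tau k al A : R).

(** Small enough for the second-order terms that the barrier produces to be
    dominated by its time derivative. *)
Definition kap : R := 1 / 200.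

Definition EE tau al (s : R) : R := tau + kap * ((al - s * s) * (al - s * s)).

Lemma EE_gt0 tau al s : 0 < tau -> 0 < EE tau al s.
Proof. by move=> t0; rewrite ltr_wpDr// mulr_ge0 ?/kap// -expr2 sqr_ge0. Qed.

Definition JJ tau al (s : R) : R := (EE tau al s)^-1.

Lemma d_EE tau al (s : R) : is_derive s 1 (EE tau al) (- (4 * kap * s * (al - s * s))).
Proof.
have D := d_sub (d_cst al s) (d_mul (d_id s) (d_id s)).
apply: d_eq (d_add (d_cst tau s) (d_mul (d_cst kap s) (d_mul D D))) _.
by ring.
Qed.

Lemma d_JJ tau al (s : R) : 0 < tau -> is_derive s 1 (JJ tau al)
  (4 * kap * s * (al - s * s) * JJ tau al s ^+ 2).
Proof.
move=> t0; apply: d_eq (d_inv (lt0r_neq0 (EE_gt0 al s t0)) (d_EE tau al s)) _.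
by rewrite opprK expr2.
Qed.

(** Along a coordinate line the barrier [(tau + kap * zeta^2)^-2] is a function
    of [zeta = al - s^2]. *)
Lemma d_psi tau al (s : R) : 0 < tau -> is_derive s 1 (fun s => JJ tau al s * JJ tau al s)
  (8 * kap * s * (al - s * s) * JJ tau al s ^+ 3).
Proof.
move=> t0; apply: d_eq (d_mul (d_JJ al s t0) (d_JJ al s t0)) _; ring.
Qed.

Lemma d_psi2 tau al (s : R) : 0 < tau ->
  is_derive s 1 (fun s => 8 * kap * s * (al - s * s) * JJ tau al s ^+ 3)
  (8 * kap * JJ tau al s ^+ 3 * ((al - s * s) - 2 * s ^+ 2 +
     12 * kap * s ^+ 2 * (al - s * s) ^+ 2 * JJ tau al s)).
Proof.
move=> t0; have DJ := d_JJ al s t0.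
have D := d_mul (d_mul (d_mul (d_cst (8 * kap) s) (d_id s))
  (d_sub (d_cst al s) (d_mul (d_id s) (d_id s)))) (d_mul (d_mul DJ DJ) DJ).
rewrite (_ : (fun s0 => _) = (fun s => 8 * kap * s * (al - s * s) *
  (JJ tau al s * JJ tau al s * JJ tau al s))); last first.
  by apply/funext => k; rewrite !exprS expr0 mulr1 !mulrA.
apply: d_eq D _; ring.
Qed.

Lemma d_psi_t (A : R -> R) (A' n t : R) : t < 0 -> is_derive t 1 A A' ->
  is_derive t 1 (fun s => (- s + kap * ((A s - n) * (A s - n)))^-1 *
     (- s + kap * ((A s - n) * (A s - n)))^-1)
   (2 * (1 - 2 * kap * (A t - n) * A') *
     ((- t + kap * ((A t - n) * (A t - n)))^-1) ^+ 3).
Proof.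
move=> t0 DA; have E0 : - t + kap * ((A t - n) * (A t - n)) != 0.
  by rewrite gt_eqF// ltr_wpDr ?oppr_gt0// mulr_ge0 ?/kap// -expr2 sqr_ge0.
have DN : is_derive t 1 (fun s : R => - s) (-1 : R) by exact: is_deriveNid.
have DAn := d_sub DA (d_cst n t).
have DE := d_add DN (d_mul (d_cst kap t) (d_mul DAn DAn)).
have DJ := d_inv (f := fun s => - s + kap * ((A s - n) * (A s - n))) E0 DE.
apply: d_eq (d_mul DJ DJ) _; move: (_^-1) => J; ring.
Qed.

(** The speed [cst * (- t)^(k - 1)] has a finite integral up to [t = 0], so that
    for a late start the boundary stays between the given spheres. With
    [k = 1 / 2 - h] this speed is a multiple of that of the flow. *)
Lemma moving_boundary (q1 q2 cst k T : R) : q1 < q2 -> 0 <= cst -> 0 < k -> T < 0 ->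
  exists t1, [/\ -1 < t1, T < t1, t1 < 0 & forall t0, t1 <= t0 -> t0 < 0 ->
    exists A : R -> R, [/\ continuous A,
      forall s t, t1 <= s -> s <= t -> t <= t0 -> A t <= A s,
      forall t, t1 <= t <= t0 -> q1 <= A t < q2 &
      forall t, t1 <= t <= t0 -> is_derive t 1 A (- (cst * (- t) `^ (k - 1)))]].
Proof.
move=> q12 c0 k0 T0.
have ck0 : 0 <= cst / k by rewrite divr_ge0// ltW.
have e0 : 0 < (q2 - q1) / (cst / k + 1).
  by rewrite divr_gt0 ?subr_gt0// ltr_wpDl.
near (0 : R)^'+ => a.
have a0 : 0 < a by near: a; exact: nbhs_right_gt.
have a1 : a < 1 by near: a; exact: nbhs_right_lt.
have aT : a < - T by near: a; apply: nbhs_right_lt; rewrite oppr_gt0.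
have ak : `|0 - a `^ k| < (q2 - q1) / (cst / k + 1).
  by near: a; move: (powR_cvg0 k0) => /cvgrPdist_lt; apply.
exists (- a); split; [lra|lra|lra|move=> t0 at0 t00].
pose A (t : R) := q1 + cst / k * (Num.max (- t) (- t0 / 2)) `^ k.
have m0 t : 0 < Num.max (- t) (- t0 / 2) by rewrite lt_max; apply/orP; right; lra.
have AE t : t <= t0 -> A t = q1 + cst / k * (- t) `^ k.
  by move=> tt0; rewrite /A max_l//; lra.
exists A; split.
- suff cA t : {for t, continuous (fun t : R => q1 + cst / k *
      (Num.max (- t) (- t0 / 2)) `^ k)} by move=> t; exact: cA.
  apply: cont_add; first exact: cvg_cst.
  apply: cont_mul; first exact: cvg_cst.
  apply: (@continuous_comp _ _ _ (fun t : R => Num.max (- t) (- t0 / 2))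
    (fun y : R => y `^ k)).
    have -> : (fun t : R => Num.max (- t) (- t0 / 2)) =
        (fun t => (- t + - t0 / 2 + `|- t - - t0 / 2|) * 2^-1).
      by apply/funext => s; rewrite maxr_absE.
    have cm (c : R) : {for t, continuous (fun t : R => - t + c)}.
      apply: cont_add; [exact: oppr_continuous|exact: cvg_cst].
    apply: cont_mul; last exact: cvg_cst.
    apply: cont_add; first exact: cm.
    apply: (@continuous_comp _ _ _ (fun t : R => - t - - t0 / 2) Num.norm).
      exact: cm.
    exact: norm_continuous.
  apply: differentiable_continuous; apply/derivable1_diffP.
  by apply: derivable_powR; rewrite in_itv/= m0.
- move=> s t a_s st tt0; rewrite !AE//; last exact: le_trans st _.
  rewrite lerD2l ler_wpM2l// ge0_ler_powR ?(ltW k0)// ?nnegrE; lra.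
- move=> t /andP[at_ tt0]; rewrite AE//.
  have p0 : 0 <= (- t) `^ k by rewrite powR_ge0.
  rewrite lerDl mulr_ge0//=.
  have tk : (- t) `^ k <= a `^ k.
    by rewrite ge0_ler_powR ?(ltW k0)// ?nnegrE; lra.
  have k1 : 0 < cst / k + 1 by rewrite ltr_wpDl.
  move: ak; rewrite sub0r normrN ger0_norm ?powR_ge0// (ltr_pdivlMr _ _ k1) => ak.
  have a_k : 0 < a `^ k by rewrite powR_gt0.
  have : cst / k * (- t) `^ k <= cst / k * a `^ k by rewrite ler_wpM2l.
  by move: ak; rewrite mulrDr mulr1 mulrC; lra.
- move=> t /andP[at_ tt0].
  have nE : \near t, q1 + cst / k * (- t) `^ k = A t.
    near=> s; rewrite /A max_l//; suff : s <= t0 / 2 by lra.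
    by apply: ltW; near: s; apply: lt_nbhsl; lra.
  apply: (near_eq_is_derive nE).
  have tn : t < 0 by exact: le_lt_trans tt0 _.
  apply: d_eq (d_add (d_cst q1 t) (d_mul (d_cst (cst / k) t) (d_powR k tn))) _.
  by rewrite mulr0 addr0 add0r mulrN mulrA divfK// gt_eqF.
Unshelve. all: by end_near. Qed.

End Barrier.

(** * Axisymmetric flows and the meridian half-plane *)

Section Flow.
Context {R : realType}.

(** The estimates below use the equations only in this pointwise form. *)
Record axi_flow (u : ST R -> R3 R) (pr : ST R -> R) (f : ST R -> R3 R)
    (h C M : R) : Prop := AxiFlow {
  fl_axi : axisymmetric u ;
  fl_u : forall i, smooth_on Q (F u i) ;
  fl_p : smooth_on Q pr ;
  fl_div : forall p, Q p ->
    pd aX (F u i0) p + pd aY (F u i1) p + pd aZ (F u i2) p = 0 ;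
  fl_mom : forall i p, Q p ->
    pd aT (F u i) p + conv u i p - lap (F u i) p + pd (ax i) pr p = F f i p ;
  fl_h : 0 < h < 1 / 2 ;
  fl_C : 0 < C ;
  fl_bds : axi_bounds u h C ;
  fl_M : 0 <= M ;
  fl_force : forall i p, Q p -> `|F f i p| <= M /\
    forall j, `|pd (ax j) (F f i) p| <= M }.

Lemma polar (x y : R) : exists th : R,
  x = cos th * Num.sqrt (x ^+ 2 + y ^+ 2) /\ y = sin th * Num.sqrt (x ^+ 2 + y ^+ 2).
Proof.
set r2 := x ^+ 2 + y ^+ 2; set r := Num.sqrt r2.
have r20 : 0 <= r2 by rewrite addr_ge0// sqr_ge0.
have rr : r ^+ 2 = r2 by rewrite sqr_sqrtr.
have [r0|r0] := eqVneq r 0.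
  have := rr; rewrite r0 expr0n/= => /esym/eqP; rewrite paddr_eq0 ?sqr_ge0//.
  by rewrite !sqrf_eq0 => /andP[/eqP -> /eqP ->]; exists 0; rewrite !mulr0.
have rp : 0 < r by rewrite lt_neqAle eq_sym r0 sqrtr_ge0.
have xr : (x / r) ^+ 2 + (y / r) ^+ 2 = 1.
  by rewrite !expr_div_n -mulrDl -/r2 -rr divff// expf_neq0.
have x1 : -1 <= x / r <= 1 by apply/andP; split; nra.
have sE : sin (acos (x / r)) = `|y / r|.
  rewrite sin_acos// -(sqrtr_sqr (y / r)); congr Num.sqrt; lra.
have cE : cos (acos (x / r)) = x / r by rewrite acosK// in_itv.
have [y0|y0] := leP 0 y.
  exists (acos (x / r)); rewrite sE cE ger0_norm.
    by rewrite !divfK.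
  by rewrite divr_ge0// ltW.
exists (- acos (x / r)); rewrite sinN cosN sE cE ltr0_norm ?opprK.
  by rewrite !divfK.
by rewrite pmulr_llt0 ?invr_gt0.
Qed.

Definition rot (th : R) (p : ST R) : ST R :=
  (cos th * p.1.1.1 - sin th * p.1.1.2, sin th * p.1.1.1 + cos th * p.1.1.2,
   p.1.2, p.2).

Definition swirl (u : ST R -> R3 R) (q : ST R) : R :=
  q.1.1.1 * F u i1 q - q.1.1.2 * F u i0 q.

Definition rad (u : ST R -> R3 R) (q : ST R) : R :=
  q.1.1.1 * F u i0 q + q.1.1.2 * F u i1 q.

Variables (u : ST R -> R3 R) (pr : ST R -> R) (f : ST R -> R3 R) (h C M : R).
Hypothesis fl : axi_flow u pr f h C M.

Lemma rotQ th p : Q p -> Q (rot th p).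
Proof. by case: p => [[[x y] z] t]; exact: rot_Q. Qed.

Lemma rotn th p : normsq (rot th p) = normsq p.
Proof. by case: p => [[[x y] z] t]; exact: rot_normsq. Qed.

Lemma swirl_rot th p : Q p -> swirl u (rot th p) = swirl u p.
Proof.
case: p => [[[x y] z] t] Qp; rewrite /swirl /rot/=.
have [-> -> _] := axi_rot (fl_axi fl) th Qp.
generalize (F u i0 (x, y, z, t)) (F u i1 (x, y, z, t)) => a b.
transitivity ((cos th ^+ 2 + sin th ^+ 2) * (x * b - y * a)); first by ring.
by rewrite cos2Dsin2 mul1r.
Qed.

Lemma rad_rot th p : Q p -> rad u (rot th p) = rad u p.
Proof.
case: p => [[[x y] z] t] Qp; rewrite /rad /rot/=.
have [-> -> _] := axi_rot (fl_axi fl) th Qp.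
generalize (F u i0 (x, y, z, t)) (F u i1 (x, y, z, t)) => a b.
transitivity ((cos th ^+ 2 + sin th ^+ 2) * (x * a + y * b)); first by ring.
by rewrite cos2Dsin2 mul1r.
Qed.

Lemma meridian x y z t : Q (x, y, z, t) ->
  let r := Num.sqrt (x ^+ 2 + y ^+ 2) in
  [/\ Q (r, 0, z, t), rad u (x, y, z, t) = r * F u i0 (r, 0, z, t),
      swirl u (x, y, z, t) = r * F u i1 (r, 0, z, t) &
      F u i2 (x, y, z, t) = F u i2 (r, 0, z, t)].
Proof.
move=> Qp r; have [th [xE yE]] := polar x y.
have r2 : r ^+ 2 = x ^+ 2 + y ^+ 2 by rewrite sqr_sqrtr// addr_ge0// sqr_ge0.
have Qr : Q (r, 0, z, t).
  by move/QE: Qp => [n tt]; apply/QE; rewrite r2 expr0n/= addr0.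
have rE : rot th (r, 0, z, t) = (x, y, z, t).
  by rewrite /rot/= !mulr0 subr0 addr0 -xE -yE.
split=> //.
- by rewrite -rE rad_rot// /rad/= mul0r addr0.
- by rewrite -rE swirl_rot// /swirl/= mul0r subr0.
- by rewrite -rE; have [_ _] := axi_rot (fl_axi fl) th Qr.
Qed.

Lemma rot_derive (g : ST R -> R) p (s : R) : smooth_on Q g -> Q p ->
  is_derive s 1 (fun s => g (rot s p)) (dth g (rot s p)).
Proof.
case: p => [[[x y] z] t] sg Qp.
have D1 : is_derive s 1 (fun s => cos s * x - sin s * y) (- (sin s * x + cos s * y)).
  apply: d_eq (d_sub (d_mul (is_derive_cos s) (d_cst x s))
    (d_mul (is_derive_sin s) (d_cst y s))) _; ring.
have D2 : is_derive s 1 (fun s => sin s * x + cos s * y) (cos s * x - sin s * y).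
  apply: d_eq (d_add (d_mul (is_derive_sin s) (d_cst x s))
    (d_mul (is_derive_cos s) (d_cst y s))) _; ring.
have D := chain_pd (z := z) (t := t) open_Q sg D1 D2 (rot_Q s Qp).
by apply: d_eq D _; rewrite addrC mulNr.
Qed.

(** Rolle's theorem on a circle about the axis. The pressure need not be constant
    on the circle, but the swirl is, so in its equation the circle may be read at
    a point where the angular derivative of the pressure vanishes. *)
Lemma pressure_critical p : Q p -> exists th, dth pr (rot th p) = 0.
Proof.
move=> Qp; have D s := rot_derive s (fl_p fl) Qp.
have pi2 : (0 : R) < 2 * trigo.pi by rewrite mulr_gt0// pi_gt0.
have [th _ Dth] : exists2 c, c \in `]0, (2 * trigo.pi : R)[%R &
    is_derive c 1 (fun s : R => pr (rot s p)) 0.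
  apply: Rolle => //.
  - by apply: derivable_within_continuous => s _; have [] := D s.
  - by rewrite /rot cos0 sin0 (mulrC 2) mulr_natr cos2pi sin2pi.
exists th; apply: etrans (@derive_val _ _ _ _ _ _ _ Dth).
by apply: esym; exact: (@derive_val _ _ _ _ _ _ _ (D th)).
Qed.

Lemma bound_r (a b : nat) (r z t : R) : (a + b <= 2)%N -> 0 <= r -> Q (r, 0, z, t) ->
  `|iter a (pd aX) (iter b (pd aZ) (F u i0)) (r, 0, z, t)| <=
    C * ((ss t)^-1 * ss t ^- a * ((ss t)^-1 * ee h t ^+ 3) ^+ b).
Proof.
move=> ab r0 Qp; have [H _] := fl_bds fl ab r0 Qp.
have /QE[_ /andP[_ t0]] := Qp.
have E := power_bound h a b 0 t0; rewrite oppr0 powRr0 mulr1 addr0 in E.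
by rewrite -E -drzE; exact: H.
Qed.

Lemma bound_zth (a b : nat) (r z t : R) i : (a + b <= 2)%N -> 0 <= r ->
  Q (r, 0, z, t) -> i = i1 \/ i = i2 ->
  `|iter a (pd aX) (iter b (pd aZ) (F u i)) (r, 0, z, t)| <=
    C * ((ss t)^-1 * ee h t ^- 3 * ss t ^- a * ((ss t)^-1 * ee h t ^+ 3) ^+ b).
Proof.
move=> ab r0 Qp ii; have [_ H] := fl_bds fl ab r0 Qp.
have /QE[_ /andP[_ t0]] := Qp.
have E := power_bound h a b h t0.
rewrite powRN in E; have e3 := ee_cube h t0; rewrite -e3 in E; rewrite -E.
rewrite -drzE; apply: le_trans H; case: ii => ->.
  by rewrite lerDr.
by rewrite lerDl.
Qed.

End Flow.

(** * The swirl is bounded *)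

Section Swirl.
Context {R : realType}.
Variables (u : ST R -> R3 R) (pr : ST R -> R) (f : ST R -> R3 R) (h C M : R).
Hypothesis fl : axi_flow u pr f h C M.

Let su i : smooth_on Q (F u i) := fl_u fl i.
Let sd d i : smooth_on Q (pd d (F u i)) := pd_smooth d (su i).

Lemma swirl_X x y z t : Q (x, y, z, t) ->
  is_derive x 1 (fun s => swirl u (s, y, z, t)) (F u i1 (x, y, z, t) +
    x * pd aX (F u i1) (x, y, z, t) - y * pd aX (F u i0) (x, y, z, t)).
Proof.
move=> Qp.
apply: d_eq (d_sub (d_mul (d_id x) (is_derive_X (su i1) Qp))
  (d_cmul y (is_derive_X (su i0) Qp))) _.
by rewrite mulr1 [X in X - _]addrC.
Qed.

Lemma swirl_XX x y z t : Q (x, y, z, t) ->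
  is_derive x 1 (fun x => F u i1 (x, y, z, t) +
    x * pd aX (F u i1) (x, y, z, t) - y * pd aX (F u i0) (x, y, z, t))
   (2 * pd aX (F u i1) (x, y, z, t) + x * pd aX (pd aX (F u i1)) (x, y, z, t) -
    y * pd aX (pd aX (F u i0)) (x, y, z, t)).
Proof.
move=> Qp.
apply: d_eq (d_sub (d_add (is_derive_X (su i1) Qp)
  (d_mul (d_id x) (is_derive_X (sd aX i1) Qp)))
  (d_cmul y (is_derive_X (sd aX i0) Qp))) _; cbv beta.
generalize (pd aX (pd aX (F u i1)) (x, y, z, t)) (pd aX (pd aX (F u i0)) (x, y, z, t)).
generalize (pd aX (F u i1) (x, y, z, t)) (pd aX (F u i0) (x, y, z, t)).
by move=> a b c e /=; ring.
Qed.

Lemma swirl_Y x y z t : Q (x, y, z, t) ->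
  is_derive y 1 (fun s => swirl u (x, s, z, t)) (x * pd aY (F u i1) (x, y, z, t) -
    F u i0 (x, y, z, t) - y * pd aY (F u i0) (x, y, z, t)).
Proof.
move=> Qp.
apply: d_eq (d_sub (d_cmul x (is_derive_Y (su i1) Qp))
  (d_mul (d_id y) (is_derive_Y (su i0) Qp))) _; cbv beta.
generalize (pd aY (F u i1) (x, y, z, t)) (pd aY (F u i0) (x, y, z, t)).
by generalize (F u i0 (x, y, z, t)) (F u i1 (x, y, z, t)) => a b c e /=; ring.
Qed.

Lemma swirl_YY x y z t : Q (x, y, z, t) ->
  is_derive y 1 (fun y => x * pd aY (F u i1) (x, y, z, t) -
    F u i0 (x, y, z, t) - y * pd aY (F u i0) (x, y, z, t))
   (x * pd aY (pd aY (F u i1)) (x, y, z, t) - 2 * pd aY (F u i0) (x, y, z, t) -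
    y * pd aY (pd aY (F u i0)) (x, y, z, t)).
Proof.
move=> Qp.
apply: d_eq (d_sub (d_sub (d_cmul x (is_derive_Y (sd aY i1) Qp))
  (is_derive_Y (su i0) Qp)) (d_mul (d_id y) (is_derive_Y (sd aY i0) Qp))) _; cbv beta.
generalize (pd aY (pd aY (F u i1)) (x, y, z, t)) (pd aY (pd aY (F u i0)) (x, y, z, t)).
generalize (pd aY (F u i1) (x, y, z, t)) (pd aY (F u i0) (x, y, z, t)).
by move=> a b c e /=; ring.
Qed.

Lemma swirl_Z x y z t : Q (x, y, z, t) ->
  is_derive z 1 (fun s => swirl u (x, y, s, t))
   (x * pd aZ (F u i1) (x, y, z, t) - y * pd aZ (F u i0) (x, y, z, t)).
Proof.
by move=> Qp; exact: (d_sub (d_cmul x (is_derive_Z (su i1) Qp))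
  (d_cmul y (is_derive_Z (su i0) Qp))).
Qed.

Lemma swirl_ZZ x y z t : Q (x, y, z, t) ->
  is_derive z 1
   (fun z => x * pd aZ (F u i1) (x, y, z, t) - y * pd aZ (F u i0) (x, y, z, t))
   (x * pd aZ (pd aZ (F u i1)) (x, y, z, t) - y * pd aZ (pd aZ (F u i0)) (x, y, z, t)).
Proof.
by move=> Qp; exact: (d_sub (d_cmul x (is_derive_Z (sd aZ i1) Qp))
  (d_cmul y (is_derive_Z (sd aZ i0) Qp))).
Qed.

Lemma swirl_T x y z t : Q (x, y, z, t) ->
  is_derive t 1 (fun s => swirl u (x, y, z, s))
   (x * pd aT (F u i1) (x, y, z, t) - y * pd aT (F u i0) (x, y, z, t)).
Proof.
by move=> Qp; exact: (d_sub (d_cmul x (is_derive_T (su i1) Qp))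
  (d_cmul y (is_derive_T (su i0) Qp))).
Qed.

End Swirl.

Section PsiSlices.
Context {R : realType}.
Implicit Types (A : R -> R) (x y z t : R).

(** The localising barrier [(tau + kap * zeta^2)^-2], where [zeta] vanishes on the
    lateral boundary: of size [tau^-2] there and bounded inside. *)
Definition Psi A (q : ST R) : R :=
  (- q.2 + kap * ((A q.2 - normsq q) * (A q.2 - normsq q)))^-1 *
  (- q.2 + kap * ((A q.2 - normsq q) * (A q.2 - normsq q)))^-1.

Lemma Psi_X A y z t : (fun s => Psi A (s, y, z, t)) =
  (fun s => JJ (- t) (A t - y ^+ 2 - z ^+ 2) s * JJ (- t) (A t - y ^+ 2 - z ^+ 2) s).
Proof.
apply/funext => s; rewrite /Psi /JJ /EE /normsq/=.
by have -> : A t - (s ^+ 2 + y ^+ 2 + z ^+ 2) = A t - y ^+ 2 - z ^+ 2 - s * s by ring.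
Qed.

Lemma Psi_Y A x z t : (fun s => Psi A (x, s, z, t)) =
  (fun s => JJ (- t) (A t - x ^+ 2 - z ^+ 2) s * JJ (- t) (A t - x ^+ 2 - z ^+ 2) s).
Proof.
apply/funext => s; rewrite /Psi /JJ /EE /normsq/=.
by have -> : A t - (x ^+ 2 + s ^+ 2 + z ^+ 2) = A t - x ^+ 2 - z ^+ 2 - s * s by ring.
Qed.

Lemma Psi_Z A x y t : (fun s => Psi A (x, y, s, t)) =
  (fun s => JJ (- t) (A t - x ^+ 2 - y ^+ 2) s * JJ (- t) (A t - x ^+ 2 - y ^+ 2) s).
Proof.
apply/funext => s; rewrite /Psi /JJ /EE /normsq/=.
by have -> : A t - (x ^+ 2 + y ^+ 2 + s ^+ 2) = A t - x ^+ 2 - y ^+ 2 - s * s by ring.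
Qed.

Lemma Psi_continuous A q : q.2 < 0 -> continuous A -> {for q, continuous (Psi A)}.
Proof.
move=> q0 cA.
have cAq : {for q, continuous (fun q : ST R => A q.2 - normsq q)}.
  apply: cont_sub; last exact: continuous_normsq.
  exact: (@continuous_comp _ _ _ (fun q : ST R => q.2) A q (@continuous_t R q) (cA q.2)).
have c0 : {for q, continuous (fun q : ST R =>
    - q.2 + kap * ((A q.2 - normsq q) * (A q.2 - normsq q)))}.
  apply: (@cont_add _ _ (fun q : ST R => - q.2)); first exact: (cvgN (@continuous_t R q)).
  by apply: cont_mul; [exact: cvg_cst|exact: cont_mul].
have nz : - q.2 + kap * ((A q.2 - normsq q) * (A q.2 - normsq q)) != 0.
  rewrite gt_eqF// ltr_wpDr ?oppr_gt0// mulr_ge0 ?/kap//.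
  by rewrite -expr2 sqr_ge0.
have cJ : {for q, continuous (fun q : ST R =>
   (- q.2 + kap * ((A q.2 - normsq q) * (A q.2 - normsq q)))^-1)}.
  exact: (cvgV nz c0).
by apply: cont_mul; exact: cJ.
Qed.

End PsiSlices.

Section SwirlMax.
Context {R : realType}.
(** The contradiction at a positive interior maximum of [sg * swirl - Mb * Psi].
    The lateral boundary moves in faster than the flow, which gives the transport
    of the barrier a sign; the diffusion of the barrier is smaller than its time
    derivative. The radial derivative of the swirl determines the vertical vorticity
    [F1x - F0y], and the angular derivative of the pressure is
    zero at the point. *)
Lemma swirl_max_algebra (M sg Mb x y z S zeta J : R)
  (F0 F1 F2 F0x F0y F0z F1x F1y F1z F0t F1t : R)
  (F0xx F0yy F0zz F1xx F1yy F1zz px py f0 f1 : R) :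
  sg ^+ 2 = 1 -> 0 < J -> J ^+ 3 >= 1 / 8 -> 0 <= zeta -> zeta <= 1 ->
  kap * zeta ^+ 2 * J <= 1 -> x ^+ 2 + y ^+ 2 + z ^+ 2 <= 1 ->
  0 < x ^+ 2 + y ^+ 2 -> 0 <= M -> 16 * M < Mb ->
  F0t + (F0 * F0x + F1 * F0y + F2 * F0z) - (F0xx + F0yy + F0zz) + px = f0 ->
  F1t + (F0 * F1x + F1 * F1y + F2 * F1z) - (F1xx + F1yy + F1zz) + py = f1 ->
  x * F0y - y * F0x = - F1 -> x * F1y - y * F1x = F0 -> x * py - y * px = 0 ->
  `|x * f1 - y * f0| <= 2 * M ->
  `|x * F0 + y * F1| + `|z * F2| <= S / 2 ->
  sg * (F1 + x * F1x - y * F0x) - Mb * (8 * kap * x * zeta * J ^+ 3) = 0 ->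
  sg * (x * F1y - F0 - y * F0y) - Mb * (8 * kap * y * zeta * J ^+ 3) = 0 ->
  sg * (x * F1z - y * F0z) - Mb * (8 * kap * z * zeta * J ^+ 3) = 0 ->
  sg * (2 * F1x + x * F1xx - y * F0xx) - Mb * (8 * kap * J ^+ 3 *
     (zeta - 2 * x ^+ 2 + 12 * kap * x ^+ 2 * zeta ^+ 2 * J)) <= 0 ->
  sg * (x * F1yy - 2 * F0y - y * F0yy) - Mb * (8 * kap * J ^+ 3 *
     (zeta - 2 * y ^+ 2 + 12 * kap * y ^+ 2 * zeta ^+ 2 * J)) <= 0 ->
  sg * (x * F1zz - y * F0zz) - Mb * (8 * kap * J ^+ 3 *
     (zeta - 2 * z ^+ 2 + 12 * kap * z ^+ 2 * zeta ^+ 2 * J)) <= 0 ->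
  0 <= sg * (x * F1t - y * F0t) - Mb * (2 * (1 - 2 * kap * zeta * (- S)) * J ^+ 3) ->
  False.
Proof.
move=> sg1 J0 J18 z0 z1 zJ n1 r0 M0 MM e0 e1 a0 a1 pcrit fb vel gx gy gz gxx gyy gzz gt.
have w3 : sg * (F1x - F0y) = Mb * (8 * kap * zeta * J ^+ 3).
  apply: (mulfI (lt0r_neq0 r0)).
  have E : (x ^+ 2 + y ^+ 2) * (F1x - F0y) =
    x * (F1 + x * F1x - y * F0x) + y * (x * F1y - F0 - y * F0y) -
    x * (F1 + (x * F0y - y * F0x)) - y * (x * F1y - y * F1x - F0) by ring.
  rewrite a0 a1 addrN subrr !mulr0 !subr0 in E.
  rewrite mulrCA E mulrDr mulrCA (subr0_eq gx) (mulrCA sg y) (subr0_eq gy).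
  ring.
have id0 : (x * F1t - y * F0t) + F0 * (F1 + x * F1x - y * F0x) +
    F1 * (x * F1y - F0 - y * F0y) + F2 * (x * F1z - y * F0z)
    - ((2 * F1x + x * F1xx - y * F0xx) + (x * F1yy - 2 * F0y - y * F0yy) +
       (x * F1zz - y * F0zz)) + 2 * (F1x - F0y) = x * f1 - y * f0 - (x * py - y * px).
  by rewrite -e0 -e1; ring.
rewrite pcrit subr0 in id0.
have id1 : sg * (x * F1t - y * F0t) + F0 * (sg * (F1 + x * F1x - y * F0x)) +
    F1 * (sg * (x * F1y - F0 - y * F0y)) + F2 * (sg * (x * F1z - y * F0z))
    - (sg * (2 * F1x + x * F1xx - y * F0xx) + sg * (x * F1yy - 2 * F0y - y * F0yy) +
       sg * (x * F1zz - y * F0zz)) + 2 * (sg * (F1x - F0y)) = sg * (x * f1 - y * f0).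
  by rewrite -id0; ring.
rewrite (subr0_eq gx) (subr0_eq gy) (subr0_eq gz) w3 in id1.
have sgf : sg * (x * f1 - y * f0) <= 2 * M.
  apply: le_trans (ler_norm _) _; rewrite normrM.
  have sgn : `|sg| = 1.
    have : `|sg| ^+ 2 = 1 by rewrite real_normK ?num_real.
    by move/eqP; rewrite sqrp_eq1// => /eqP.
  by rewrite sgn mul1r.
pose X := Mb * J ^+ 3; pose n := x ^+ 2 + y ^+ 2 + z ^+ 2.
pose v := x * F0 + y * F1 + z * F2; pose W := kap * zeta ^+ 2 * J.
have Mb0 : 0 < Mb by lra.
have J30 : 0 < J ^+ 3 by rewrite exprn_gt0.
have X0 : 0 <= X by rewrite mulr_ge0 ?ltW.
have n0 : 0 <= n by rewrite !addr_ge0 ?sqr_ge0.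
have kap0 : 0 <= (kap : R) by rewrite /kap; lra.
have W0 : 0 <= W by rewrite !mulr_ge0 ?sqr_ge0 ?(ltW J0).
have v0 : 0 <= v + S / 2.
  have : - v <= `|x * F0 + y * F1| + `|z * F2|.
    by rewrite /v opprD lerD// -normrN ler_norm.
  by move: vel; lra.
have nW : n * W <= 1 by exact: mulr_ile1.
have B1 : 0 <= X * (zeta * (v + S / 2)).
  exact: mulr_ge0 X0 (mulr_ge0 z0 v0).
have B2 : 0 <= X * (1 - n * W) by apply: mulr_ge0 X0 _; rewrite subr_ge0.
have B3 : 0 <= X * (1 - zeta) by apply: mulr_ge0 X0 _; rewrite subr_ge0.
have B4 : 0 <= X * n := mulr_ge0 X0 n0.
have B5 : 0 <= X * zeta := mulr_ge0 X0 z0.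
have B6 : Mb / 8 <= X by rewrite /X ler_pM2l//; move: J18; rewrite mul1r.
have total : X * (7 / 5) <= 2 * M.
  apply: le_trans sgf; rewrite -id1; move: gxx gyy gzz gt B1 B2 B3 B4 B5.
  rewrite /n /W /v /X /kap; lra.
by move: B6 total MM M0; lra.
Qed.


End SwirlMax.

Section SwirlBound.
Context {R : realType}.
Variables (u : ST R -> R3 R) (pr : ST R -> R) (f : ST R -> R3 R) (h C M : R).
Hypothesis fl : axi_flow u pr f h C M.

Lemma dist_upd d (p : ST R) (s k : R) : `|upd d p s - upd d p k| = `|s - k|.
Proof.
rewrite (upd_line d p s) (upd_line d p k) opprD addrACA subrr add0r -scalerBl normrZ.
have -> : `|vec d : ST R| = 1; last by rewrite mulr1.
by case: d; rewrite /= /ex /ey /ez /et normSTE normr0 normr1 ?maxxx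
  ?(max_l (@ler01 R)) ?(max_r (@ler01 R)) ?(max_l (@ler01 R)).
Qed.

Lemma dist_X (s x y z t : R) : `|((s, y, z, t) : ST R) - (x, y, z, t)| = `|s - x|.
Proof. exact: (dist_upd aX (x, y, z, t)). Qed.

Lemma dist_Y (s x y z t : R) : `|((x, s, z, t) : ST R) - (x, y, z, t)| = `|s - y|.
Proof. exact: (dist_upd aY (x, y, z, t)). Qed.

Lemma dist_Z (s x y z t : R) : `|((x, y, s, t) : ST R) - (x, y, z, t)| = `|s - z|.
Proof. exact: (dist_upd aZ (x, y, z, t)). Qed.

Lemma dist_T (s x y z t : R) : `|((x, y, z, s) : ST R) - (x, y, z, t)| = `|s - t|.
Proof. exact: (dist_upd aT (x, y, z, t)). Qed.

(** The speed bound in the whole ball, by rotation to the meridian plane. *)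
Lemma radial_speed x y z t : Q (x, y, z, t) ->
  `|rad u (x, y, z, t)| <= C * ((ss t)^-1 * ee h t ^- 3) /\
  `|swirl u (x, y, z, t)| <= C * ((ss t)^-1 * ee h t ^- 3) /\
  `|F u i2 (x, y, z, t)| <= C * ((ss t)^-1 * ee h t ^- 3).
Proof.
move=> Qp; have [Qr -> -> ->] := meridian fl Qp.
have /QE[n /andP[t1 t0]] := Qp.
have r0 := sqrtr_ge0 (x ^+ 2 + y ^+ 2).
have r1 : Num.sqrt (x ^+ 2 + y ^+ 2) <= 1.
  by rewrite -[leRHS]sqrtr1 ler_wsqrtr//; nra.
have C0 := fl_C fl; have s0 := ss_gt0 t0; have e0 := ee_gt0 h t0.
have e1 : ee h t <= 1 by apply: ee_le1; [exact: fl_h fl|rewrite ltW//].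
have B0 := bound_r fl (a := 0) (b := 0) isT r0 Qr.
have B1 := bound_zth fl (a := 0) (b := 0) isT r0 Qr (or_introl erefl).
have B2 := bound_zth fl (a := 0) (b := 0) isT r0 Qr (or_intror erefl).
move: B0 B1 B2; rewrite /= !expr0 invr1 !mulr1.
move: (Num.sqrt _) r0 r1 => r r0 r1 Ba Bb Bc.
set a := F u i0 (r, 0, z, t) in Ba *; set b := F u i1 (r, 0, z, t) in Bb *.
have e31 : 1 <= ee h t ^- 3.
  by rewrite invf_ge1 ?exprn_gt0// exprn_ile1// ltW.
have Ba' : `|a| <= C * ((ss t)^-1 * ee h t ^- 3).
  apply: le_trans Ba _; rewrite ler_pM2l// ler_peMr// invr_ge0 ltW//.
split; last split=> //.
- by rewrite normrM ger0_norm// (le_trans _ Ba')// ler_piMl.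
- by rewrite normrM ger0_norm// (le_trans _ Bb)// ler_piMl.
Qed.

Lemma swirl_no_max (sg Mb d : R) (A : R -> R) x y z t : sg ^+ 2 = 1 ->
  Q (x, y, z, t) -> 0 < d ->
  (forall q, `|q - (x, y, z, t)| < d -> q.2 <= t ->
    sg * swirl u q - Mb * Psi A q <=
    sg * swirl u (x, y, z, t) - Mb * Psi A (x, y, z, t)) ->
  is_derive t 1 A (- (4 * C * ((ss t)^-1 * ee h t ^- 3))) ->
  0 <= A t - normsq (x, y, z, t) <= 1 ->
  dth pr (x, y, z, t) = 0 -> 0 < x ^+ 2 + y ^+ 2 -> 16 * M < Mb -> False.
Proof.
move=> sg1 Qp d0 loc DA /andP[z0 z1] crit r0 MM.
have /QE[n1 /andP[t1 t0]] := Qp.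
have tn0 : 0 < - t by rewrite oppr_gt0.
have [dQ dQ0 HQ] := open_ball_in open_Q Qp.
have m0 : 0 < Num.min d dQ by rewrite lt_min d0.
pose zeta := A t - normsq (x, y, z, t).
pose J := (- t + kap * (zeta * zeta))^-1.
have kap0 : 0 <= (kap : R) by rewrite /kap; lra.
have zz : 0 <= kap * (zeta * zeta) by rewrite mulr_ge0// -expr2 sqr_ge0.
have E0' : 0 < - t + kap * (zeta * zeta) by rewrite ltr_wpDr.
have J0 : 0 < J by rewrite invr_gt0.
have xx1 : `|x| <= 1 by rewrite ler_norml; apply/andP; split; nra.
have yy1 : `|y| <= 1 by rewrite ler_norml; apply/andP; split; nra.
have zz1 : `|z| <= 1 by rewrite ler_norml; apply/andP; split; nra.
have kz1 : kap * (zeta * zeta) <= 1.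
  have : kap * (zeta * zeta) <= 1 * 1.
    apply: ler_pM => //; [by rewrite -expr2 sqr_ge0|by rewrite /kap; lra|].
    by rewrite mulr_ile1.
  by rewrite mul1r.
have J3 : 1 / 8 <= J ^+ 3.
  have J2 : 1 / 2 <= J.
    rewrite /J mul1r lef_pV2 ?posrE//; lra.
  have -> : 1 / 8 = (1 / 2 : R) ^+ 3 by field.
  by rewrite lerXn2r// nnegrE; lra.
have zJ : kap * zeta ^+ 2 * J <= 1.
  rewrite /J ler_pdivrMr// mul1r expr2; lra.
have alX : A t - y ^+ 2 - z ^+ 2 - x * x = zeta by rewrite /zeta /normsq/=; ring.
have alY : A t - x ^+ 2 - z ^+ 2 - y * y = zeta by rewrite /zeta /normsq/=; ring.
have alZ : A t - x ^+ 2 - y ^+ 2 - z * z = zeta by rewrite /zeta /normsq/=; ring.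
have JX : JJ (- t) (A t - y ^+ 2 - z ^+ 2) x = J by rewrite /JJ /EE alX.
have JY : JJ (- t) (A t - x ^+ 2 - z ^+ 2) y = J by rewrite /JJ /EE alY.
have JZ : JJ (- t) (A t - x ^+ 2 - y ^+ 2) z = J by rewrite /JJ /EE alZ.
have [gx gxx] : sg * (F u i1 (x, y, z, t) + x * pd aX (F u i1) (x, y, z, t) -
      y * pd aX (F u i0) (x, y, z, t)) - Mb * (8 * kap * x * zeta * J ^+ 3) = 0 /\
   sg * (2 * pd aX (F u i1) (x, y, z, t) + x * pd aX (pd aX (F u i1)) (x, y, z, t) -
    y * pd aX (pd aX (F u i0)) (x, y, z, t)) - Mb * (8 * kap * J ^+ 3 *
     (zeta - 2 * x ^+ 2 + 12 * kap * x ^+ 2 * zeta ^+ 2 * J)) <= 0.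
  have PX := Psi_X A y z t; set al := A t - y ^+ 2 - z ^+ 2 in PX alX JX.
  rewrite -alX -JX.
  apply: (local_max_derive2 (f := fun s => sg * swirl u (s, y, z, t) -
    Mb * Psi A (s, y, z, t)) (f1 := fun s => sg * (F u i1 (s, y, z, t) +
    s * pd aX (F u i1) (s, y, z, t) - y * pd aX (F u i0) (s, y, z, t)) -
    Mb * (8 * kap * s * (al - s * s) * JJ (- t) al s ^+ 3)) m0).
  - move=> s; rewrite -(dist_X s x y z t) lt_min => /andP[_ /HQ Qs].
    apply: (d_sub (d_cmul sg (swirl_X fl Qs))); apply: d_cmul.
    by rewrite PX; exact: d_psi.
  - by move=> s; rewrite -(dist_X s x y z t) lt_min => /andP[sd _]; exact: loc.
  - exact: (d_sub (d_cmul sg (swirl_XX fl Qp)) (d_cmul Mb (d_psi2 al x tn0))).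
have [gy gyy] : sg * (x * pd aY (F u i1) (x, y, z, t) - F u i0 (x, y, z, t) -
      y * pd aY (F u i0) (x, y, z, t)) - Mb * (8 * kap * y * zeta * J ^+ 3) = 0 /\
   sg * (x * pd aY (pd aY (F u i1)) (x, y, z, t) - 2 * pd aY (F u i0) (x, y, z, t) -
    y * pd aY (pd aY (F u i0)) (x, y, z, t)) - Mb * (8 * kap * J ^+ 3 *
     (zeta - 2 * y ^+ 2 + 12 * kap * y ^+ 2 * zeta ^+ 2 * J)) <= 0.
  have PY := Psi_Y A x z t; set al := A t - x ^+ 2 - z ^+ 2 in PY alY JY.
  rewrite -alY -JY.
  apply: (local_max_derive2 (f := fun s => sg * swirl u (x, s, z, t) -
    Mb * Psi A (x, s, z, t)) (f1 := fun s => sg * (x * pd aY (F u i1) (x, s, z, t) -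
    F u i0 (x, s, z, t) - s * pd aY (F u i0) (x, s, z, t)) -
    Mb * (8 * kap * s * (al - s * s) * JJ (- t) al s ^+ 3)) m0).
  - move=> s; rewrite -(dist_Y s x y z t) lt_min => /andP[_ /HQ Qs].
    apply: (d_sub (d_cmul sg (swirl_Y fl Qs))); apply: d_cmul.
    by rewrite PY; exact: d_psi.
  - by move=> s; rewrite -(dist_Y s x y z t) lt_min => /andP[sd _]; exact: loc.
  - exact: (d_sub (d_cmul sg (swirl_YY fl Qp)) (d_cmul Mb (d_psi2 al y tn0))).
have [gz gzz] : sg * (x * pd aZ (F u i1) (x, y, z, t) -
      y * pd aZ (F u i0) (x, y, z, t)) - Mb * (8 * kap * z * zeta * J ^+ 3) = 0 /\
   sg * (x * pd aZ (pd aZ (F u i1)) (x, y, z, t) -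
    y * pd aZ (pd aZ (F u i0)) (x, y, z, t)) - Mb * (8 * kap * J ^+ 3 *
     (zeta - 2 * z ^+ 2 + 12 * kap * z ^+ 2 * zeta ^+ 2 * J)) <= 0.
  have PZ := Psi_Z A x y t; set al := A t - x ^+ 2 - y ^+ 2 in PZ alZ JZ.
  rewrite -alZ -JZ.
  apply: (local_max_derive2 (f := fun s => sg * swirl u (x, y, s, t) -
    Mb * Psi A (x, y, s, t)) (f1 := fun s => sg * (x * pd aZ (F u i1) (x, y, s, t) -
    y * pd aZ (F u i0) (x, y, s, t)) -
    Mb * (8 * kap * s * (al - s * s) * JJ (- t) al s ^+ 3)) m0).
  - move=> s; rewrite -(dist_Z s x y z t) lt_min => /andP[_ /HQ Qs].
    apply: (d_sub (d_cmul sg (swirl_Z fl Qs))); apply: d_cmul.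
    by rewrite PZ; exact: d_psi.
  - by move=> s; rewrite -(dist_Z s x y z t) lt_min => /andP[sd _]; exact: loc.
  - exact: (d_sub (d_cmul sg (swirl_ZZ fl Qp)) (d_cmul Mb (d_psi2 al z tn0))).
have gt : 0 <= sg * (x * pd aT (F u i1) (x, y, z, t) - y * pd aT (F u i0) (x, y, z, t)) -
   Mb * (2 * (1 - 2 * kap * zeta * (- (4 * C * ((ss t)^-1 * ee h t ^- 3)))) * J ^+ 3).
  apply: (left_max_derive (f := fun s => sg * swirl u (x, y, z, s) -
    Mb * Psi A (x, y, z, s)) d0).
    move=> s /andP[s1 s2]; apply: loc => //.
    by rewrite dist_T ltr_distl s1 (le_lt_trans s2)// ltrDl.
  apply: (d_sub (d_cmul sg (swirl_T fl Qp))); apply: d_cmul.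
  exact: (d_psi_t (normsq (x, y, z, t)) t0 DA).
have dth0 := dthF0 (fl_axi fl) (fl_u fl) Qp.
have dth1 := dthF1 (fl_axi fl) (fl_u fl) Qp.
have E0 := fl_mom fl i0 Qp; have E1 := fl_mom fl i1 Qp.
have [V0 [_ V2]] := radial_speed Qp.
have [f0b _] := fl_force fl i0 Qp; have [f1b _] := fl_force fl i1 Qp.
rewrite /conv /lap /ax /= in E0 E1; rewrite /dth /= in dth0 dth1 crit.
apply: (swirl_max_algebra (M := M) sg1 J0 J3 z0 z1 zJ (ltW n1) r0 (fl_M fl) MM
  E0 E1 dth0 dth1 crit _ _ gx gy gz gxx gyy gzz gt).
- apply: le_trans (ler_normB _ _) _; rewrite !normrM mulr_natl mulr2n.
  by apply: lerD; apply: le_trans (ler_piMl _ _) _.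
- rewrite normrM.
  have V3 := le_trans (ler_piMl (normr_ge0 (F u i2 (x, y, z, t))) zz1) V2.
  apply: le_trans (lerD V0 V3) _.
  generalize ((ss t)^-1 * ee h t ^- 3) => w.
  by have -> : 4 * C * w / 2 = C * w + C * w by field.
Qed.

End SwirlBound.

Section SwirlBounded.
Context {R : realType}.

Lemma speed_power (h t : R) : t < 0 ->
  (- t) `^ (1 / 2 - h - 1) = (ss t)^-1 * ee h t ^- 3.
Proof.
move=> t0; have E := power_bound h 0 0 h t0.
rewrite powRN in E; have e3 := ee_cube h t0; rewrite -e3 !expr0 invr1 !mulr1 in E.
by rewrite -E; congr (_ `^ _); field.
Qed.

Lemma speed_le (h t : R) : 0 < h < 1 / 2 -> -1 <= t < 0 ->
  (ss t)^-1 * ee h t ^- 3 <= (- t)^-1.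
Proof.
move=> hr tt; have /andP[_ t0] := tt.
have s0 := ss_gt0 t0; have e0 := ee_gt0 h t0; have se := ss_le_ee3 hr tt.
have -> : (- t)^-1 = (ss t)^-1 * (ss t)^-1 by rewrite -(ss_sqr t0) expr2 invfM.
rewrite ler_pM2l ?invr_gt0//.
by rewrite lef_pV2 ?posrE// exprn_gt0.
Qed.

Lemma gap01 (a n : R) : 0 <= n -> n < a -> a < 1 -> 0 <= a - n <= 1.
Proof. by move=> n0 na a1; apply/andP; split; lra. Qed.

Lemma norm_le_of_signs (w v b : R) : w - v <= 0 -> - w - v <= 0 -> v <= b -> `|w| <= b.
Proof. by move=> w1 w2 vb; rewrite ler_norml; apply/andP; split; lra. Qed.

Lemma Psi_gt0 (A : R -> R) (q : ST R) : q.2 < 0 -> 0 < Psi A q.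
Proof.
move=> q0; suff : 0 < (- q.2 + kap * ((A q.2 - normsq q) * (A q.2 - normsq q)))^-1.
  by move=> H; rewrite mulr_gt0.
rewrite invr_gt0 ltr_wpDr ?oppr_gt0// mulr_ge0 ?/kap//.
by rewrite -expr2 sqr_ge0.
Qed.

Lemma normsq_ge0 (q : ST R) : 0 <= normsq q.
Proof. by rewrite !addr_ge0 ?sqr_ge0. Qed.

(** On the lateral boundary the barrier is [(- t)^-2], beyond every bound that the
    hypotheses give for the velocity; at a fixed distance from that boundary it is
    bounded. *)
Lemma Psi_ge (A : R -> R) (q : ST R) : -1 <= q.2 < 0 ->
  0 <= A q.2 - normsq q <= 1 -> 1 / 4 <= Psi A q.
Proof.
move=> /andP[q1 q0] /andP[z0 z1]; rewrite /Psi.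
set zeta := A q.2 - normsq q in z0 z1 *.
have k1 : kap * (zeta * zeta) <= 1 * 1.
  have ka : 0 <= (kap : R) by rewrite /kap; lra.
  have kb : (kap : R) <= 1 by rewrite /kap; lra.
  exact: (ler_pM ka (mulr_ge0 z0 z0) kb (mulr_ile1 z0 z0 z1 z1)).
have k0 : 0 <= kap * (zeta * zeta) by rewrite !mulr_ge0 ?/kap.
have J : 1 / 2 <= (- q.2 + kap * (zeta * zeta))^-1.
  rewrite mul1r lef_pV2 ?posrE//; lra.
have -> : 1 / 4 = 1 / 2 * (1 / 2) :> R by field.
by apply: ler_pM => //; lra.
Qed.

Lemma Psi_lateral (A : R -> R) (q : ST R) : normsq q = A q.2 ->
  Psi A q = (- q.2)^-1 * (- q.2)^-1.
Proof. by move=> E; rewrite /Psi E subrr !mulr0 addr0. Qed.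

Lemma Psi_le (A : R -> R) (q : ST R) (g : R) : q.2 < 0 -> 0 < g ->
  g <= A q.2 - normsq q -> Psi A q <= (kap * g ^+ 2) ^- 2.
Proof.
move=> q0 g0 gA; rewrite /Psi; set zeta := A q.2 - normsq q in gA *.
have kap0 : 0 < (kap : R) by rewrite /kap; lra.
have gz : g ^+ 2 <= zeta * zeta by rewrite expr2 ler_pM// ltW.
have kg : 0 < kap * g ^+ 2 by rewrite mulr_gt0// exprn_gt0.
have E : kap * g ^+ 2 <= - q.2 + kap * (zeta * zeta).
  apply: le_trans (_ : kap * (zeta * zeta) <= _); first by rewrite ler_pM2l.
  by rewrite lerDr oppr_ge0 ltW.
have E0 : 0 < - q.2 + kap * (zeta * zeta) by exact: lt_le_trans E.
rewrite -exprVn expr2; apply: ler_pM; rewrite ?invr_ge0 ?(ltW E0)//;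
  by rewrite lef_pV2 ?posrE.
Qed.

Variables (u : ST R -> R3 R) (pr : ST R -> R) (f : ST R -> R3 R) (h C M : R).
Hypothesis fl : axi_flow u pr f h C M.

Lemma swirl_continuous q : Q q -> {for q, continuous (swirl u)}.
Proof.
move=> Qq; apply: cont_sub; apply: cont_mul.
- exact: continuous_x.
- exact: (smooth_continuous (fl_u fl i1) Qq).
- exact: continuous_y.
- exact: (smooth_continuous (fl_u fl i0) Qq).
Qed.

Lemma swirl_axis x y z t : x ^+ 2 + y ^+ 2 = 0 -> swirl u (x, y, z, t) = 0.
Proof.
move/eqP; rewrite paddr_eq0 ?sqr_ge0// !sqrf_eq0 => /andP[/eqP -> /eqP ->].
by rewrite /swirl/= !mul0r subrr.
Qed.

(** The swirl [r u_theta] obeys a maximum principle; near [t = 0] it stays bounded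
    in the interior, whatever happens at the boundary of the ball. *)
Lemma swirl_bounded (q : R) : 0 < q < 1 -> exists t1 K : R,
  [/\ -1 < t1, t1 < 0, 0 <= K & forall p, Q p -> t1 <= p.2 -> normsq p <= q ->
    `|swirl u p| <= K].
Proof.
move=> /andP[q0 q1].
pose qm := (1 + q) / 2.
have qm1 : qm < 1 by rewrite /qm; lra.
have qqm : q < qm by rewrite /qm; lra.
have hr := fl_h fl; have /andP[h0 h12] := hr.
have C0 := fl_C fl; have M0 := fl_M fl.
have c40 : 0 <= 4 * C by lra.
have k0 : 0 < 1 / 2 - h by lra.
have T0 : -1 < 0 :> R by lra.
have [t1 [t1m _ t10 HA]] := moving_boundary qm1 c40 k0 T0.
have mt1 : 0 < - t1 by rewrite oppr_gt0.
(* Large enough for the force, and to dominate the swirl, which is at most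
   [C / (- t)], at the initial time and on the lateral boundary. *)
pose Mb := 16 * M + 4 * C / (- t1) + 1.
have Ct : C <= 4 * C / - t1.
  by rewrite ler_pdivlMr//; nra.
have Ct0 : 0 <= C / - t1 by rewrite divr_ge0// ltW.
have Mb16 : 16 * M < Mb by rewrite /Mb; lra.
have MbC : C <= Mb by rewrite /Mb; lra.
have MbCt : C / - t1 <= Mb * (1 / 4) by rewrite /Mb; lra.
have Mb0 : 0 < Mb by lra.
pose g := qm - q.
have g0 : 0 < g by rewrite subr_gt0.
have kap0 : 0 < (kap : R) by rewrite /kap; lra.
have Kp : 0 <= (kap * g ^+ 2) ^- 2.
  by rewrite invr_ge0 exprn_ge0// mulr_ge0 ?sqr_ge0// ltW.
exists t1, (Mb * (kap * g ^+ 2) ^- 2); split=> //.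
  by rewrite mulr_ge0// ltW.
move=> p0 Qp0 tp0 np0.
have t00 : p0.2 < 0 by case: Qp0 => _ /andP[].
have [A [cA decA A1 dA]] := HA _ tp0 t00.
have main sg : sg ^+ 2 = 1 -> `|sg| = 1 -> sg * swirl u p0 - Mb * Psi A p0 <= 0.
  move=> sg2 sg1; rewrite leNgt; apply/negP => Hp0.
  have A1' t : t1 <= t <= p0.2 -> A t < 1 by move=> /A1/andP[].
  have absG p : Q p -> sg * swirl u p <= C * (- p.2)^-1.
    case: p => [[[x y] z] t] Qp; apply: le_trans (ler_norm _) _.
    rewrite normrM sg1 mul1r; have [_ [B _]] := radial_speed fl Qp.
    apply: le_trans B _; rewrite ler_pM2l//; apply: speed_le => //.
    by have /QE[_ /andP[a b]] := Qp; rewrite (ltW a).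
  have QA p : t1 <= p.2 <= p0.2 -> normsq p < 1 -> Q p.
    case: p => [[[x y] z] t] /= /andP[a b] n; apply/QE; split=> //.
    by rewrite (lt_le_trans t1m a) (le_lt_trans b t00).
  have [|||||p [_ tp np Hp pmax]] := @interior_max R setT A t1 p0.2
    (fun p => sg * swirl u p - Mb * Psi A p) p0 closedT t1m t00 cA decA A1' _ _ _ I _ _ Hp0.
  - move=> p _ tp n; have Qp := QA p tp n.
    have p20 : p.2 < 0 by move/andP: tp => [_ /le_lt_trans]; apply.
    apply: cont_sub; apply: cont_mul; try exact: cvg_cst.
      exact: swirl_continuous.
    exact: Psi_continuous.
  - move=> p _ tp np; rewrite subr_le0.
    have tt : t1 <= p.2 <= p0.2 by rewrite tp lexx.
    have A1p := A1' _ tt; rewrite tp in A1p.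
    have Qp : Q p by apply: QA => //; exact: le_lt_trans np A1p.
    apply: le_trans (absG p Qp) _; rewrite tp; apply: le_trans MbCt _.
    rewrite ler_pM2l//; apply: Psi_ge.
      by rewrite tp (ltW t1m) t10.
    rewrite tp; have := normsq_ge0 p; lra.
  - move=> p _ tp np; rewrite subr_le0.
    have A1p := A1' _ tp.
    have Qp : Q p by apply: QA => //; rewrite np.
    have p20 : 0 < - p.2 by move/andP: tp => [_ /le_lt_trans/(_ t00)]; rewrite oppr_gt0.
    have p21 : - p.2 <= 1 by move/andP: tp => [a _]; lra.
    apply: le_trans (absG p Qp) _; rewrite (Psi_lateral np).
    apply: ler_pM => //; first exact: ltW.
      by rewrite invr_ge0 ltW.
    by rewrite ler_peMr ?invr_ge0 ?(ltW p20)// invf_ge1.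
  - by rewrite tp0 lexx.
  - by apply: le_trans np0 _; apply: le_trans (ltW qqm) _;
      have /andP[] := A1 p0.2 (introT andP (conj tp0 (lexx _))).
  have /andP[tp1 tp2] := tp.
  have tt : t1 <= p.2 <= p0.2 by rewrite (ltW tp1).
  have p20 : p.2 < 0 by exact: le_lt_trans tp2 t00.
  have Qp : Q p by apply: QA => //; exact: lt_trans np (A1' _ tt).
  have [th cth] := pressure_critical fl Qp.
  have np' : normsq (rot th p) < A (rot th p).2 by rewrite rotn.
  have [d d0 Hd] := interior_near (p := rot th p) decA tp np'.
  have HE : sg * swirl u (rot th p) - Mb * Psi A (rot th p) =
      sg * swirl u p - Mb * Psi A p.
    by rewrite (swirl_rot fl)// /Psi rotn.
  have loc (r : ST R) : `|r - rot th p| < d -> r.2 <= (rot th p).2 ->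
      sg * swirl u r - Mb * Psi A r <=
      sg * swirl u (rot th p) - Mb * Psi A (rot th p).
    by move=> r1 r2; rewrite HE; have [a b] := Hd r r1 r2; exact: pmax.
  have Qr : Q (rot th p) by exact: rotQ.
  have Hr : 0 < sg * swirl u (rot th p) - Mb * Psi A (rot th p) by rewrite HE.
  have nA : 0 <= A (rot th p).2 - normsq (rot th p) <= 1.
    by rewrite rotn; exact: gap01 (normsq_ge0 p) np (A1' _ tt).
  have DA : is_derive (rot th p).2 1 A
      (- (4 * C * ((ss (rot th p).2)^-1 * ee h (rot th p).2 ^- 3))).
    by have := dA _ tt; rewrite (speed_power h p20).
  have r20 : (rot th p).2 < 0 by [].
  move: (rot th p) loc Qr Hr nA DA cth r20 => [[[x y] z] t] loc Qr Hr nA DA cr r20.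
  apply: (swirl_no_max fl sg2 Qr d0 loc DA nA cr _ Mb16).
  rewrite lt_neqAle eq_sym addr_ge0 ?sqr_ge0// andbT; apply/eqP => r0.
  move: Hr; rewrite (swirl_axis _ _ r0) mulr0 sub0r oppr_gt0 ltNge.
  by rewrite mulr_ge0 ?(ltW Mb0)// ltW// Psi_gt0.
have P0 : Psi A p0 <= (kap * g ^+ 2) ^- 2.
  apply: Psi_le => //.
  have /A1/andP[a _] : t1 <= p0.2 <= p0.2 by rewrite tp0 lexx.
  rewrite /g; lra.
have MP : Mb * Psi A p0 <= Mb * (kap * g ^+ 2) ^- 2 by rewrite ler_pM2l.
have M1 := main 1 (expr1n _ 2) (normr1 _).
have M2 := main (-1) (etrans (sqrrN 1) (expr1n _ 2)) (etrans (normrN _) (normr1 _)).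
rewrite mul1r in M1; rewrite mulN1r in M2.
exact: norm_le_of_signs M1 M2 MP.
Qed.

End SwirlBounded.

(** * Rate of the swirl at the axis *)

Section SwirlRate.
Context {R : realType}.

Lemma MVT_upd d p (g : ST R -> R) (a b : R) : smooth_on Q g -> a < b ->
  (forall s, a <= s <= b -> Q (upd d p s)) ->
  exists2 c, a < c < b & g (upd d p b) - g (upd d p a) = pd d g (upd d p c) * (b - a).
Proof.
move=> sg ab Qs.
have D (s : R) : a <= s <= b ->
    is_derive s 1 (fun s => g (upd d p s)) (pd d g (upd d p s)).
  by move=> /Qs Qp; exact: is_derive_upd (is_derive_pd d sg Qp).
have [c + E] : exists2 c, c \in `]a, b[%R &
    g (upd d p b) - g (upd d p a) = pd d g (upd d p c) * (b - a).
  apply: (@MVT _ (fun s => g (upd d p s)) (fun s => pd d g (upd d p s))) => //.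
    by move=> s; rewrite in_itv/= => /andP[s1 s2]; apply: D; rewrite !ltW.
  apply: derivable_within_continuous => s; rewrite in_itv/= => ss.
  by have [] := D s ss.
by rewrite in_itv/= => cab; exists c.
Qed.

Lemma MVT_X (g : ST R -> R) (a b y z t : R) : smooth_on Q g -> a < b ->
  (forall s, a <= s <= b -> Q (s, y, z, t)) ->
  exists2 c, a < c < b & g (b, y, z, t) - g (a, y, z, t) =
    pd aX g (c, y, z, t) * (b - a).
Proof. exact: (@MVT_upd aX (0, y, z, t)). Qed.

Lemma MVT_Z (g : ST R -> R) (a b x y t : R) : smooth_on Q g -> a < b ->
  (forall s, a <= s <= b -> Q (x, y, s, t)) ->
  exists2 c, a < c < b & g (x, y, b, t) - g (x, y, a, t) =
    pd aZ g (x, y, c, t) * (b - a).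
Proof. exact: (@MVT_upd aZ (x, y, 0, t)). Qed.

Lemma QE0 (x z t : R) : Q (x, 0, z, t) <-> x ^+ 2 + z ^+ 2 < 1 /\ -1 < t < 0.
Proof. by rewrite QE expr0n/= addr0. Qed.

Lemma Q_shrink (x x' z t : R) : Q (x', 0, z, t) -> 0 <= x <= x' -> Q (x, 0, z, t).
Proof.
move=> /QE0[n tt] /andP[x0 xx]; apply/QE0; split=> //.
apply: le_lt_trans n; rewrite lerD2r ler_sqr ?nnegrE//.
exact: le_trans x0 xx.
Qed.

Variables (u : ST R -> R3 R) (pr : ST R -> R) (f : ST R -> R3 R) (h C M : R).
Hypothesis fl : axi_flow u pr f h C M.

Lemma dth_axis (g : ST R -> R) z t : dth g (0, 0, z, t) = 0.
Proof.
have E (a b : R) : 0 * a - 0 * b = 0 by ring.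
exact: E.
Qed.

Lemma F1_axis z t : Q (0, 0, z, t) -> F u i1 (0, 0, z, t) = 0.
Proof.
move=> Qp.
have E := etrans (esym (dth_axis (F u i0) z t)) (dthF0 (fl_axi fl) (fl_u fl) Qp).
by apply: oppr_inj; apply: etrans (esym E) _; rewrite oppr0.
Qed.

Lemma F0_axis z t : Q (0, 0, z, t) -> F u i0 (0, 0, z, t) = 0.
Proof.
move=> Qp; apply: etrans (esym (dthF1 (fl_axi fl) (fl_u fl) Qp)) _.
exact: dth_axis.
Qed.

Lemma pd_opp d (g : ST R -> R) p : smooth_on Q g -> Q p ->
  pd d (fun q => - g q) p = - pd d g p.
Proof.
by move=> sg Qp; apply: is_derive_pdE; exact: (is_deriveN (is_derive_pd d sg Qp)).
Qed.

Lemma dth_pdF0 d p : Q p -> dth (pd d (F u i0)) p = - pd d (F u i1) p -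
  ((vec d : ST R).1.1.1 * pd aY (F u i0) p - (vec d : ST R).1.1.2 * pd aX (F u i0) p).
Proof.
move=> Qp; rewrite (dth_pd d open_Q (fl_u fl i0) (dthF0 (fl_axi fl) (fl_u fl)) Qp).
by rewrite (pd_opp d (fl_u fl i1) Qp).
Qed.

Lemma dth_pdF1 d p : Q p -> dth (pd d (F u i1)) p = pd d (F u i0) p -
  ((vec d : ST R).1.1.1 * pd aY (F u i1) p - (vec d : ST R).1.1.2 * pd aX (F u i1) p).
Proof.
by move=> Qp; rewrite (dth_pd d open_Q (fl_u fl i1) (dthF1 (fl_axi fl) (fl_u fl)) Qp).
Qed.

Lemma dth_pdF2 d p : Q p -> dth (pd d (F u i2)) p =
  - ((vec d : ST R).1.1.1 * pd aY (F u i2) p - (vec d : ST R).1.1.2 * pd aX (F u i2) p).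
Proof.
move=> Qp; rewrite (dth_pd d open_Q (fl_u fl i2) (dthF2 (fl_axi fl) (fl_u fl)) Qp).
rewrite (_ : pd d (fun=> 0) p = 0) ?sub0r//.
by apply: is_derive_pdE; exact: is_derive_cst.
Qed.

Lemma F1z_axis z t : Q (0, 0, z, t) -> pd aZ (F u i1) (0, 0, z, t) = 0.
Proof.
move=> Qp.
have E := etrans (esym (dth_axis (pd aZ (F u i0)) z t)) (dth_pdF0 aZ Qp).
apply: oppr_inj; rewrite oppr0; apply: etrans (esym E); symmetry.
have E' (a b c : R) : a - (0 * b - 0 * c) = a by ring.
exact: E'.
Qed.

(** Near the axis [u_theta / r] is compared with its value at the distance
    [s e], which is where the bound on the swirl and the second derivative
    bound balance. *)
Lemma swirl_rate (q : R) : 0 < q < 1 -> exists t1 K : R,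
  [/\ -1 < t1, t1 < 0, 0 <= K & forall x z t, 0 < x -> Q (x, 0, z, t) -> t1 <= t ->
    x ^+ 2 + z ^+ 2 <= q -> x * `|F u i1 (x, 0, z, t)| <= K /\
    `|F u i1 (x, 0, z, t)| <= K * x * (ss t ^- 2 * ee h t ^- 2)].
Proof.
move=> /andP[q0 q1].
have qm : 0 < (1 + q) / 2 < 1 by apply/andP; split; lra.
have [t1 [K [t1m t10 K0 HK]]] := swirl_bounded fl qm.
have C0 := fl_C fl; have hr := fl_h fl.
exists (Num.max t1 (- ((1 - q) / 2))), (K + C); split.
- by rewrite lt_max t1m.
- by rewrite gt_max t10; lra.
- by rewrite addr_ge0// ltW.
move=> x z t x0 Qp; rewrite ge_max => /andP[t1t tq] n.
have /QE0[n1 /andP[tm t0]] := Qp.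
have s0 := ss_gt0 t0; have e0 := ee_gt0 h t0.
have tt : -1 <= t < 0 by rewrite (ltW tm).
have s1 := ss_le1 tt; have e1 := ee_le1 hr tt.
have s2 := ss_sqr t0.
move: (ss t) (ee h t) s0 e0 s1 e1 s2
  (fun r r0 Qr => bound_zth fl (a := 2) (b := 0) (r := r) (z := z) (t := t) isT r0 Qr
     (or_introl erefl)) => s e s0 e0 s1 e1 s2 Bd.
pose d := s * e.
have d0 : 0 < d by rewrite mulr_gt0.
have d2 : d ^+ 2 <= (1 - q) / 2.
  rewrite /d exprMn s2; apply: le_trans (_ : - t * 1 <= _); last by lra.
  by rewrite ler_pM2l ?oppr_gt0// exprn_ile1// ltW.
have G y : 0 < y -> y ^+ 2 + z ^+ 2 <= (1 + q) / 2 -> y * `|F u i1 (y, 0, z, t)| <= K.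
  move=> y0 ny; have Qy : Q (y, 0, z, t).
    by apply/QE0; rewrite tm t0; split=> //; lra.
  have := HK _ Qy t1t; rewrite /normsq/= expr0n/= addr0 => /(_ ny).
  by rewrite /swirl/= mul0r subr0 normrM gtr0_norm.
have xK : x * `|F u i1 (x, 0, z, t)| <= K by apply: G => //; lra.
split; first by apply: le_trans xK _; rewrite lerDl ltW.
have rate y : d <= y -> y ^+ 2 + z ^+ 2 <= (1 + q) / 2 ->
    `|F u i1 (y, 0, z, t)| <= K * y * (s ^- 2 * e ^- 2).
  move=> dy ny; have y0 := lt_le_trans d0 dy.
  have := G y y0 ny; move: (`|_|) => w yw.
  rewrite -invfM -exprMn -/d -(ler_pM2l y0); apply: le_trans yw _.
  rewrite -mulrA mulrCA ler_peMr// mulrA -expr2 ler_pdivlMr ?exprn_gt0// mul1r.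
  by rewrite ler_sqr ?nnegrE ?(ltW d0) ?(ltW y0).
have [dx|xd] := leP d x.
  apply: le_trans (rate x dx _) _; first by lra.
  by rewrite ler_wpM2r ?ler_wpM2r ?lerDl ?(ltW C0) ?(ltW x0)// mulr_ge0// invr_ge0 exprn_ge0// ltW.
have Qd y : 0 <= y <= d -> Q (y, 0, z, t).
  move=> /andP[y0 yd]; apply/QE0; rewrite tm t0; split=> //.
  have : y ^+ 2 <= d ^+ 2 by rewrite ler_sqr ?nnegrE// ltW.
  have := sqr_ge0 x; lra.
have nd : d ^+ 2 + z ^+ 2 <= (1 + q) / 2 by have := sqr_ge0 x; lra.
have su := fl_u fl i1; have F1a : F u i1 (0, 0, z, t) = 0.
  by apply: F1_axis; apply: Qd; rewrite lexx ltW.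
have [c1 /andP[c10 c1x] E1] : exists2 c, 0 < c < x & F u i1 (x, 0, z, t) -
    F u i1 (0, 0, z, t) = pd aX (F u i1) (c, 0, z, t) * (x - 0).
  by apply: MVT_X => // y /andP[y0 yx]; apply: Qd; rewrite y0 (le_trans yx)// ltW.
have [c2 /andP[c20 c2d] E2] : exists2 c, 0 < c < d & F u i1 (d, 0, z, t) -
    F u i1 (0, 0, z, t) = pd aX (F u i1) (c, 0, z, t) * (d - 0).
  exact: (MVT_X su d0 Qd).
have near_eq : `|pd aX (F u i1) (c1, 0, z, t) - pd aX (F u i1) (c2, 0, z, t)| <=
    C * (s ^- 2 * e ^- 2).
  have H a b : 0 < a -> a < b -> b < d -> `|pd aX (F u i1) (b, 0, z, t) -
      pd aX (F u i1) (a, 0, z, t)| <= C * (s ^- 2 * e ^- 2).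
    move=> a0 ab bd.
    have [c /andP[ca cb] ->] : exists2 c, a < c < b & pd aX (F u i1) (b, 0, z, t) -
      pd aX (F u i1) (a, 0, z, t) = pd aX (pd aX (F u i1)) (c, 0, z, t) * (b - a).
      apply: MVT_X => //; first exact: pd_smooth.
      move=> y /andP[ay yb]; apply: Qd; rewrite (le_trans (ltW a0) ay)/=.
      by rewrite (le_trans yb)// ltW.
    have c0 : 0 <= c by rewrite ltW// (lt_trans a0).
    have Qc : Q (c, 0, z, t) by apply: Qd; rewrite c0 ltW// (lt_trans cb).
    have := Bd c c0 Qc; rewrite /= expr0 mulr1.
    rewrite normrM; move: (`|pd _ _ _|) (normr_ge0 (pd aX (pd aX (F u i1)) (c, 0, z, t))).
    move=> w w0 Bw.
    apply: le_trans (ler_pM w0 (normr_ge0 _) Bw (_ : _ <= d)) _.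
      rewrite gtr0_norm ?subr_gt0//; lra.
    rewrite /d le_eqVlt; apply/orP; left; apply/eqP.
    by field; rewrite !gt_eqF.
  have [cc|cc|->] := ltgtP c1 c2.
  - by rewrite distrC; apply: H.
  - by apply: H => //; exact: lt_trans xd.
  - by rewrite subrr normr0 mulr_ge0 ?(ltW C0)// mulr_ge0 // invr_ge0 exprn_ge0// ltW.
have rd := rate d (lexx d) nd; clearbody d.
move: E1 E2 rd near_eq; rewrite F1a !subr0 => -> ->.
move: (pd _ _ _) (pd _ _ _) => w1 w2; rewrite !normrM (gtr0_norm x0) (gtr0_norm d0).
rewrite mulrAC (ler_pM2r d0) => Kw Cw.
rewrite mulrAC (ler_pM2r x0) mulrDl.
by have := ler_normD (w1 - w2) w2; rewrite subrK; lra.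
Qed.

End SwirlRate.

(** * The equation of the angular vorticity *)

Section Vorticity.
Context {R : realType}.
Variables (u : ST R -> R3 R) (pr : ST R -> R) (f : ST R -> R3 R) (h C M : R).
Hypothesis fl : axi_flow u pr f h C M.

Let su i : smooth_on Q (F u i) := fl_u fl i.

Lemma pd_add d (g k : ST R -> R) p (a b : R) : is_derive p (vec d) g a ->
  is_derive p (vec d) k b -> is_derive p (vec d) (fun q => g q + k q) (a + b).
Proof. by move=> Dg Dk; exact: (is_deriveD Dg Dk). Qed.

Lemma pd_subd d (g k : ST R -> R) p (a b : R) : is_derive p (vec d) g a ->
  is_derive p (vec d) k b -> is_derive p (vec d) (fun q => g q - k q) (a - b).
Proof. by move=> Dg Dk; exact: (is_deriveB Dg Dk). Qed.

(** The component of the vorticity that becomes the angular one on the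
    meridian half-plane. *)
Definition vort (q : ST R) : R := pd aZ (F u i0) q - pd aX (F u i2) q.

Lemma vort_smooth : smooth_on Q vort.
Proof. by apply: smooth_sub; [exact: open_Q|exact: pd_smooth|exact: pd_smooth]. Qed.

Lemma pd_vort d p : Q p ->
  pd d vort p = pd d (pd aZ (F u i0)) p - pd d (pd aX (F u i2)) p.
Proof.
move=> Qp; apply: is_derive_pdE; apply: pd_subd;
  by apply: is_derive_pd Qp; exact: pd_smooth.
Qed.

Lemma pd_pd_vort d p : Q p ->
  pd d (pd d vort) p = pd d (pd d (pd aZ (F u i0))) p - pd d (pd d (pd aX (F u i2))) p.
Proof.
move=> Qp.
rewrite (eq_pd d open_Q (fun q Qq => pd_vort d Qq) Qp).
by apply: is_derive_pdE; apply: pd_subd;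
  apply: is_derive_pd Qp; do 2 apply: pd_smooth.
Qed.

(** Derivatives are commuted here, so that the vorticity equation becomes an
    algebraic combination of two instances. *)
Lemma momentum_pd i d p : Q p ->
  pd aT (pd d (F u i)) p +
  (F u i0 p * pd aX (pd d (F u i)) p + pd aX (F u i) p * pd d (F u i0) p +
   (F u i1 p * pd aY (pd d (F u i)) p + pd aY (F u i) p * pd d (F u i1) p) +
   (F u i2 p * pd aZ (pd d (F u i)) p + pd aZ (F u i) p * pd d (F u i2) p)) -
  (pd aX (pd aX (pd d (F u i))) p + pd aY (pd aY (pd d (F u i))) p +
   pd aZ (pd aZ (pd d (F u i))) p) + pd d (pd (ax i) pr) p = pd d (F f i) p.
Proof.
move=> Qp.
rewrite -(eq_pd d open_Q (fun q Qq => fl_mom fl i Qq) Qp).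
have s1 e : smooth_on Q (pd e (F u i)) by exact: pd_smooth.
have c1 e : pd d (pd e (F u i)) p = pd e (pd d (F u i)) p.
  exact: (pd_comm d e open_Q (su i) Qp).
have c2 e : pd d (pd e (pd e (F u i))) p = pd e (pd e (pd d (F u i))) p.
  rewrite (pd_comm d e open_Q (s1 e) Qp); apply: (eq_pd _ open_Q) Qp => q Qq.
  exact: (pd_comm d e open_Q (su i) Qq).
have D1 e : is_derive p (vec d) (pd e (F u i)) (pd e (pd d (F u i)) p).
  by rewrite -c1; exact: is_derive_pd (s1 e) Qp.
have D2 e : is_derive p (vec d) (pd e (pd e (F u i))) (pd e (pd e (pd d (F u i))) p).
  by rewrite -c2; exact: is_derive_pd (pd_smooth e (s1 e)) Qp.
have DF j := is_derive_pd d (su j) Qp.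
have D := pd_add (pd_subd (pd_add (D1 aT) (pd_add (pd_add
  (is_derive_mul (DF i0) (D1 aX)) (is_derive_mul (DF i1) (D1 aY)))
  (is_derive_mul (DF i2) (D1 aZ)))) (pd_add (pd_add (D2 aX) (D2 aY)) (D2 aZ)))
  (is_derive_pd d (pd_smooth (ax i) (fl_p fl)) Qp).
by symmetry; exact: (is_derive_pdE D).
Qed.

Lemma vorticity_cartesian p : Q p ->
  pd aT vort p + (F u i0 p * pd aX vort p + F u i1 p * pd aY vort p + F u i2 p * pd aZ vort p)
  - (pd aX (pd aX vort) p + pd aY (pd aY vort) p + pd aZ (pd aZ vort) p) +
  (pd aZ (F u i0) p * pd aX (F u i0) p + pd aZ (F u i1) p * pd aY (F u i0) p +
   pd aZ (F u i2) p * pd aZ (F u i0) p - pd aX (F u i0) p * pd aX (F u i2) p -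
   pd aX (F u i1) p * pd aY (F u i2) p - pd aX (F u i2) p * pd aZ (F u i2) p) =
  pd aZ (F f i0) p - pd aX (F f i2) p.
Proof.
move=> Qp; have E0 := momentum_pd i0 aZ Qp; have E2 := momentum_pd i2 aX Qp.
have Ep : pd aZ (pd (ax i0) pr) p = pd aX (pd (ax i2) pr) p.
  exact: (pd_comm aZ aX open_Q (fl_p fl) Qp).
rewrite -E0 -E2 Ep !(pd_vort _ Qp) !(pd_pd_vort _ Qp).
have alg (t0 t2 a b c ax ay az bx by_ bz axx ayy azz bxx byy bzz
   F0x F0y F0z F1x F1z F2x F2y F2z P : R) :
  t0 - t2 + (a * (ax - bx) + b * (ay - by_) + c * (az - bz)) -
    (axx - bxx + (ayy - byy) + (azz - bzz)) +
    (F0z * F0x + F1z * F0y + F2z * F0z - F0x * F2x - F1x * F2y - F2x * F2z) =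
  t0 + (a * ax + F0x * F0z + (b * ay + F0y * F1z) + (c * az + F0z * F2z)) -
    (axx + ayy + azz) + P -
  (t2 + (a * bx + F2x * F0x + (b * by_ + F2y * F1x) + (c * bz + F2z * F2x)) -
    (bxx + byy + bzz) + P) by ring.
exact: alg.
Qed.

(** The horizontal vorticity rotates like the horizontal velocity; this gives the
    derivatives of [vort] in the direction of [y] at [y = 0]. *)
Definition vort_rad (q : ST R) : R := pd aY (F u i2) q - pd aZ (F u i1) q.

Lemma dth_sub (g k : ST R -> R) p : smooth_on Q g -> smooth_on Q k -> Q p ->
  dth (fun q => g q - k q) p = dth g p - dth k p.
Proof.
move=> sg sk Qp.
have E d : pd d (fun q => g q - k q) p = pd d g p - pd d k p.
  exact: is_derive_pdE (pd_subd (is_derive_pd d sg Qp) (is_derive_pd d sk Qp)).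
rewrite /dth !E.
have alg (x y a b c d : R) : x * (a - b) - y * (c - d) = x * a - y * c - (x * b - y * d).
  by ring.
exact: alg.
Qed.

Lemma dth_vort p : Q p -> dth vort p = vort_rad p.
Proof.
move=> Qp; rewrite (dth_sub (pd_smooth _ (su _)) (pd_smooth _ (su _)) Qp).
rewrite (dth_pdF0 fl aZ Qp) (dth_pdF2 fl aX Qp).
have alg (a b c d e : R) : - a - (0 * b - 0 * c) - - (1 * d - 0 * e) = d - a by ring.
exact: alg.
Qed.

Lemma dth_vort_rad p : Q p -> dth vort_rad p = - vort p.
Proof.
move=> Qp; rewrite (dth_sub (pd_smooth _ (su _)) (pd_smooth _ (su _)) Qp).
rewrite (dth_pdF1 fl aZ Qp) (dth_pdF2 fl aY Qp).
have alg (a b c d e : R) : - (0 * a - 1 * b) - (c - (0 * d - 0 * e)) = - (c - b) by ring.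
exact: alg.
Qed.

Lemma vort_axis z t : Q (0, 0, z, t) -> vort (0, 0, z, t) = 0.
Proof.
move=> Qp; have E := etrans (esym (dth_axis vort_rad z t)) (dth_vort_rad Qp).
by apply: oppr_inj; apply: etrans (esym E) _; rewrite oppr0.
Qed.

Lemma dth_meridian (g : ST R -> R) x z t : dth g (x, 0, z, t) = x * pd aY g (x, 0, z, t).
Proof.
have alg (a b : R) : x * a - 0 * b = x * a by ring.
exact: alg.
Qed.

(** The pressure cancels, and incompressibility reduces the stretching terms to
    [u_r / r]; the [z]-derivative of the squared swirl is the only source besides
    the force. *)
Lemma vorticity_meridian x z t (p := (x, 0, z, t) : ST R) : Q p -> 0 < x ->
  pd aT vort p + F u i0 p * pd aX vort p + F u i2 p * pd aZ vort p
  - (pd aX (pd aX vort) p + pd aX vort p / x + pd aZ (pd aZ vort) p)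
  + (x ^- 2 - F u i0 p / x) * vort p =
  2 * F u i1 p * pd aZ (F u i1) p / x + (pd aZ (F f i0) p - pd aX (F f i2) p).
Proof.
move=> Qp x0; have xn : x != 0 by rewrite gt_eqF.
have yE g v : dth g p = v -> pd aY g p = v / x.
  move=> gv; have := dth_meridian g x z t; rewrite -/p gv => ->.
  by rewrite mulrC mulKf.
have F0y := yE _ _ (dthF0 (fl_axi fl) (fl_u fl) Qp).
have F1y := yE _ _ (dthF1 (fl_axi fl) (fl_u fl) Qp).
have F2y := yE _ _ (dthF2 (fl_axi fl) (fl_u fl) Qp).
have Wty := yE _ _ (dth_vort Qp); have Wry := yE _ _ (dth_vort_rad Qp).
have Wtyy : pd aY (pd aY vort) p = (pd aY vort_rad p + pd aX vort p) / x.
  apply: yE; rewrite (dth_pd aY open_Q vort_smooth dth_vort Qp).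
  have alg (a b c : R) : a - (0 * b - 1 * c) = a + c by ring.
  exact: alg.
have WrE : vort_rad p = - pd aZ (F u i1) p by rewrite /vort_rad F2y mul0r sub0r.
have WtE : vort p = pd aZ (F u i0) p - pd aX (F u i2) p by [].
have D := fl_div fl Qp; have V := vorticity_cartesian Qp.
rewrite -V Wty Wtyy Wry WrE F0y F2y.
rewrite F1y in D.
have alg (t0 a b c wx wz wxx wzz W az ax bz bx cz cx : R) : W = az - cx ->
  ax + a / x + cz = 0 ->
  t0 + a * wx + c * wz - (wxx + wx / x + wzz) + (x ^- 2 - a / x) * W =
  2 * b * bz / x + (t0 + (a * wx + b * (- bz / x) + c * wz) -
   (wxx + (- W / x + wx) / x + wzz) +
   (az * ax + bz * (- b / x) + cz * az - ax * cx - bx * (0 / x) - cx * cz)).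
  move=> WE DE.
  have -> : (az * ax + bz * (- b / x) + cz * az - ax * cx - bx * (0 / x) - cx * cz) =
    (ax + a / x + cz) * (az - cx) - a / x * (az - cx) - b * bz / x by field.
  by rewrite DE -WE; field.
exact: alg WtE D.
Qed.

End Vorticity.

(** * The angular vorticity bound *)

Section VorticityBarrier.
Context {R : realType}.
Implicit Types (A : R -> R) (h k x z t : R).

(** The power [s^-1 * e^-2]; the final vorticity bound is [theta / s]. *)
Definition theta (h t : R) : R := (- t) `^ (- (1 / 2 + 2 * h / 3)).

Lemma theta_power h t : t < 0 -> theta h t = (ss t)^-1 * ee h t ^- 2.
Proof.
move=> t0; have tn : - t != 0 by rewrite gt_eqF// oppr_gt0.
have -> : (ss t)^-1 = (- t) `^ (- (1 / 2)) by rewrite powRN.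
have -> : ee h t ^- 2 = (- t) `^ (- (2 * h / 3)).
  rewrite powRN /ee -powR_mulrn ?powR_ge0// -powRrM; congr (_ ^-1).
  by congr (_ `^ _); field.
by rewrite -powRD ?tn ?implybT// /theta opprD.
Qed.

Lemma d_theta h t : t < 0 ->
  is_derive t 1 (theta h) ((1 / 2 + 2 * h / 3) * theta h t / (- t)).
Proof.
move=> t0; have tn : - t != 0 by rewrite gt_eqF// oppr_gt0.
apply: d_eq (d_powR (- (1 / 2 + 2 * h / 3)) t0) _.
rewrite powRB ?(negbTE tn) ?implybT// powRr1 ?oppr_ge0 ?ltW//.
by rewrite -/(theta h t) mulNr opprK mulrA.
Qed.

(** At the distance [x] from the axis and with [k = K^2 tau] this profile balances
    the bounds on the swirl source away from the axis and close to it. *)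
Definition profile (k s : R) : R := (s * s + k)^-1.

Lemma profile_neq0 k (s : R) : 0 < k -> s * s + k != 0.
Proof. by move=> k0; rewrite gt_eqF// ltr_wpDl// -expr2 sqr_ge0. Qed.

Lemma d_profile k (s : R) : 0 < k -> is_derive s 1 (profile k) (- (2 * s * profile k s ^+ 2)).
Proof.
move=> k0; apply: d_eq (d_inv (f := fun s : R => s * s + k) (profile_neq0 s k0)
  (d_add (d_mul (d_id s) (d_id s)) (d_cst k s))) _.
by rewrite /profile; move: (_^-1) => w; ring.
Qed.

Lemma d_profile2 k (s : R) : 0 < k -> is_derive s 1 (fun s : R => - (2 * s * profile k s ^+ 2))
  (- (2 * profile k s ^+ 2) + 8 * s ^+ 2 * profile k s ^+ 3).
Proof.
move=> k0; have D := d_profile s k0.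
have -> : (fun s : R => - (2 * s * profile k s ^+ 2)) =
    (fun s : R => -2 * (s * (profile k s * profile k s))).
  by apply/funext => r; move: (profile k r) => d; ring.
apply: d_eq (d_cmul (-2) (d_mul (d_id s) (d_mul D D))) _; ring.
Qed.

Lemma d_profile_t k x t : 0 < k -> t < 0 ->
  is_derive t 1 (fun s : R => profile (k * - s) x) (k * profile (k * - t) x ^+ 2).
Proof.
move=> k0 t0; have kt : 0 < k * - t by rewrite mulr_gt0// oppr_gt0.
have DN : is_derive t 1 (fun s : R => - s) (-1 : R) by exact: is_deriveNid.
apply: d_eq (d_inv (f := fun s : R => x * x + k * - s) (profile_neq0 x kt)
  (d_add (d_cst (x * x) t) (d_cmul k DN))) _.
by rewrite /profile; move: (_^-1) => w; ring.
Qed.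

(** The barrier for the angular vorticity divided by [r]: the first term absorbs
    the swirl source, the second dominates on the parabolic boundary, the third
    absorbs the force. *)
Definition vort_barrier A (h k m1 m2 m3 : R) (q : ST R) : R :=
  m1 * (theta h q.2 * profile (k * - q.2) q.1.1.1) + m2 * Psi A q + m3 * (2 - q.1.1.1).

Lemma vort_barrier_continuous A h k m1 m2 m3 q : 0 < k -> q.2 < 0 -> continuous A ->
  {for q, continuous (vort_barrier A h k m1 m2 m3)}.
Proof.
move=> k0 q0 cA.
have kq : 0 < k * - q.2 by rewrite mulr_gt0// oppr_gt0.
have cN : {for q, continuous (fun q : ST R => - q.2)} by exact: (cvgN (@continuous_t R q)).
have cth : {for q, continuous (fun q : ST R => theta h q.2)}.
  apply: (@continuous_comp _ _ _ (fun q : ST R => q.2) (theta h) q (@continuous_t R q)).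
  by apply: differentiable_continuous; apply/derivable1_diffP; have [] := d_theta h q0.
have cD : {for q, continuous (fun q : ST R => q.1.1.1 * q.1.1.1 + k * - q.2)}.
  apply: cont_add; first by apply: cont_mul; exact: continuous_x.
  by apply: cont_mul; [exact: cvg_cst|exact: cN].
have cDD : {for q, continuous (fun q : ST R => profile (k * - q.2) q.1.1.1)}.
  exact: (cvgV (profile_neq0 _ kq) cD).
apply: cont_add; first apply: cont_add.
- by apply: cont_mul; [exact: cvg_cst|exact: cont_mul].
- by apply: cont_mul; [exact: cvg_cst|exact: Psi_continuous].
- apply: cont_mul; first exact: cvg_cst.
  by apply: cont_sub; [exact: cvg_cst|exact: continuous_x].
Qed.

End VorticityBarrier.

Section VorticityAlgebra.
Context {R : realType}.

(** Comparison of [w] with [x * P] at an interior maximum of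
    [tau^N * (w - x * P)]; the operator acting on [x * P] is [x] times a
    drift-diffusion operator in dimension five. *)
Lemma compare_at_max (x a c n w P wt wx wz wxx wzz Pt Px Pz Pxx Pzz rhs : R) :
  0 < x -> 0 <= n + x ^- 2 - a / x -> 0 < w - x * P ->
  wt + a * wx + c * wz - (wxx + wx / x + wzz) + (x ^- 2 - a / x) * w = rhs ->
  wx - (P + x * Px) = 0 -> wz - x * Pz = 0 ->
  wxx - (2 * Px + x * Pxx) <= 0 -> wzz - x * Pzz <= 0 ->
  0 <= wt - x * Pt - n * (w - x * P) ->
  x * (Pt + a * Px + c * Pz - Pxx - 3 * Px / x - Pzz) <= rhs.
Proof.
move=> x0 n0 w0 <- /subr0_eq -> /subr0_eq -> xx zz tt.
have H := mulr_ge0 n0 (ltW w0).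
have xn : x != 0 by rewrite gt_eqF.
have E : wt + a * (P + x * Px) + c * (x * Pz) - (wxx + (P + x * Px) / x + wzz) +
    (x ^- 2 - a / x) * w - x * (Pt + a * Px + c * Pz - Pxx - 3 * Px / x - Pzz) =
  (wt - x * Pt - n * (w - x * P)) - (wxx - (2 * Px + x * Pxx)) - (wzz - x * Pzz) +
  (n + x ^- 2 - a / x) * (w - x * P) by field.
rewrite -subr_ge0 E; lra.
Qed.

(** The drift [a] is of order [s^-1]; with the scale [K] of the profile equal to
    four times its constant it costs half of the time derivative. *)
Lemma profile_lower (x s a K be theta D : R) : 0 < x -> 0 < s -> 0 < K -> 1 / 2 <= be ->
  0 < theta -> D = (x * x + K ^+ 2 * s ^+ 2)^-1 -> `|a| <= K / 4 * s^-1 ->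
  theta * D / (4 * s ^+ 2) <=
   be * theta / s ^+ 2 * D + theta * (K ^+ 2 * D ^+ 2) + a * (theta * - (2 * x * D ^+ 2)) -
   theta * (- (2 * D ^+ 2) + 8 * x ^+ 2 * D ^+ 3) -
   3 * (theta * - (2 * x * D ^+ 2)) / x.
Proof.
move=> x0 s0 K0 be0 th0 DE aK.
have xn : x != 0 by rewrite gt_eqF.
have sn : s != 0 by rewrite gt_eqF.
have E0 : 0 < x * x + K ^+ 2 * s ^+ 2.
  by rewrite addr_gt0// ?mulr_gt0// ?exprn_gt0.
have D0 : 0 < D by rewrite DE invr_gt0.
have DI : D * (x * x + K ^+ 2 * s ^+ 2) = 1 by rewrite DE mulVf// gt_eqF.
have xD : 2 * x * D * (K * s) <= 1.
  rewrite -[leRHS]DI; have -> : 2 * x * D * (K * s) = D * (2 * (x * (K * s))) by ring.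
  by rewrite ler_pM2l//; have := sqr_ge0 (x - K * s); nra.
have aD : `|a| * (2 * x * D) <= (4 * s ^+ 2)^-1.
  apply: le_trans (_ : (K / 4 * s^-1) * (2 * x * D) <= _).
    by rewrite ler_wpM2r// !mulr_ge0// ltW.
  have -> : K / 4 * s^-1 * (2 * x * D) = (2 * x * D * (K * s)) * (4 * s ^+ 2)^-1.
    by field.
  by rewrite ler_piMl// invr_ge0 mulr_ge0// sqr_ge0.
have na : - `|a| <= a by rewrite lerNl -normrN ler_norm.
have aD' : - (4 * s ^+ 2)^-1 <= - (a * (2 * x * D)).
  rewrite lerN2; apply: le_trans aD; rewrite ler_wpM2r ?ler_norm//.
  by rewrite !mulr_ge0// ltW.
have x2D : x ^+ 2 * D <= 1.
  by rewrite -DI mulrC ler_pM2l// -expr2 lerDl mulr_ge0// sqr_ge0.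
have k1 : 0 <= K ^+ 2 * D by rewrite mulr_ge0 ?sqr_ge0 ?ltW.
have k2 : 0 <= 8 * D * (1 - x ^+ 2 * D).
  by apply: mulr_ge0; [rewrite mulr_ge0// ltW|rewrite subr_ge0].
have k3 : (s ^+ 2)^-1 / 2 <= be / s ^+ 2.
  by rewrite mulrC ler_wpM2r ?invr_ge0 ?sqr_ge0//; lra.
have k4 : (4 * s ^+ 2)^-1 = (s ^+ 2)^-1 / 4 by field.
have -> : be * theta / s ^+ 2 * D + theta * (K ^+ 2 * D ^+ 2) +
   a * (theta * - (2 * x * D ^+ 2)) - theta * (- (2 * D ^+ 2) + 8 * x ^+ 2 * D ^+ 3) -
   3 * (theta * - (2 * x * D ^+ 2)) / x =
  theta * D * (be / s ^+ 2 + K ^+ 2 * D + - (a * (2 * x * D)) + 8 * D * (1 - x ^+ 2 * D)).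
  by field; rewrite xn sn.
rewrite ler_pM2l ?mulr_gt0//.
have alg (p q r v w y : R) : y / 2 <= p -> w = y / 4 -> - w <= r -> 0 <= q -> 0 <= v ->
  w <= p + q + r + v by lra.
exact: alg k3 k4 aD' k1 k2.
Qed.

(** The drift-diffusion operator in dimension five applied to the localising
    barrier, with the same mechanism as for the swirl. *)
Lemma psi_lower (x z a c S zeta J : R) :
  0 < x -> 0 < J -> 0 <= zeta -> zeta <= 1 ->
  kap * zeta ^+ 2 * J <= 1 -> x ^+ 2 + z ^+ 2 <= 1 -> `|x * a| + `|z * c| <= S / 2 ->
  0 <= 2 * (1 - 2 * kap * zeta * (- S)) * J ^+ 3 +
    a * (8 * kap * x * zeta * J ^+ 3) + c * (8 * kap * z * zeta * J ^+ 3) -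
    8 * kap * J ^+ 3 * (zeta - 2 * x ^+ 2 + 12 * kap * x ^+ 2 * zeta ^+ 2 * J) -
    3 * (8 * kap * x * zeta * J ^+ 3) / x -
    8 * kap * J ^+ 3 * (zeta - 2 * z ^+ 2 + 12 * kap * z ^+ 2 * zeta ^+ 2 * J).
Proof.
move=> x0 J0 z0 z1 zJ n1 vel.
pose n := x ^+ 2 + z ^+ 2; pose v := x * a + z * c; pose W := kap * zeta ^+ 2 * J.
have kap0 : 0 <= (kap : R) by rewrite /kap; lra.
have n0 : 0 <= n by rewrite addr_ge0 ?sqr_ge0.
have W0 : 0 <= W by rewrite !mulr_ge0 ?sqr_ge0 ?(ltW J0).
have v0 : 0 <= v + S / 2.
  have := ler_norm (- (x * a)); have := ler_norm (- (z * c)); rewrite !normrN /v.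
  by move: vel; lra.
have nW : n * W <= 1 by exact: mulr_ile1.
have B1 := mulr_ge0 z0 v0.
have -> : 2 * (1 - 2 * kap * zeta * (- S)) * J ^+ 3 +
    a * (8 * kap * x * zeta * J ^+ 3) + c * (8 * kap * z * zeta * J ^+ 3) -
    8 * kap * J ^+ 3 * (zeta - 2 * x ^+ 2 + 12 * kap * x ^+ 2 * zeta ^+ 2 * J) -
    3 * (8 * kap * x * zeta * J ^+ 3) / x -
    8 * kap * J ^+ 3 * (zeta - 2 * z ^+ 2 + 12 * kap * z ^+ 2 * zeta ^+ 2 * J) =
  J ^+ 3 * (2 + 8 * kap * (zeta * (v + S / 2)) - 40 * kap * zeta + 16 * kap * n -
    96 * kap * (n * W)).
  by rewrite /v /n /W; field; rewrite gt_eqF.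
apply: mulr_ge0; first by rewrite exprn_ge0// ltW.
have alg (p q r : R) : 0 <= p -> q <= 1 -> 0 <= r -> 0 <= 2 + 8 * kap * p -
  40 * kap * zeta + 16 * kap * r - 96 * kap * q by rewrite /kap; lra.
exact: alg B1 nW n0.
Qed.

(** Off the axis [b b_z / x] is controlled by the swirl, near it by the mixed
    second derivative of [b]. *)
Lemma forcing_le (x s e b bz Kb C K : R) : 0 < x -> 0 < s -> 0 < e -> e <= 1 ->
  0 <= Kb -> 0 <= C -> x * `|b| <= Kb -> `|b| <= Kb * x * (s ^- 2 * e ^- 2) ->
  `|bz| <= C * s ^- 2 -> `|bz| <= C * x * s ^- 3 ->
  `|b| * `|bz| / x <= Kb * C * (1 + K ^+ 2) *
     (x * (s^-1 * e ^- 2) * (x * x + K ^+ 2 * s ^+ 2)^-1 / s ^+ 2).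
Proof.
move=> x0 s0 e0 e1 Kb0 C0; move: (`|b|) (`|bz|) (normr_ge0 b) (normr_ge0 bz).
move=> {}b {}bz b0 bz0 b1 b2 z1 z2.
have xn : x != 0 by rewrite gt_eqF.
have sn : s != 0 by rewrite gt_eqF.
have en : e != 0 by rewrite gt_eqF.
have E0 : 0 < x * x + K ^+ 2 * s ^+ 2.
  by rewrite ltr_wpDr ?mulr_gt0// mulr_ge0 ?sqr_ge0.
rewrite ler_pdivrMr//.
have -> : Kb * C * (1 + K ^+ 2) *
     (x * (s^-1 * e ^- 2) * (x * x + K ^+ 2 * s ^+ 2)^-1 / s ^+ 2) * x =
   Kb * C * (1 + K ^+ 2) * (x ^+ 2 * s ^- 3 * e ^- 2) / (x * x + K ^+ 2 * s ^+ 2).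
  by move: (gt_eqF E0) => /negbT; move: (_ + K ^+ 2 * _) => E En; field; rewrite En sn en.
rewrite ler_pdivlMr//.
have b3 : b <= Kb * (s^-1 * e^-1).
  rewrite -ler_sqr ?nnegrE//; last by rewrite !mulr_ge0// invr_ge0 ltW.
  apply: le_trans (_ : (x * b) * (Kb * (s ^- 2 * e ^- 2)) <= _).
    have := ler_pM b0 b0 (lexx b) b2.
    by have -> : x * b * (Kb * (s ^- 2 * e ^- 2)) = b * (Kb * x * (s ^- 2 * e ^- 2)) by ring.
  apply: le_trans (_ : Kb * (Kb * (s ^- 2 * e ^- 2)) <= _).
    by rewrite ler_wpM2r// mulr_ge0// mulr_ge0// invr_ge0 exprn_ge0// ltW.
  by rewrite le_eqVlt; apply/orP; left; apply/eqP; field; rewrite sn en.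
have F1 : b * bz * (x * x) <= Kb * C * (x ^+ 2 * s ^- 3 * e ^- 2).
  have -> : Kb * C * (x ^+ 2 * s ^- 3 * e ^- 2) =
    (Kb * (s^-1 * e^-1)) * (C * s ^- 2) * (x * x) * e^-1 by field; rewrite sn en.
  apply: le_trans (_ : (Kb * (s^-1 * e^-1)) * (C * s ^- 2) * (x * x) <= _).
    by rewrite ler_pM2r ?mulr_gt0//; exact: ler_pM.
  rewrite ler_peMr ?invf_ge1// !mulr_ge0 ?invr_ge0 ?exprn_ge0// ltW//.
have F2 : b * bz * s ^+ 2 <= Kb * C * (x ^+ 2 * s ^- 3 * e ^- 2).
  have -> : Kb * C * (x ^+ 2 * s ^- 3 * e ^- 2) =
    (Kb * x * (s ^- 2 * e ^- 2)) * (C * x * s ^- 3) * s ^+ 2 by field; rewrite sn en.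
  by rewrite ler_pM2r ?exprn_gt0//; exact: ler_pM.
move: F1 F2; have := sqr_ge0 K; move: (x ^+ 2 * _ * _) (s ^+ 2) (K ^+ 2) (x * x).
move=> Y S k X k0 F1 F2.
have := ler_wpM2l k0 F2; lra.
Qed.

End VorticityAlgebra.

Section VorticityMax.
Context {R : realType}.

Lemma d_negX (n : nat) (t : R) : t < 0 ->
  is_derive t 1 (fun s : R => (- s) ^+ n) (- (n%:R / (- t) * (- t) ^+ n)).
Proof.
move=> t0; have tn : - t != 0 by rewrite gt_eqF// oppr_gt0.
have DN : is_derive t 1 (fun s : R => - s) (-1 : R) by exact: is_deriveNid.
elim: n => [|n IH].
  have -> : (fun s : R => (- s) ^+ 0) = (fun=> 1) by apply/funext => s; rewrite expr0.
  by apply: d_eq (d_cst 1 t) _; rewrite !mul0r oppr0.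
have -> : (fun s : R => (- s) ^+ n.+1) = (fun s => (- s) * (- s) ^+ n).
  by apply/funext => s; rewrite exprS.
apply: d_eq (d_mul DN IH) _; rewrite exprS -natr1.
by move: (- t) tn ((- t) ^+ n) => T Tn y; field.
Qed.

(** The constants are fixed here: the profile pays for the swirl source and for
    the drift of the linear term, and the linear term pays for the force. *)
Lemma barrier_total (x s e a C k K1 m1 m2 m3 D gL pL : R) :
  0 < x -> x * x <= 1 -> 0 < s -> s <= 1 -> 0 < e -> e <= 1 -> 0 <= k -> 0 <= C ->
  0 <= K1 -> 0 <= m2 -> 0 <= m3 -> m1 = 4 * (2 * K1 + m3 * (C * (1 + k))) ->
  D = (x * x + k * s ^+ 2)^-1 -> `|a| <= C * s^-1 ->
  s^-1 * e ^- 2 * D / (4 * s ^+ 2) <= gL -> 0 <= pL ->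
  2 * (K1 * (x * (s^-1 * e ^- 2) * D / s ^+ 2)) + 3 * m3 <=
    x * (m1 * gL + m2 * pL + m3 * (3 / x - a)).
Proof.
move=> x0 x1 s0 s1 e0 e1 k0 C0 K10 m20 m30 m1E DE aC gL0 pL0.
have xn : x != 0 by rewrite gt_eqF.
have sn : s != 0 by rewrite gt_eqF.
have en : e != 0 by rewrite gt_eqF.
have E0 : 0 < x * x + k * s ^+ 2.
  by rewrite ltr_wpDr ?mulr_gt0// mulr_ge0// sqr_ge0.
have E1 : x * x + k * s ^+ 2 <= 1 + k.
  by apply: lerD => //; rewrite ler_piMr// exprn_ile1// ltW.
have D1 : 1 <= (1 + k) * D by rewrite DE ler_pdivlMr// mul1r.
have D0 : 0 < D by rewrite DE invr_gt0.
pose Y := s^-1 * e ^- 2 * D / s ^+ 2.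
have Y0 : 0 <= Y by rewrite !mulr_ge0 ?invr_ge0 ?exprn_ge0 ?sqr_ge0 ?ltW.
have Y1 : s^-1 <= (1 + k) * Y.
  rewrite (_ : (1 + k) * Y = s^-1 * ((1 + k) * D * ((s * e) ^- 2))); last first.
    by rewrite /Y; field; rewrite en sn.
  rewrite ler_peMr ?invr_ge0 ?(ltW s0)// -[leLHS]mul1r; apply: ler_pM => //.
  have se0 : 0 < s * e by rewrite mulr_gt0.
  have se1 : s * e <= 1 by apply: mulr_ile1; rewrite // ltW.
  by rewrite invf_ge1 ?exprn_gt0// exprn_ile1// ltW.
have gY : Y / 4 <= gL.
  by apply: le_trans gL0; rewrite /Y le_eqVlt; apply/orP; left; apply/eqP; field;
    rewrite en sn.
have m10 : 0 <= m1.
  by rewrite m1E mulr_ge0// addr_ge0 ?mulr_ge0// addr_ge0.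
have L1 : m1 * (Y / 4) <= m1 * gL by rewrite ler_wpM2l.
have L2 : 0 <= m2 * pL by rewrite mulr_ge0.
have aY : a <= C * ((1 + k) * Y).
  by apply: le_trans (ler_norm _) _; apply: le_trans aC _; rewrite ler_wpM2l.
have L3 : m3 * a <= m3 * (C * ((1 + k) * Y)) by rewrite ler_wpM2l.
have L4 : 2 * K1 * Y <= m1 * gL + m2 * pL - m3 * a.
  have E : m1 * (Y / 4) = 2 * K1 * Y + m3 * (C * ((1 + k) * Y)) by rewrite m1E; field.
  by move: L1; rewrite E; move: L2 L3; clear; lra.
have -> : 2 * (K1 * (x * (s^-1 * e ^- 2) * D / s ^+ 2)) + 3 * m3 =
  x * (2 * K1 * Y) + 3 * m3 by rewrite /Y; ring.
have -> : x * (m1 * gL + m2 * pL + m3 * (3 / x - a)) =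
  x * (m1 * gL + m2 * pL - m3 * a) + 3 * m3 by field.
by rewrite lerD2r ler_pM2l.
Qed.

(** The weight [(- t)^N] adds [N / (- t)] to the zero-order coefficient, which
    makes it nonnegative whatever the sign of the stretching [a / x]. *)
Lemma zero_order_ge0 (x s a C n : R) : 0 < x -> 0 < s -> 0 <= C -> `|a| <= C * s^-1 ->
  C ^+ 2 <= n -> 0 <= n / s ^+ 2 + x ^- 2 - a / x.
Proof.
move=> x0 s0 C0 aC Cn.
have a1 : a / x <= C * s^-1 * x^-1.
  by rewrite ler_pM2r ?invr_gt0//; apply: le_trans (ler_norm _) aC.
have a2 : (C * s^-1) ^+ 2 <= n / s ^+ 2.
  by rewrite exprMn exprVn ler_pM2r// invr_gt0 exprn_gt0.
have y0 : 0 <= C * s^-1 * x^-1 by rewrite !mulr_ge0// invr_ge0 ltW.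
have alg (p q v w : R) : v <= p * q -> p ^+ 2 <= w -> 0 <= p * q -> 0 <= w + q ^+ 2 - v.
  by have := sqr_ge0 (p - q); nra.
by rewrite -[x ^- 2]exprVn; exact: alg a1 a2 y0.
Qed.

Variables (u : ST R -> R3 R) (pr : ST R -> R) (f : ST R -> R3 R) (h C M : R).
Hypothesis fl : axi_flow u pr f h C M.

Lemma swirl_forcing x z t Kb K : Q (x, 0, z, t) -> 0 < x -> 0 <= Kb ->
  x * `|F u i1 (x, 0, z, t)| <= Kb ->
  `|F u i1 (x, 0, z, t)| <= Kb * x * (ss t ^- 2 * ee h t ^- 2) ->
  `|F u i1 (x, 0, z, t)| * `|pd aZ (F u i1) (x, 0, z, t)| / x <=
    Kb * C * (1 + K ^+ 2) * (x * ((ss t)^-1 * ee h t ^- 2) *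
     (x * x + K ^+ 2 * ss t ^+ 2)^-1 / ss t ^+ 2).
Proof.
move=> Qp x0 Kb0 b1 b2; have /QE0[n /andP[tm t0]] := Qp.
have s0 := ss_gt0 t0; have e0 := ee_gt0 h t0.
have tt : -1 <= t < 0 by rewrite (ltW tm).
have e1 := ee_le1 (fl_h fl) tt; have C0 := fl_C fl.
apply: forcing_le => //; first exact: ltW.
  have := bound_zth fl (a := 0) (b := 1) (z := z) isT (ltW x0) Qp (or_introl erefl).
  rewrite /= expr0 expr1 invr1 mulr1.
  have -> : (ss t)^-1 * ee h t ^- 3 * ((ss t)^-1 * ee h t ^+ 3) = ss t ^- 2.
    by field; rewrite !gt_eqF.
  by [].
have Qs s : 0 <= s <= x -> Q (s, 0, z, t) by exact: Q_shrink.
have [c /andP[c0 cx] E] := MVT_X (pd_smooth aZ (fl_u fl i1)) x0 Qs.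
have Q0 : Q (0, 0, z, t) by apply: Qs; rewrite lexx ltW.
have Qc : Q (c, 0, z, t) by apply: Qs; rewrite !ltW.
move: E; rewrite (F1z_axis fl Q0) !subr0 => ->.
have := bound_zth fl (a := 1) (b := 1) (z := z) isT (ltW c0) Qc (or_introl erefl).
rewrite /= !expr1 normrM (gtr0_norm x0) [C * x * _]mulrAC ler_pM2r//.
have -> : (ss t)^-1 * ee h t ^- 3 * (ss t)^-1 * ((ss t)^-1 * ee h t ^+ 3) = ss t ^- 3.
  by field; rewrite !gt_eqF.
by [].
Qed.

End VorticityMax.

Section VorticityNoMax.
Context {R : realType}.
Variables (u : ST R -> R3 R) (pr : ST R -> R) (f : ST R -> R3 R) (h C M : R).
Hypothesis fl : axi_flow u pr f h C M.

(** The maximum principle at one point: [vort - x * barrier] is compared along the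
    three coordinate lines, with the weight [(- t)^N] in time. *)
Lemma vorticity_no_max (sg d k K Kb m1 m2 m3 : R) (N : nat) (A : R -> R) x z t :
  `|sg| = 1 -> Q (x, 0, z, t) -> 0 < x -> 0 < d ->
  (forall q : ST R, `|q - (x, 0, z, t)| < d -> q.1.1.2 = 0 -> 0 <= q.1.1.1 -> q.2 <= t ->
    (- q.2) ^+ N * (sg * vort u q - q.1.1.1 * vort_barrier A h k m1 m2 m3 q) <=
    (- t) ^+ N * (sg * vort u (x, 0, z, t) - x * vort_barrier A h k m1 m2 m3 (x, 0, z, t))) ->
  is_derive t 1 A (- (4 * C * ((ss t)^-1 * ee h t ^- 3))) ->
  0 <= A t - normsq (x, 0, z, t) <= 1 ->
  0 < sg * vort u (x, 0, z, t) - x * vort_barrier A h k m1 m2 m3 (x, 0, z, t) ->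
  0 <= Kb -> x * `|F u i1 (x, 0, z, t)| <= Kb ->
  `|F u i1 (x, 0, z, t)| <= Kb * x * (ss t ^- 2 * ee h t ^- 2) ->
  K = 4 * C -> k = K ^+ 2 -> C ^+ 2 <= N%:R -> 0 <= m2 -> m3 = M + 1 ->
  m1 = 4 * (2 * (Kb * C * (1 + k)) + m3 * (C * (1 + k))) -> False.
Proof.
move=> sg1 Qp x0 d0 loc DA /andP[z0 z1] w0 Kb0 b1 b2 KE kE CN m20 m3E m1E.
have /QE0[n1 /andP[tm t0]] := Qp.
have C0 := fl_C fl; have M0 := fl_M fl; have hr := fl_h fl; have /andP[h0 _] := hr.
have K0 : 0 < K by rewrite KE mulr_gt0.
have k0 : 0 < k by rewrite kE exprn_gt0.
have tn0 : 0 < - t by rewrite oppr_gt0.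
have kt : 0 < k * - t by rewrite mulr_gt0.
have TN : 0 < (- t) ^+ N by rewrite exprn_gt0.
have s0 := ss_gt0 t0; have e0 := ee_gt0 h t0.
have tt : -1 <= t < 0 by rewrite (ltW tm).
have s1 := ss_le1 tt; have e1 := ee_le1 hr tt; have s2 := ss_sqr t0.
have xx1 : x * x <= 1 by have := sqr_ge0 z; rewrite -expr2; lra.
have x1 : `|x| <= 1 by rewrite gtr0_norm// -ler_sqr ?nnegrE ?(ltW x0)// expr1n expr2.
have zz1 : `|z| <= 1 by rewrite ler_norml; apply/andP; split; nra.
have [dQ dQ0 HQ] := open_ball_in open_Q Qp.
pose d' := Num.min (Num.min d dQ) x.
have m0 : 0 < d' by rewrite !lt_min d0 dQ0.
have md (s : R) : s < d' -> [/\ s < d, s < dQ & s < x].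
  by rewrite /d' !lt_min => /andP[/andP[-> ->] ->].
pose zeta := A t - normsq (x, 0, z, t).
pose J := (- t + kap * (zeta * zeta))^-1.
have kap0 : 0 <= (kap : R) by rewrite /kap; lra.
have zz : 0 <= kap * (zeta * zeta) by rewrite mulr_ge0// -expr2 sqr_ge0.
have E0' : 0 < - t + kap * (zeta * zeta) by rewrite ltr_wpDr.
have J0 : 0 < J by rewrite invr_gt0.
have zJ : kap * zeta ^+ 2 * J <= 1.
  by rewrite /J ler_pdivrMr// mul1r expr2 lerDr ltW.
have alX : A t - 0 ^+ 2 - z ^+ 2 - x * x = zeta by rewrite /zeta /normsq/=; ring.
have alZ : A t - x ^+ 2 - 0 ^+ 2 - z * z = zeta by rewrite /zeta /normsq/=; ring.
have JX : JJ (- t) (A t - 0 ^+ 2 - z ^+ 2) x = J by rewrite /JJ /EE alX.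
have JZ : JJ (- t) (A t - x ^+ 2 - 0 ^+ 2) z = J by rewrite /JJ /EE alZ.
pose D := profile (k * - t) x; pose T := theta h t.
have sW := vort_smooth fl; have sWd e : smooth_on Q (pd e (vort u)) := pd_smooth e sW.
pose P := vort_barrier A h k m1 m2 m3.
pose Px := m1 * (T * - (2 * x * D ^+ 2)) + m2 * (8 * kap * x * zeta * J ^+ 3) + m3 * (0 - 1).
pose Pxx := m1 * (T * (- (2 * D ^+ 2) + 8 * x ^+ 2 * D ^+ 3)) + m2 * (8 * kap * J ^+ 3 *
     (zeta - 2 * x ^+ 2 + 12 * kap * x ^+ 2 * zeta ^+ 2 * J)) + 0.
have [gx gxx] : sg * pd aX (vort u) (x, 0, z, t) - (P (x, 0, z, t) + x * Px) = 0 /\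
    sg * pd aX (pd aX (vort u)) (x, 0, z, t) - (2 * Px + x * Pxx) <= 0.
  have PX := Psi_X A 0 z t; rewrite /Px /Pxx.
  set al := A t - 0 ^+ 2 - z ^+ 2 in PX alX JX; rewrite -alX -JX.
  pose P1 (s : R) := m1 * (T * - (2 * s * profile (k * - t) s ^+ 2)) +
    m2 * (8 * kap * s * (al - s * s) * JJ (- t) al s ^+ 3) + m3 * (0 - 1).
  have DP (s : R) : is_derive s 1 (fun s : R => P (s, 0, z, t)) (P1 s).
    have Dpsi := d_psi al s tn0; rewrite -PX in Dpsi.
    exact: (d_add (d_add (d_cmul m1 (d_cmul T (d_profile s kt))) (d_cmul m2 Dpsi))
      (d_cmul m3 (d_sub (d_cst 2 s) (d_id s)))).
  have DP1 := d_add (d_add (d_cmul m1 (d_cmul T (d_profile2 x kt)))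
    (d_cmul m2 (d_psi2 al x tn0))) (d_cst (m3 * (0 - 1)) x).
  apply: (local_max_derive2 (f := fun s => sg * vort u (s, 0, z, t) -
    s * P (s, 0, z, t)) (f1 := fun s => sg * pd aX (vort u) (s, 0, z, t) -
    (P (s, 0, z, t) + s * P1 s)) m0).
  - move=> s /md[_ + _]; rewrite -(dist_X s x 0 z t) => /HQ Qs.
    apply: (d_sub (d_cmul sg (is_derive_X sW Qs))).
    by apply: d_eq (d_mul (d_id s) (DP s)) _; rewrite mulr1 addrC.
  - move=> s /md[sd _ sx]; have s0' : 0 <= s.
      by move: sx; rewrite ltr_distl => /andP[+ _]; rewrite subrr => /ltW.
    rewrite -(ler_pM2l TN); rewrite -(dist_X s x 0 z t) in sd.
    exact: (loc (s, 0, z, t) sd erefl s0' (lexx t)).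
  - apply: d_eq (d_sub (d_cmul sg (is_derive_X (sWd aX) Qp))
      (d_add (DP x) (d_mul (d_id x) DP1))) _.
    have alg (a b c v : R) : a - (b + (x * c + b * 1)) = a - (2 * b + x * c) by ring.
    exact: alg.
pose Pz := 0 + m2 * (8 * kap * z * zeta * J ^+ 3) + 0.
pose Pzz := 0 + m2 * (8 * kap * J ^+ 3 *
     (zeta - 2 * z ^+ 2 + 12 * kap * z ^+ 2 * zeta ^+ 2 * J)) + 0.
have [gz gzz] : sg * pd aZ (vort u) (x, 0, z, t) - x * Pz = 0 /\
    sg * pd aZ (pd aZ (vort u)) (x, 0, z, t) - x * Pzz <= 0.
  have PZ := Psi_Z A x 0 t; rewrite /Pz /Pzz.
  set al := A t - x ^+ 2 - 0 ^+ 2 in PZ alZ JZ; rewrite -alZ -JZ.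
  pose P1 (s : R) := 0 + m2 * (8 * kap * s * (al - s * s) * JJ (- t) al s ^+ 3) + 0.
  have DP (s : R) : is_derive s 1 (fun s : R => P (x, 0, s, t)) (P1 s).
    have Dpsi := d_psi al s tn0; rewrite -PZ in Dpsi.
    exact: (d_add (d_add (d_cst (m1 * (T * D)) s) (d_cmul m2 Dpsi)) (d_cst (m3 * (2 - x)) s)).
  have DP1 := d_add (d_add (d_cst 0 z) (d_cmul m2 (d_psi2 al z tn0))) (d_cst 0 z).
  apply: (local_max_derive2 (f := fun s => sg * vort u (x, 0, s, t) -
    x * P (x, 0, s, t)) (f1 := fun s => sg * pd aZ (vort u) (x, 0, s, t) - x * P1 s) m0).
  - move=> s /md[_ + _]; rewrite -(dist_Z s x 0 z t) => /HQ Qs.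
    exact: (d_sub (d_cmul sg (is_derive_Z sW Qs)) (d_cmul x (DP s))).
  - move=> s /md[sd _ _].
    rewrite -(ler_pM2l TN); rewrite -(dist_Z s x 0 z t) in sd.
    exact: (loc (x, 0, s, t) sd erefl (ltW x0) (lexx t)).
  - exact: (d_sub (d_cmul sg (is_derive_Z (sWd aZ) Qp)) (d_cmul x DP1)).
pose be : R := 1 / 2 + 2 * h / 3.
pose S := 4 * C * ((ss t)^-1 * ee h t ^- 3).
pose Pt := m1 * (T * (k * D ^+ 2) + D * (be * T / (- t))) +
  m2 * (2 * (1 - 2 * kap * zeta * (- S)) * J ^+ 3) + 0.
have gt : 0 <= sg * pd aT (vort u) (x, 0, z, t) - x * Pt -
    N%:R / (- t) * (sg * vort u (x, 0, z, t) - x * P (x, 0, z, t)).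
  have DP : is_derive t 1 (fun s : R => P (x, 0, z, s)) Pt.
    have Dpsi := d_psi_t (normsq (x, 0, z, t)) t0 DA.
    exact: (d_add (d_add (d_cmul m1 (d_mul (d_theta h t0) (d_profile_t x k0 t0)))
      (d_cmul m2 Dpsi)) (d_cst (m3 * (2 - x)) t)).
  have DH := d_mul (d_negX N t0) (d_sub (d_cmul sg (is_derive_T sW Qp)) (d_cmul x DP)).
  have := left_max_derive d0 _ DH.
  have H (s : R) : t - d < s <= t -> (- s) ^+ N * (sg * vort u (x, 0, z, s) - x * P (x, 0, z, s)) <=
      (- t) ^+ N * (sg * vort u (x, 0, z, t) - x * P (x, 0, z, t)).
    move=> /andP[sa sb]; apply: (loc (x, 0, z, s)) => //; last exact: ltW.
    by rewrite dist_T ltr_distl sa (le_lt_trans sb)// ltrDl.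
  move=> /(_ H).
  have alg (T' n g w : R) : T' * g + w * - (n * T') = T' * (g - n * w) by ring.
  by rewrite alg pmulr_rge0.
have V := vorticity_meridian fl Qp x0.
have aC : `|F u i0 (x, 0, z, t)| <= C * (ss t)^-1.
  have := bound_r fl (a := 0) (b := 0) isT (ltW x0) Qp.
  by rewrite /= !expr0 invr1 !mulr1.
have cC : `|F u i2 (x, 0, z, t)| <= C * ((ss t)^-1 * ee h t ^- 3).
  have := bound_zth fl (a := 0) (b := 0) isT (ltW x0) Qp (or_intror erefl).
  by rewrite /= !expr0 invr1 !mulr1.
have Fb := swirl_forcing fl K Qp x0 Kb0 b1 b2.
have f0b : `|pd aZ (F f i0) (x, 0, z, t)| <= M.
  by have [_ H] := fl_force fl i0 Qp; exact: (H i2).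
have f2b : `|pd aX (F f i2) (x, 0, z, t)| <= M.
  by have [_ H] := fl_force fl i2 Qp; exact: (H i0).
move: aC cC V Fb f0b f2b w0 gx gxx gz gzz gt; rewrite -/(P _).
generalize (pd aX (pd aX (vort u)) (x, 0, z, t)) (pd aZ (pd aZ (vort u)) (x, 0, z, t)).
generalize (pd aX (vort u) (x, 0, z, t)) (pd aZ (vort u) (x, 0, z, t))
  (pd aT (vort u) (x, 0, z, t)).
generalize (pd aZ (F u i1) (x, 0, z, t)) (pd aZ (F f i0) (x, 0, z, t)).
generalize (pd aX (F f i2) (x, 0, z, t)) (F u i0 (x, 0, z, t)) (F u i2 (x, 0, z, t)).
generalize (vort u (x, 0, z, t)) (F u i1 (x, 0, z, t)) (P (x, 0, z, t)).
move=> w b Pw f2 a c bz f0 wx wz wt wxx wzz aC cC V Fb f0b f2b w0 gx gxx gz gzz gt.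
clear b1 b2 loc sW sWd HQ DA.
have TE : T = (ss t)^-1 * ee h t ^- 2 := theta_power h t0.
have DE : D = (x * x + k * ss t ^+ 2)^-1 by rewrite s2.
have V' : sg * wt + a * (sg * wx) + c * (sg * wz) -
   (sg * wxx + sg * wx / x + sg * wzz) + (x ^- 2 - a / x) * (sg * w) =
   sg * (2 * b * bz / x + (f0 - f2)) by rewrite -V; ring.
have n0 : 0 <= N%:R / (- t) + x ^- 2 - a / x.
  by rewrite -s2; exact: zero_order_ge0 x0 s0 (ltW C0) aC CN.
have cmp := compare_at_max x0 n0 w0 V' gx gz gxx gzz gt.
have rhs_le : sg * (2 * b * bz / x + (f0 - f2)) <= 2 * (`|b| * `|bz| / x) + 2 * M.
  apply: le_trans (ler_norm _) _; rewrite normrM sg1 mul1r.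
  apply: le_trans (ler_normD _ _) _; apply: lerD.
    by rewrite !normrM normfV (gtr0_norm x0) ger0_norm// !mulrA.
  by apply: le_trans (ler_normB _ _) _; rewrite mulr_natl mulr2n lerD.
have aK : `|a| <= K / 4 * (ss t)^-1.
  by rewrite KE; have -> : 4 * C / 4 = C by field.
have TG : 0 < T by rewrite powR_gt0.
have DK : D = (x * x + K ^+ 2 * ss t ^+ 2)^-1 by rewrite -kE.
have be1 : 1 / 2 <= be by rewrite /be lerDl divr_ge0// mulr_ge0// ltW.
have gL := profile_lower x0 s0 K0 be1 TG DK aK.
have vel : `|x * a| + `|z * c| <= S / 2.
  have e31 : 1 <= ee h t ^- 3 by rewrite invf_ge1 ?exprn_gt0// exprn_ile1// ltW.
  have aC' : `|a| <= C * ((ss t)^-1 * ee h t ^- 3).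
    by apply: le_trans aC _; rewrite ler_pM2l// ler_peMr// invr_ge0 ltW.
  rewrite !normrM; have -> : S / 2 = C * ((ss t)^-1 * ee h t ^- 3) +
    C * ((ss t)^-1 * ee h t ^- 3) by rewrite /S; move: (_^-1 * _) => v; field.
  apply: lerD.
    exact: le_trans (ler_piMl (normr_ge0 a) x1) aC'.
  exact: le_trans (ler_piMl (normr_ge0 c) zz1) cC.
have n1' : x ^+ 2 + z ^+ 2 <= 1 by exact: ltW.
have pL := psi_lower x0 J0 z0 z1 zJ n1' vel.
have K10 : 0 <= Kb * C * (1 + k) by rewrite !mulr_ge0 ?addr_ge0 ?(ltW C0) ?(ltW k0).
have m30 : 0 <= m3 by rewrite m3E addr_ge0.
rewrite -kE in gL; rewrite TE in gL.
have tot := barrier_total x0 xx1 s0 s1 e0 e1 (ltW k0) (ltW C0) K10 m20 m30 m1E DE aC gL pL.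
rewrite -kE -DE in Fb.
have E : x * (Pt + a * Px + c * Pz - Pxx - 3 * Px / x - Pzz) = x * (m1 *
   (be * ((ss t)^-1 * ee h t ^- 2) / ss t ^+ 2 * D +
    (ss t)^-1 * ee h t ^- 2 * (k * D ^+ 2) +
    a * ((ss t)^-1 * ee h t ^- 2 * - (2 * x * D ^+ 2)) -
    (ss t)^-1 * ee h t ^- 2 * (- (2 * D ^+ 2) + 8 * x ^+ 2 * D ^+ 3) -
    3 * ((ss t)^-1 * ee h t ^- 2 * - (2 * x * D ^+ 2)) / x) +
   m2 * (2 * (1 - 2 * kap * zeta * (- S)) * J ^+ 3 +
    a * (8 * kap * x * zeta * J ^+ 3) + c * (8 * kap * z * zeta * J ^+ 3) -
    8 * kap * J ^+ 3 * (zeta - 2 * x ^+ 2 + 12 * kap * x ^+ 2 * zeta ^+ 2 * J) -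
    3 * (8 * kap * x * zeta * J ^+ 3) / x -
    8 * kap * J ^+ 3 * (zeta - 2 * z ^+ 2 + 12 * kap * z ^+ 2 * zeta ^+ 2 * J)) +
   m3 * (3 / x - a)).
  rewrite /Pt /Px /Pz /Pxx /Pzz -TE -s2.
  by move: (J ^+ 3) (ss t ^+ 2)^-1; clear; move=> *; ring.
rewrite E in cmp.
move: (le_trans tot cmp) rhs_le Fb; rewrite m3E.
move: (sg * _) (`|b| * _ / x) (Kb * C * _ * _).
by clear -M0 => *; lra.
Qed.

End VorticityNoMax.

Section VorticityRate.
Context {R : realType}.
Variables (u : ST R -> R3 R) (pr : ST R -> R) (f : ST R -> R3 R) (h C M : R).
Hypothesis fl : axi_flow u pr f h C M.

(** The vorticity vanishes on the axis, so second derivatives bound it linearly in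
    the distance; this gives the values on the parabolic boundary. *)
Lemma vorticity_crude x z t : Q (x, 0, z, t) -> 0 < x ->
  `|vort u (x, 0, z, t)| <= 2 * C * x * ((- t)^-1 * (- t)^-1).
Proof.
move=> Qp x0; have /QE0[n /andP[tm t0]] := Qp.
have s0 := ss_gt0 t0; have e0 := ee_gt0 h t0.
have tt : -1 <= t < 0 by rewrite (ltW tm).
have se := ss_le_ee3 (fl_h fl) tt; have C0 := fl_C fl.
have e1 := ee_le1 (fl_h fl) tt; have s2 := ss_sqr t0.
have Qs s : 0 <= s <= x -> Q (s, 0, z, t) by exact: Q_shrink.
have [c /andP[c0 cx] E] := MVT_X (vort_smooth fl) x0 Qs.
have Q0 : Q (0, 0, z, t) by apply: Qs; rewrite lexx ltW.
have Qc : Q (c, 0, z, t) by apply: Qs; rewrite !ltW.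
have Ba := bound_r fl (a := 1) (b := 1) isT (ltW c0) Qc.
have Bb := bound_zth fl (a := 2) (b := 0) isT (ltW c0) Qc (or_intror erefl).
move: E; rewrite (vort_axis fl Q0) !subr0 => ->.
rewrite (pd_vort fl aX Qc) normrM (gtr0_norm x0) [2 * C * x * _]mulrAC ler_pM2r//.
move: Ba Bb; rewrite /= !expr1 expr0 mulr1.
move: (pd _ _ _) (pd _ _ _) => w1 w2 Ba Bb.
rewrite -s2; move: (ss t) (ee h t) s0 e0 se e1 Ba Bb => s e s0 e0 se e1 Ba Bb.
have e31 : e ^+ 3 <= 1 by rewrite exprn_ile1// ltW.
have e30 : 0 < e ^+ 3 by rewrite exprn_gt0.
have sn : s != 0 by rewrite gt_eqF.
have en : e != 0 by rewrite gt_eqF.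
have T0 : 0 < (s ^+ 2)^-1 * (s ^+ 2)^-1 by rewrite mulr_gt0// invr_gt0 exprn_gt0.
have H1 : s^-1 * s^-1 * (s^-1 * e ^+ 3) <= (s ^+ 2)^-1 * (s ^+ 2)^-1.
  have -> : s^-1 * s^-1 * (s^-1 * e ^+ 3) = (s ^+ 2)^-1 * (s ^+ 2)^-1 * (s * e ^+ 3).
    by field.
  rewrite ler_piMr ?(ltW T0)// mulr_ile1 ?(ltW s0) ?(ltW e30)//.
  exact: le_trans se e31.
have H2 : s^-1 * e ^- 3 * s ^- 2 <= (s ^+ 2)^-1 * (s ^+ 2)^-1.
  have -> : s^-1 * e ^- 3 * s ^- 2 = (s ^+ 2)^-1 * (s ^+ 2)^-1 * (s / e ^+ 3).
    by field; rewrite en.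
  by rewrite ler_piMr ?(ltW T0)// ler_pdivrMr// mul1r.
apply: le_trans (ler_normB _ _) _.
have -> : 2 * C * ((s ^+ 2)^-1 * (s ^+ 2)^-1) = C * ((s ^+ 2)^-1 * (s ^+ 2)^-1) +
  C * ((s ^+ 2)^-1 * (s ^+ 2)^-1) by ring.
apply: lerD.
  by apply: le_trans Ba _; rewrite ler_pM2l.
by apply: le_trans Bb _; rewrite ler_pM2l.
Qed.

(** The maximum principle is applied to the angular vorticity divided by [r], in a
    region that stays inside the ball where the swirl rate holds. The result gains
    a factor [e] over the hypothesis on the radial derivative of [u_z]. *)
Lemma vorticity_rate (q : R) : 0 < q < 1 -> exists t1 K : R,
  [/\ -1 < t1, t1 < 0, 0 <= K & forall x z t, 0 < x -> Q (x, 0, z, t) -> t1 <= t ->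
    x ^+ 2 + z ^+ 2 <= q -> `|vort u (x, 0, z, t)| <= K * (ss t ^- 2 * ee h t ^- 2)].
Proof.
move=> /andP[q0 q1].
pose qm := (1 + q) / 2; pose qs := (1 + qm) / 2.
have qqm : q < qm by rewrite /qm; lra.
have qms : qm < qs by rewrite /qs /qm; lra.
have qs1 : 0 < qs < 1 by rewrite /qs /qm; apply/andP; split; lra.
have hr := fl_h fl; have /andP[h0 h12] := hr.
have C0 := fl_C fl; have M0 := fl_M fl.
have [ta [Kb [tam ta0 Kb0 HK]]] := swirl_rate fl qs1.
have c40 : 0 <= 4 * C by lra.
have k0' : 0 < 1 / 2 - h by lra.
have [t1 [t1m tat1 t10 HA]] := moving_boundary qms c40 k0' ta0.
have mt1 : 0 < - t1 by rewrite oppr_gt0.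
pose K := 4 * C; pose k := K ^+ 2.
have K0 : 0 < K by rewrite mulr_gt0.
have k0 : 0 < k by rewrite exprn_gt0.
(* [m3] beats the force, [m1] the swirl source and the drift of the linear term;
   [m2] makes the barrier dominate on the parabolic boundary, where [Psi] is at
   least [1 / 4] initially and [(- t)^-2] laterally. *)
pose m3 := M + 1.
pose m1 := 4 * (2 * (Kb * C * (1 + k)) + m3 * (C * (1 + k))).
pose m2 := 2 * C + 4 * (2 * C * ((- t1)^-1 * (- t1)^-1)).
have m30 : 0 <= m3 by rewrite addr_ge0.
have k10 : 0 <= 1 + k by rewrite addr_ge0// ltW.
have m10 : 0 <= m1.
  rewrite /m1 mulr_ge0// addr_ge0// ?mulr_ge0// ?mulr_ge0// ltW//.
have Ct0 : 0 <= 2 * C * ((- t1)^-1 * (- t1)^-1).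
  by rewrite mulr_ge0 ?mulr_ge0 ?invr_ge0 ?(ltW mt1) ?(ltW C0).
have m2C : 2 * C <= m2 by rewrite /m2; lra.
have m2t : 2 * C * ((- t1)^-1 * (- t1)^-1) <= m2 * (1 / 4) by rewrite /m2; lra.
have m20 : 0 <= m2 by apply: le_trans m2C; rewrite mulr_ge0// ltW.
pose g := qm - q; have g0 : 0 < g by rewrite subr_gt0.
have kap0 : 0 < (kap : R) by rewrite /kap; lra.
have Kp : 0 <= (kap * g ^+ 2) ^- 2.
  by rewrite invr_ge0 exprn_ge0// mulr_ge0 ?sqr_ge0// ltW.
pose N := (Num.truncn (C ^+ 2)).+1.
have CN : C ^+ 2 <= N%:R by apply: ltW; exact: truncnS_gt.
exists t1, (m1 / (2 * K) + m2 * (kap * g ^+ 2) ^- 2 + 2 * m3); split=> //.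
  have a1 : 0 <= m1 / (2 * K) by rewrite divr_ge0// mulr_ge0// ltW.
  have a2 : 0 <= m2 * (kap * g ^+ 2) ^- 2 by rewrite mulr_ge0.
  by have a3 : 0 <= 2 * m3; [rewrite mulr_ge0|rewrite !addr_ge0].
move=> x z t x0 Qp tt1 nq; have /QE0[n /andP[tm t0]] := Qp.
have [A [cA decA A1 dA]] := HA t tt1 t0.
have A1' r : t1 <= r <= t -> A r < 1.
  by move=> /A1/andP[_ Ar]; apply: lt_trans Ar _; case/andP: qs1.
pose P := vort_barrier A h k m1 m2 m3; pose p0 : ST R := (x, 0, z, t).
have QA p : t1 <= p.2 <= t -> normsq p < 1 -> Q p.
  case: p => [[[x' y'] z'] t'] /= /andP[a b] n'; apply/QE; split=> //.
  by rewrite (lt_le_trans t1m a) (le_lt_trans b t0).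
have P_ge p : p.2 < 0 -> p.1.1.1 <= 1 -> m2 * Psi A p <= P p.
  move=> p20 px; rewrite /P /vort_barrier; set G := m1 * _.
  have G0 : 0 <= G.
    have pp : 0 <= k * - p.2 by apply: mulr_ge0; rewrite ?oppr_ge0 ltW.
    apply: mulr_ge0 => //; apply: mulr_ge0; first exact: powR_ge0.
    by rewrite invr_ge0 addr_ge0// -expr2 sqr_ge0.
  have m30' : 0 <= m3 * (2 - p.1.1.1) by rewrite mulr_ge0// subr_ge0; lra.
  by move: (m2 * _) => v; lra.
pose S := [set p : ST R | p.1.1.2 = 0] `&` [set p | 0 <= p.1.1.1].
have cS : closed S.
  apply: closedI.
    rewrite (_ : [set p : ST R | p.1.1.2 = 0] = (fun p : ST R => p.1.1.2) @^-1` [set 0]);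
      last by apply/seteqP; split.
    by apply: preimage_closed; [move=> p _; exact: continuous_y|exact: closed_eq].
  rewrite (_ : [set p : ST R | 0 <= p.1.1.1] = (fun p : ST R => p.1.1.1) @^-1` [set s | 0 <= s])//.
  by apply: preimage_closed; [move=> p _; exact: continuous_x|exact: closed_ge].
have main sg : `|sg| = 1 -> sg * vort u p0 - x * P p0 <= 0.
  move=> sg1; rewrite leNgt; apply/negP => Hp0.
  pose H (p : ST R) := (- p.2) ^+ N * (sg * vort u p - p.1.1.1 * P p).
  have sx p : S p -> Q p -> (p.1.1.1 = 0 -> H p = 0) /\ p.1.1.1 <= 1.
    case: p => [[[x' y'] z'] t'] [/= -> x'0] Qx; split=> [xE|].
      by move: xE Qx => /= -> Qx; rewrite /H/= mul0r subr0 (vort_axis fl Qx) !mulr0.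
    have /QE0[nx _] := Qx.
    have : x' ^+ 2 <= 1 by have := sqr_ge0 z'; lra.
    by rewrite -[X in _ <= X -> _](expr1n _ 2) ler_sqr ?nnegrE.
  have crude p (c : R) : S p -> Q p -> 0 <= c ->
      2 * C * ((- p.2)^-1 * (- p.2)^-1) <= c -> c <= P p -> H p <= 0.
    move=> Sp Qx c0 Cc cP; have [H0 _] := sx p Sp Qx.
    case: p Sp Qx Cc cP H0 => [[[x' y'] z'] t'] [/= -> x'0] Qx Cc cP H0.
    have [xE|xn] := eqVneq x' 0; first by rewrite H0.
    have x'p : 0 < x' by rewrite lt_neqAle eq_sym xn.
    have /QE0[_ /andP[_ t'0]] := Qx.
    rewrite /H /= pmulr_rle0 ?exprn_gt0 ?oppr_gt0// subr_le0.
    apply: le_trans (ler_norm _) _; rewrite normrM sg1 mul1r.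
    apply: le_trans (vorticity_crude Qx x'p) _.
    rewrite mulrAC mulrC ler_pM2l//; exact: le_trans Cc cP.
  have Hp0' : 0 < H p0 by rewrite mulr_gt0// exprn_gt0// oppr_gt0.
  have Sp0 : S p0 by split=> //; exact: ltW.
  have np0 : normsq p0 <= q by rewrite /normsq/= expr0n/= addr0.
  have [|||||p [Sp tp np Hp pmax]] := @interior_max R S A t1 t H p0 cS t1m t0 cA decA A1'
    _ _ _ Sp0 _ _ Hp0'.
  - move=> p _ tp n'; have Qx := QA p tp n'.
    have p20 : p.2 < 0 by move/andP: tp => [_ /le_lt_trans]; apply.
    apply: cont_mul.
      apply: (@continuous_comp _ _ _ (fun q : ST R => q.2) (fun s : R => (- s) ^+ N) p
        (@continuous_t R p)).
      by apply: differentiable_continuous; apply/derivable1_diffP; have [] := d_negX N p20.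
    apply: cont_sub; apply: cont_mul.
    + exact: cvg_cst.
    + exact: (smooth_continuous (vort_smooth fl) Qx).
    + exact: continuous_x.
    + exact: vort_barrier_continuous.
  - move=> p Sp tp np; have tt : t1 <= p.2 <= t by rewrite tp lexx.
    have A1p := A1' _ tt; rewrite tp in A1p.
    have Qx : Q p by apply: QA => //; exact: le_lt_trans np A1p.
    apply: (crude p (m2 * (1 / 4))) => //; first by rewrite mulr_ge0.
      by rewrite tp.
    have [_ px] := sx p Sp Qx; apply: le_trans (P_ge p _ px); last by rewrite tp.
    rewrite ler_wpM2l//; apply: Psi_ge; first by rewrite tp (ltW t1m).
    rewrite tp; have := normsq_ge0 p; lra.
  - move=> p Sp tp np; have A1p := A1' _ tp.
    have Qx : Q p by apply: QA => //; rewrite np.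
    have p20 : p.2 < 0 by move/andP: tp => [_ /le_lt_trans]; apply.
    have T0 : 0 <= (- p.2)^-1 * (- p.2)^-1 by rewrite mulr_ge0// invr_ge0 oppr_ge0 ltW.
    apply: (crude p (m2 * ((- p.2)^-1 * (- p.2)^-1))) => //; first by rewrite mulr_ge0.
      by rewrite ler_wpM2r.
    by have [_ px] := sx p Sp Qx; have := P_ge p p20 px; rewrite (Psi_lateral np).
  - by rewrite tt1 lexx.
  - apply: le_trans np0 _; apply: le_trans (ltW qqm) _.
    by have /A1/andP[] : t1 <= t <= t by rewrite tt1 lexx.
  have /andP[tp1 tp2] := tp.
  have tt : t1 <= p.2 <= t by rewrite (ltW tp1).
  have p20 : p.2 < 0 by exact: le_lt_trans tp2 t0.
  have Qx : Q p by apply: QA => //; exact: lt_trans np (A1' _ tt).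
  have [d d0 Hd] := interior_near decA tp np.
  have nA := gap01 (normsq_ge0 p) np (A1' _ tt).
  have DA : is_derive p.2 1 A (- (4 * C * ((ss p.2)^-1 * ee h p.2 ^- 3))).
    by have := dA _ tt; rewrite (speed_power h p20).
  have [H0 _] := sx p Sp Qx.
  have npq : normsq p <= qs.
    by have /andP[_ As] := A1 _ tt; apply: ltW; exact: lt_trans np As.
  have tap : ta <= p.2 by apply: ltW; exact: lt_trans tat1 tp1.
  have pmax' r : `|r - p| < d -> r.1.1.2 = 0 -> 0 <= r.1.1.1 -> r.2 <= p.2 -> H r <= H p.
    by move=> r1 r2 r3 r4; have [a b] := Hd r r1 r4; exact: pmax.
  case: p Sp H0 pmax' Qx Hp {tp np pmax tp1 tp2 Hd A1 HA dA} tt p20 nA DA npq tap =>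
    [[[x' y'] z'] t'] [/= yE x'0] H0 pmax' Qx Hp tt p20 nA DA npq tap.
  subst y'.
  have xn : x' != 0 by apply/eqP => xE; move: Hp; rewrite H0// ltxx.
  have x'p : 0 < x' by rewrite lt_neqAle eq_sym xn.
  have npq' : x' ^+ 2 + z' ^+ 2 <= qs.
    by move: npq; rewrite /normsq/= expr0n/= addr0.
  have [b1 b2] := HK x' z' t' x'p Qx tap npq'.
  apply: (vorticity_no_max fl (sg := sg) (d := d) (N := N) sg1 Qx x'p d0 pmax' DA nA _
    Kb0 b1 b2 erefl erefl CN m20 erefl erefl).
  by move: Hp; rewrite /H/= pmulr_rgt0// exprn_gt0// oppr_gt0.
have s0 := ss_gt0 t0; have e0 := ee_gt0 h t0.
have tt : -1 <= t < 0 by rewrite (ltW tm).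
have s1 := ss_le1 tt; have e1 := ee_le1 hr tt; have s2 := ss_sqr t0.
have x1 : x <= 1.
  by rewrite -ler_sqr ?nnegrE ?(ltW x0)// expr1n; have := sqr_ge0 z; lra.
have w1 : 1 <= ss t ^- 2 * ee h t ^- 2.
  by rewrite -[leLHS]mulr1 ler_pM// invf_ge1 ?exprn_gt0// exprn_ile1// ltW.
have Pb : x * P p0 <= (m1 / (2 * K) + m2 * (kap * g ^+ 2) ^- 2 + 2 * m3) *
    (ss t ^- 2 * ee h t ^- 2).
  have Ps : Psi A p0 <= (kap * g ^+ 2) ^- 2.
    apply: Psi_le => //; have /A1/andP[a _] : t1 <= t <= t by rewrite tt1 lexx.
    by rewrite /normsq/= expr0n/= addr0 /g; lra.
  rewrite /P /vort_barrier /= (theta_power h t0) /profile -s2 -/p0.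
  move: (Psi A p0) Ps (ltW (Psi_gt0 A (q := p0) t0)) => Y YK Y0.
  have I1 : x * ((ss t)^-1 * ee h t ^- 2 * (x * x + k * ss t ^+ 2)^-1) <=
      (2 * K)^-1 * (ss t ^- 2 * ee h t ^- 2).
    have E0 : 0 < x * x + k * ss t ^+ 2 by rewrite addr_gt0 ?mulr_gt0 ?exprn_gt0.
    rewrite [leLHS]mulrA ler_pdivrMr// (_ : x * ((ss t)^-1 * ee h t ^- 2) =
      (2 * K)^-1 * (ss t ^- 2 * ee h t ^- 2) * (2 * x * (K * ss t))); last first.
      by field; rewrite !gt_eqF.
    rewrite ler_pM2l ?mulr_gt0 ?invr_gt0 ?mulr_gt0 ?exprn_gt0//.
    by rewrite /k; have := sqr_ge0 (x - K * ss t); nra.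
  have I1' := ler_wpM2l m10 I1.
  have I2 : x * (m2 * Y) <= m2 * (kap * g ^+ 2) ^- 2.
    apply: le_trans (ler_piMl _ x1) _; first by rewrite mulr_ge0.
    by rewrite ler_wpM2l.
  have I3 : x * (m3 * (2 - x)) <= 2 * m3 by nra.
  have I2' : m2 * (kap * g ^+ 2) ^- 2 <=
      m2 * (kap * g ^+ 2) ^- 2 * (ss t ^- 2 * ee h t ^- 2).
    by rewrite ler_peMr// mulr_ge0.
  have I3' : 2 * m3 <= 2 * m3 * (ss t ^- 2 * ee h t ^- 2).
    by rewrite ler_peMr// mulr_ge0.
  have alg (G w r v y : R) : x * G <= r * w -> m1 * (x * G) <= m1 * (r * w) ->
    x * (m2 * Y) <= y * w -> x * (m3 * (2 - x)) <= v * w ->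
    x * (m1 * G + m2 * Y + m3 * (2 - x)) <= (m1 * r + y + v) * w.
    move=> _ J1 J2 J3.
    have -> : (m1 * r + y + v) * w = m1 * (r * w) + y * w + v * w by ring.
    by rewrite 2!mulrDr (mulrCA x m1) lerD// lerD.
  exact: alg I1 I1' (le_trans I2 I2') (le_trans I3 I3').
have M1 := main 1 (normr1 _); have M2 := main (-1) (etrans (normrN _) (normr1 _)).
rewrite mul1r in M1; rewrite mulN1r in M2.
exact: norm_le_of_signs M1 M2 Pb.
Qed.

End VorticityRate.

(** * The axial strain *)

Section AxialStrain.
Context {R : realType}.

Lemma powR_small (k c : R) : 0 < k -> 0 < c ->
  exists2 a : R, 0 < a & forall t : R, - a <= t -> t < 0 -> (- t) `^ k <= c.
Proof.
move=> k0 c0; exists (c `^ k^-1); first by rewrite powR_gt0.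
move=> t at_ t0; have -> : c = (c `^ k^-1) `^ k.
  by rewrite -powRrM mulVf ?gt_eqF// powRr1// ltW.
rewrite ge0_ler_powR ?(ltW k0) ?nnegrE//; last by lra.
  by rewrite oppr_ge0 ltW.
by rewrite powR_ge0.
Qed.

Lemma box_in_ball (q x z x' z' l : R) : x ^+ 2 + z ^+ 2 <= q -> q < 1 ->
  l <= (1 - q) / 16 -> 0 <= x -> x <= x' <= x + l -> z <= z' <= z + l ->
  x' ^+ 2 + z' ^+ 2 <= (1 + q) / 2.
Proof.
move=> n q1 lq x0 /andP[xa xb] /andP[za zb].
have q0 : 0 <= q by apply: le_trans n; rewrite addr_ge0 ?sqr_ge0.
have l0 : 0 <= l by lra.
have x1 : x <= 1 by have := sqr_ge0 z; nra.
have z1 : z <= 1 by have := sqr_ge0 x; nra.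
have z2 : -1 <= z by have := sqr_ge0 x; nra.
have H1 : x' ^+ 2 <= x ^+ 2 + 3 * l.
  have : x' ^+ 2 <= (x + l) ^+ 2 by rewrite ler_sqr ?nnegrE; lra.
  have -> : (x + l) ^+ 2 = x ^+ 2 + l * (2 * x + l) by ring.
  have : l * (2 * x + l) <= l * 3 by rewrite ler_wpM2l//; lra.
  by lra.
have H2 : z' ^+ 2 <= z ^+ 2 + 3 * l.
  pose v := z' - z; have v0 : 0 <= v by rewrite /v; lra.
  have vl : v <= l by rewrite /v; lra.
  have -> : z' ^+ 2 = z ^+ 2 + v * (2 * z + v) by rewrite /v; ring.
  have : v * (2 * z + v) <= v * 3 by rewrite ler_wpM2l//; lra.
  by lra.
lra.
Qed.

Variables (u : ST R -> R3 R) (pr : ST R -> R) (f : ST R -> R3 R) (h C M : R).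
Hypothesis fl : axi_flow u pr f h C M.

Lemma div_meridian x z t : 0 < x -> Q (x, 0, z, t) ->
  F u i0 (x, 0, z, t) + x * pd aX (F u i0) (x, 0, z, t) =
  - (x * pd aZ (F u i2) (x, 0, z, t)).
Proof.
move=> x0 Qp; have D := fl_div fl Qp.
have E := dthF1 (fl_axi fl) (fl_u fl) Qp; rewrite dth_meridian in E.
have alg (a ax b1 cz : R) : x * b1 = a -> ax + b1 + cz = 0 -> a + x * ax = - (x * cz).
  by move=> <- D0; rewrite -[LHS]subr0 -(mulr0 x) -D0; ring.
exact: alg E D.
Qed.

(** Incompressibility makes the average of [d_z u_z], with weight [r], over an
    interval of radii a boundary term in [r u_r]. *)
Lemma flux_mean x y z t : 0 <= x -> x < y -> Q (y, 0, z, t) ->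
  exists2 c, x < c < y & pd aZ (F u i2) (c, 0, z, t) * (y ^+ 2 - x ^+ 2) =
    - (2 * (y * F u i0 (y, 0, z, t) - x * F u i0 (x, 0, z, t))).
Proof.
move=> x0 xy Qy.
have Qs s : x <= s <= y -> Q (s, 0, z, t).
  by move=> /andP[xs sy]; apply: Q_shrink Qy _; rewrite (le_trans x0).
have D1 s : x <= s <= y -> is_derive s 1 (fun s : R => s * F u i0 (s, 0, z, t))
    (s * pd aX (F u i0) (s, 0, z, t) + F u i0 (s, 0, z, t) * 1).
  by move=> /Qs Q1; exact: d_mul (d_id s) (is_derive_X (fl_u fl i0) Q1).
pose v := y ^+ 2 - x ^+ 2.
pose w := y * F u i0 (y, 0, z, t) - x * F u i0 (x, 0, z, t).
have D2 s : x <= s <= y -> is_derive s 1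
    (fun s : R => v * (s * F u i0 (s, 0, z, t)) - w * (s * s))
    (v * (s * pd aX (F u i0) (s, 0, z, t) + F u i0 (s, 0, z, t) * 1) -
     w * (s * 1 + s * 1)).
  by move=> /D1 D; exact: d_sub (d_cmul v D) (d_cmul w (d_mul (d_id s) (d_id s))).
pose phi (s : R) := v * (s * F u i0 (s, 0, z, t)) - w * (s * s).
have [c + Dc] : exists2 c, c \in `]x, y[%R & is_derive c 1 phi 0.
  apply: (@Rolle _ phi x y xy).
  - by move=> s; rewrite in_itv/= => /andP[a b]; have [] := D2 s; rewrite ?ltW.
  - apply: derivable_within_continuous => s; rewrite in_itv/= => ss.
    by have [] := D2 s ss.
  - have alg (a b : R) : (y ^+ 2 - x ^+ 2) * (x * a) - (y * b - x * a) * (x * x) =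
      (y ^+ 2 - x ^+ 2) * (y * b) - (y * b - x * a) * (y * y) by ring.
    exact: alg.
rewrite in_itv/= => /andP[c1 c2]; exists c; first by rewrite c1.
have cc : x <= c <= y by rewrite !ltW.
have c0 : 0 < c by exact: le_lt_trans x0 c1.
have E := etrans (esym (@derive_val _ _ _ _ _ _ _ (D2 c cc))) (@derive_val _ _ _ _ _ _ _ Dc).
have alg (p a ax v' w' : R) : a + c * ax = - (c * p) ->
    v' * (c * ax + a * 1) - w' * (c * 1 + c * 1) = 0 -> p * v' = - (2 * w').
  rewrite mulr1 [c * ax + a]addrC => -> E0; apply: (mulfI (lt0r_neq0 c0)).
  have -> : c * (p * v') = - (v' * - (c * p) - w' * (c * 1 + c * 1)) - w' * (c * 1 + c * 1).
    by ring.
  by rewrite E0; ring.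
exact: alg (div_meridian c0 (Qs c cc)) E.
Qed.

(** [d_z u_z] varies little over short radial distances: the vorticity bound
    controls the radial variation of [u_z], and the bound on [d_z^2 u_z] turns
    it into one for [d_z u_z] by a difference quotient in [z]. *)
Lemma strain_variation x y z t d K : 0 <= x -> x < y -> 0 < d ->
  (forall r k, x <= r <= y -> z <= k <= z + d -> Q (r, 0, k, t)) ->
  (forall r k, x < r < y -> z <= k <= z + d -> `|pd aX (F u i2) (r, 0, k, t)| <= K) ->
  `|pd aZ (F u i2) (y, 0, z, t) - pd aZ (F u i2) (x, 0, z, t)| <=
    2 * K * (y - x) / d + 2 * (d * (C * (ss t ^- 3 * ee h t ^+ 3))).
Proof.
move=> x0 xy d0 Qb HK.
have zd : z < z + d by rewrite ltrDl.
have zz : z <= z <= z + d by rewrite lexx ltW.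
have zzd : z <= z + d <= z + d by rewrite lexx ltW.
have xx : x <= x <= y by rewrite lexx ltW.
have yy : x <= y <= y by rewrite lexx ltW.
have t0 : t < 0 by have /QE0[_ /andP[]] := Qb x z xx zz.
have s0 := ss_gt0 t0; have e0 := ee_gt0 h t0.
have inc k : z <= k <= z + d ->
    `|F u i2 (y, 0, k, t) - F u i2 (x, 0, k, t)| <= K * (y - x).
  move=> kk; have [c cc ->] := MVT_X (fl_u fl i2) xy (fun s ss => Qb s k ss kk).
  rewrite normrM [X in _ * X]gtr0_norm ?subr_gt0// ler_wpM2r ?subr_ge0 ?(ltW xy)//.
  exact: HK.
have B2 r k : x <= r <= y -> z <= k <= z + d ->
    `|pd aZ (pd aZ (F u i2)) (r, 0, k, t)| <= C * (ss t ^- 3 * ee h t ^+ 3).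
  move=> rr kk; have r0 : 0 <= r by move/andP: rr => [/(le_trans x0)].
  have := bound_zth fl (a := 0) (b := 2) isT r0 (Qb r k rr kk) (or_intror erefl).
  rewrite /= expr0 invr1 mulr1.
  have -> : (ss t)^-1 * ee h t ^- 3 * ((ss t)^-1 * ee h t ^+ 3) ^+ 2 = ss t ^- 3 * ee h t ^+ 3.
    by field; rewrite !gt_eqF.
  by [].
have quot r : x <= r <= y ->
    `|pd aZ (F u i2) (r, 0, z, t) - (F u i2 (r, 0, z + d, t) - F u i2 (r, 0, z, t)) / d| <=
    d * (C * (ss t ^- 3 * ee h t ^+ 3)).
  move=> rr; have [c /andP[zc cz] E] := MVT_Z (fl_u fl i2) zd (fun k kk => Qb r k rr kk).
  rewrite E addrAC subrr add0r mulfK ?gt_eqF//.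
  have Qc k : z <= k <= c -> Q (r, 0, k, t).
    by move=> /andP[a b]; apply: Qb => //; rewrite a (le_trans b)// ltW.
  have [c' /andP[zc' cz'] E'] := MVT_Z (pd_smooth aZ (fl_u fl i2)) zc Qc.
  rewrite distrC E' normrM mulrC; apply: ler_pM => //.
    by rewrite gtr0_norm ?subr_gt0//; lra.
  by apply: B2 => //; rewrite (ltW zc')/=; apply: ltW; exact: lt_trans cz' cz.
have alg (p p' a b a' b' N : R) : `|p - (a - a') / d| <= N ->
    `|p' - (b - b') / d| <= N -> `|b' - a'| <= K * (y - x) -> `|b - a| <= K * (y - x) ->
    `|p' - p| <= 2 * K * (y - x) / d + 2 * N.
  move=> H1 H2 H3 H4.
  have H5 : `|(b - b') / d - (a - a') / d| <= 2 * K * (y - x) / d.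
    have -> : (b - b') / d - (a - a') / d = ((b - a) - (b' - a')) / d by ring.
    rewrite normrM normfV (gtr0_norm d0) ler_pM2r ?invr_gt0//.
    have -> : 2 * K * (y - x) = K * (y - x) + K * (y - x) by ring.
    apply: le_trans (ler_normB _ _) _; exact: lerD H4 H3.
  have -> : p' - p = (b - b') / d - (a - a') / d + (p' - (b - b') / d) - (p - (a - a') / d).
    by ring.
  apply: le_trans (ler_normB _ _) _; apply: le_trans (lerD (ler_normD _ _) (lexx _)) _.
  by rewrite (_ : 2 * N = N + N) ?addrA ?lerD// ?lerD//; ring.
exact: alg (quot x xx) (quot y yy) (inc z zz) (inc (z + d) zzd).
Qed.

(** Over radial distances of order [s] the axial strain varies little, and its mean
    over an interval of length [L * s] is small for large [L]. The factor [e] that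
    the vorticity bound gains makes both possible at once. *)
Lemma axial_strain (q eta : R) : 0 < q < 1 -> 0 < eta ->
  exists2 t1, -1 < t1 < 0 & forall x z t, 0 <= x -> Q (x, 0, z, t) -> t1 <= t ->
    x ^+ 2 + z ^+ 2 <= q -> `|pd aZ (F u i2) (x, 0, z, t)| <= eta / (- t).
Proof.
have alg_e (e v w r k : R) : e * (6 * v * w) <= r * k -> 2 * w * v * e <= r / 3 * k.
  by lra.
move=> /andP[q0 q1] eta0.
have qm : 0 < (1 + q) / 2 < 1 by apply/andP; split; lra.
have [ta [K [tam ta0 K0 HK]]] := vorticity_rate fl qm.
have C0 := fl_C fl; have hr := fl_h fl; have /andP[h0 h12] := hr.
pose L := 6 * C / eta; pose ep := eta / (6 * C).
have L0 : 0 < L by rewrite divr_gt0// mulr_gt0.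
have ep0 : 0 < ep by rewrite divr_gt0// mulr_gt0.
pose g := (1 - q) / 16; have g0 : 0 < g by rewrite /g; lra.
have KC : 0 < K + C by lra.
have hf : 0 < 1 / 2 :> R by lra.
have h3 : 0 < h / 3 by lra.
have h2 : 0 < 1 / 2 - h by lra.
have c1 : 0 < eta * ep / (6 * L * (K + C)) 
  by apply: divr_gt0; apply: mulr_gt0 => //; apply: mulr_gt0.
have [a1 a10 He] := powR_small h3 c1.
have [a2 a20 Hs] := powR_small hf (divr_gt0 g0 L0).
have [a3 a30 Hd] := powR_small h2 (divr_gt0 g0 ep0).
pose t1 := Num.max ta (Num.max (- a1) (Num.max (- a2) (- a3))).
exists t1.
  by rewrite /t1 lt_max tam/= !gt_max ta0 !oppr_lt0 a10 a20 a30.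
move=> x z t x0 Qp; rewrite /t1 !ge_max => /andP[tta /andP[ta1 /andP[ta2 ta3]]] n.
have /QE0[_ /andP[tm t0]] := Qp.
have s0 := ss_gt0 t0; have e0 := ee_gt0 h t0; have s2 := ss_sqr t0.
have tt : -1 <= t < 0 by rewrite (ltW tm).
have e1 := ee_le1 hr tt.
have He' : ee h t <= _ := He t ta1 t0.
have Hs' : ss t <= _ := Hs t ta2 t0.
have Hd' : ss t * ee h t ^- 3 <= g / ep.
  rewrite ee_cube// -powRN /ss -powRD; last by rewrite gt_eqF ?implybT// oppr_gt0.
  exact: Hd.
(* The radial variation of the strain is at most the bound on [d_r u_z] times
   [l / d], that is, a multiple of [(L / ep) * e * s^-2]. *)
pose l := L * ss t; pose d := ep * (ss t * ee h t ^- 3).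
have l0 : 0 < l by rewrite mulr_gt0.
have d0 : 0 < d.
  by apply: mulr_gt0 => //; apply: mulr_gt0; rewrite // invr_gt0 exprn_gt0.
have lg : l <= g by move: Hs'; rewrite ler_pdivlMr// mulrC.
have dg : d <= g by move: Hd'; rewrite ler_pdivlMr// mulrC.
pose y := x + l; have xy : x < y by rewrite ltrDl.
have nb r k : x <= r <= y -> z <= k <= z + d -> r ^+ 2 + k ^+ 2 <= (1 + q) / 2.
  move=> /andP[ra rb] /andP[ka kb]; apply: (box_in_ball n q1 (lexx g) x0).
    by rewrite ra (le_trans rb)// lerD2l.
  by rewrite ka (le_trans kb)// lerD2l.
have Qb r k : x <= r <= y -> z <= k <= z + d -> Q (r, 0, k, t).
  move=> rr kk; apply/QE0; rewrite tm t0; split=> //.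
  by apply: le_lt_trans (nb r k rr kk) _; lra.
have HX r k : x < r < y -> z <= k <= z + d ->
    `|pd aX (F u i2) (r, 0, k, t)| <= (K + C) * (ss t ^- 2 * ee h t ^- 2).
  move=> /andP[ra rb] kk; have rr : x <= r <= y by rewrite !ltW.
  have r0 : 0 < r by exact: le_lt_trans x0 ra.
  have := HK r k t r0 (Qb r k rr kk) tta (nb r k rr kk).
  have := bound_r fl (a := 0) (b := 1) isT (ltW r0) (Qb r k rr kk).
  rewrite /= expr0 expr1 invr1 mulr1 /vort => Ba Bw.
  have Ba' : `|pd aZ (F u i0) (r, 0, k, t)| <= C * (ss t ^- 2 * ee h t ^- 2).
    apply: le_trans Ba _; rewrite ler_pM2l//.
    have -> : (ss t)^-1 * ((ss t)^-1 * ee h t ^+ 3) =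
      ss t ^- 2 * ee h t ^- 2 * ee h t ^+ 5 by field; rewrite !gt_eqF.
    rewrite ler_piMr ?exprn_ile1 ?(ltW e0)//.
    by rewrite mulr_ge0// invr_ge0 exprn_ge0// ltW.
  have alg (p p' w : R) : `|p - p'| <= K * w -> `|p| <= C * w -> `|p'| <= (K + C) * w.
    move=> H1 H2; rewrite -[p'](subKr p) mulrDl [leRHS]addrC.
    by apply: le_trans (ler_normB _ _) _; exact: lerD.
  exact: alg Bw Ba'.
have yy : x <= y <= y by rewrite lexx ltW.
have xx : x <= x <= y by rewrite lexx ltW.
have zz : z <= z <= z + d by rewrite lexx lerDl ltW.
have y0 : 0 <= y by exact: le_trans (ltW xy).
have [c /andP[xc cy] E] := flux_mean x0 xy (Qb y z yy zz).
have V : `|pd aZ (F u i2) (c, 0, z, t) - pd aZ (F u i2) (x, 0, z, t)| <=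
    2 * ((K + C) * (ss t ^- 2 * ee h t ^- 2)) * (c - x) / d +
    2 * (d * (C * (ss t ^- 3 * ee h t ^+ 3))).
  apply: strain_variation => //.
    by move=> r k /andP[ra rb]; apply: Qb; rewrite ra (le_trans rb)// ltW.
  by move=> r k /andP[ra rb]; apply: HX; rewrite ra (lt_trans rb).
have Bx : `|F u i0 (x, 0, z, t)| <= C * (ss t)^-1.
  have := bound_r fl (a := 0) (b := 0) isT x0 Qp.
  by rewrite /= !expr0 invr1 !mulr1.
have By : `|F u i0 (y, 0, z, t)| <= C * (ss t)^-1.
  have := bound_r fl (a := 0) (b := 0) isT y0 (Qb y z yy zz).
  by rewrite /= !expr0 invr1 !mulr1.
have yE : y = x + l by [].
clearbody y.
have final (s e p c0 ax ay : R) : 0 < s -> 0 < e -> e <= eta * ep / (6 * L * (K + C)) ->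
    l = L * s -> d = ep * (s * e ^- 3) -> `|c0 - p| <=
    2 * ((K + C) * (s ^- 2 * e ^- 2)) * (c - x) / d + 2 * (d * (C * (s ^- 3 * e ^+ 3))) ->
    `|ax| <= C * s^-1 -> `|ay| <= C * s^-1 ->
    c0 * (y ^+ 2 - x ^+ 2) = - (2 * (y * ay - x * ax)) -> `|p| <= eta / s ^+ 2.
  move=> {}s0 {}e0 {}He' lE dE {}V {}Bx {}By {}E.
  have sn : s != 0 by rewrite gt_eqF.
  have en : e != 0 by rewrite gt_eqF.
  have epn : ep != 0 by rewrite gt_eqF.
  have xy0 : 0 < y + x by exact: ltr_wpDr x0 (le_lt_trans x0 xy).
  have c0B : `|c0| <= eta / 3 / s ^+ 2.
    rewrite -(ler_pM2r l0) -(ler_pM2r xy0).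
    have -> : `|c0| * l * (y + x) = `|c0 * (y ^+ 2 - x ^+ 2)|.
      rewrite (_ : y ^+ 2 - x ^+ 2 = l * (y + x)); last by rewrite yE; ring.
      by rewrite normrM (gtr0_norm (mulr_gt0 l0 xy0)) mulrA.
    rewrite E normrN normrM normr_nat.
    apply: le_trans (_ : 2 * ((y + x) * (C * s^-1)) <= _).
      rewrite ler_pM2l// mulrDl; apply: le_trans (ler_normB _ _) _.
      by rewrite !normrM (ger0_norm x0) (ger0_norm y0) lerD// ler_wpM2l.
    rewrite le_eqVlt; apply/orP; left; apply/eqP.
    by rewrite lE /L; field; rewrite sn gt_eqF.
  have V1 : 2 * ((K + C) * (s ^- 2 * e ^- 2)) * (c - x) / d <= eta / 3 / s ^+ 2.
    apply: le_trans (_ : 2 * ((K + C) * (s ^- 2 * e ^- 2)) * l / d <= _).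
      rewrite ler_pM2r ?invr_gt0// ler_pM2l; last first.
        by rewrite mulr_gt0// mulr_gt0// mulr_gt0// invr_gt0 exprn_gt0.
      by rewrite lerBlDl -yE ltW.
    have -> : 2 * ((K + C) * (s ^- 2 * e ^- 2)) * l / d =
        2 * (K + C) * L * e / ep / s ^+ 2 by rewrite lE dE; field; rewrite sn en epn.
    rewrite ler_pM2r ?invr_gt0 ?exprn_gt0// ler_pdivrMr//.
    move: He'; rewrite ler_pdivlMr; last by apply: mulr_gt0 => //; apply: mulr_gt0.
    exact: alg_e.
  have V2 : 2 * (d * (C * (s ^- 3 * e ^+ 3))) = eta / 3 / s ^+ 2.
    by rewrite dE /ep; field; rewrite sn en gt_eqF.
  rewrite V2 in V; rewrite -[p](subKr c0).
  apply: le_trans (ler_normB _ _) _.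
  have -> : eta / s ^+ 2 = eta / 3 / s ^+ 2 + (eta / 3 / s ^+ 2 + eta / 3 / s ^+ 2) by field.
  by apply: lerD => //; apply: le_trans V _; rewrite lerD2r.
rewrite -s2; exact: final s0 e0 He' erefl erefl V Bx By E.
Qed.



End AxialStrain.

(** * The limit *)

Section StrainRate.
Context {R : realType}.
Variables (u : ST R -> R3 R) (pr : ST R -> R) (f : ST R -> R3 R) (h C M : R).
Hypothesis fl : axi_flow u pr f h C M.

Lemma u_r_over_r_axis z t : Q (0, 0, z, t) ->
  u_r_over_r u 0 z t = pd aX (F u i0) (0, 0, z, t).
Proof.
move=> Qp; rewrite /u_r_over_r eqxx; apply: cvg_lim => //.
have [df dv] := is_derive_X (fl_u fl i0) Qp.
have H : (fun k : R => k^-1 *: (((fun s : R => F u i0 (s, 0, z, t)) \o shift 0) (k *: 1) -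
    F u i0 (0, 0, z, t))) @ 0^'+ --> pd aX (F u i0) (0, 0, z, t).
  apply/cvgrPdist_lt => e e0; rewrite -dv.
  have /cvgrPdist_lt/(_ e e0) := df.
  rewrite !near_withinE; apply: filterS => k kH k0.
  by apply: kH; rewrite gt_eqF.
apply: cvg_trans H; apply: near_eq_cvg; near=> k.
rewrite (F0_axis fl Qp) subr0 /= addr0 [k *: 1]mulr1 mulrC.
by [].
Unshelve. all: by end_near. Qed.

Lemma radial_over_r x z t (c : R) : 0 < x -> Q (x, 0, z, t) ->
  (forall r, 0 < r < x -> `|pd aZ (F u i2) (r, 0, z, t)| <= c) ->
  `|F u i0 (x, 0, z, t) / x| <= c / 2.
Proof.
move=> x0 Qp H; have [r rr E] := flux_mean fl (lexx 0) x0 Qp.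
have := H r rr; move: E; generalize (pd aZ (F u i2) (r, 0, z, t)).
generalize (F u i0 (x, 0, z, t)) (F u i0 (0, 0, z, t)) => a a0 p E pc.
have -> : a / x = - (p / 2).
  apply: (mulIf (expf_neq0 2 (lt0r_neq0 x0))).
  have -> : - (p / 2) * x ^+ 2 = - (p * (x ^+ 2 - 0 ^+ 2)) / 2 by ring.
  by rewrite E; field; rewrite gt_eqF.
by rewrite normrN normrM normfV normr_nat ler_pM2r.
Qed.

(** By incompressibility all the entries of the sum are controlled by the axial
    strain, except [d_z u_r] whose scaling leaves a factor [e^3]. *)
Lemma strain_rate (q eta : R) : 0 < q < 1 -> 0 < eta ->
  exists2 t1, -1 < t1 < 0 & forall (X : R3 R) t, t1 <= t -> t < 0 ->
    normsq (X, t) <= q -> Gsum u t X <= eta / (- t).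
Proof.
move=> qq eta0; have eta4 : 0 < eta / 4 by rewrite divr_gt0.
have sum4 (p1 p2 p3 p4 c : R) : p1 <= 3 / 2 * c -> p2 <= c / 2 -> p3 <= c -> p4 <= c ->
  p1 + p2 + p3 + p4 <= 4 * c by lra.
have [ta /andP[tam ta0] HS] := axial_strain fl qq eta4.
have C0 := fl_C fl; have /andP[h0 _] := fl_h fl.
have [a a0 Ha] := powR_small h0 (divr_gt0 eta4 C0).
exists (Num.max ta (- a)).
  by rewrite lt_max tam gt_max ta0 oppr_lt0.
move=> [[x y] z] t; rewrite ge_max => /andP[tta taa] t0 n.
pose r := Num.sqrt (x ^+ 2 + y ^+ 2).
have -> : Gsum u t (x, y, z) = `|drz 1 0 (u_r u) r z t| + `|u_r_over_r u r z t| +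
  `|drz 0 1 (u_z u) r z t| + `|drz 0 1 (u_r u) r z t| by [].
have r0 : 0 <= r by exact: sqrtr_ge0.
have rn : r ^+ 2 + z ^+ 2 <= q.
  by rewrite sqr_sqrtr// addr_ge0 ?sqr_ge0.
have tm : -1 < t by exact: lt_le_trans tam tta.
have Qp : Q (r, 0, z, t).
  by apply/QE0; rewrite tm t0; split=> //; case/andP: qq => _; exact: le_lt_trans.
have Qk k : 0 <= k <= r -> Q (k, 0, z, t) by exact: Q_shrink.
have Sk k : 0 <= k <= r -> `|pd aZ (F u i2) (k, 0, z, t)| <= eta / 4 / (- t).
  move=> kk; have /andP[k0 kr] := kk; apply: HS => //; first exact: Qk.
  by apply: le_trans rn; rewrite lerD2r ler_sqr.
have s0 := ss_gt0 t0; have e0 := ee_gt0 h t0; have s2 := ss_sqr t0.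
have arz : `|pd aZ (F u i0) (r, 0, z, t)| <= eta / 4 / (- t).
  have := bound_r fl (a := 0) (b := 1) isT r0 Qp.
  rewrite /= expr0 expr1 invr1 mulr1 => /le_trans; apply.
  have := Ha t taa t0; rewrite -(ee_cube h t0) ler_pdivlMr// -s2 => He.
  have -> : C * ((ss t)^-1 * ((ss t)^-1 * ee h t ^+ 3)) = ee h t ^+ 3 * C / ss t ^+ 2.
    by field; rewrite gt_eqF.
  by rewrite ler_pM2r// invr_gt0 exprn_gt0.
have rr : 0 <= r <= r by rewrite r0 lexx.
have [axr orr] : `|pd aX (F u i0) (r, 0, z, t)| <= 3 / 2 * (eta / 4 / (- t)) /\
    `|u_r_over_r u r z t| <= eta / 4 / (- t) / 2.
  have c0 : 0 <= eta / 4 / (- t) by exact: le_trans (normr_ge0 _) arz.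
  have [r00|rn0] := eqVneq r 0.
    have S0 := Sk r rr; rewrite r00 in Qp S0 *.
    rewrite (u_r_over_r_axis Qp).
    have D := fl_div fl Qp.
    have E : pd aY (F u i1) (0, 0, z, t) = pd aX (F u i0) (0, 0, z, t).
      have := etrans (esym (dth_axis (pd aX (F u i1)) z t)) (dth_pdF1 fl aX Qp).
      have alg (p v w : R) : 0 = p - (1 * v - 0 * w) -> v = p.
        by rewrite mul1r mul0r subr0 => /esym/subr0_eq.
      exact: alg.
    have alg (p v w c : R) : 0 <= c -> p + v + w = 0 -> v = p -> `|w| <= c ->
        `|p| <= 3 / 2 * c /\ `|p| <= c / 2.
      move=> c0' + vp; rewrite vp => pw; have -> : p = - (w / 2) by lra.
      by rewrite normrN normrM normfV normr_nat; split; lra.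
    exact: alg c0 D E S0.
  have rp : 0 < r by rewrite lt_neqAle eq_sym rn0.
  have O : `|F u i0 (r, 0, z, t) / r| <= eta / 4 / (- t) / 2.
    by apply: radial_over_r => // k /andP[k0 kr]; apply: Sk; rewrite !ltW.
  rewrite /u_r_over_r (negbTE rn0); split; last exact: O.
  have D := div_meridian fl rp Qp.
  have alg (p b w c : R) : b + r * p = - (r * w) -> `|w| <= c -> `|b / r| <= c / 2 ->
      `|p| <= 3 / 2 * c.
    move=> E wc bc; have -> : p = - w - b / r.
      apply: (mulfI rn0); rewrite mulrBr mulrN -E mulrCA divff// mulr1; ring.
    by apply: le_trans (ler_normB _ _) _; rewrite normrN; lra.
  exact: alg D (Sk r rr) O.
have Szz := Sk r rr.
have Ex : drz 1 0 (u_r u) r z t = pd aX (F u i0) (r, 0, z, t) := drzE 1 0 (F u i0) r z t.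
have Ez : drz 0 1 (u_z u) r z t = pd aZ (F u i2) (r, 0, z, t) := drzE 0 1 (F u i2) r z t.
have Exz : drz 0 1 (u_r u) r z t = pd aZ (F u i0) (r, 0, z, t) := drzE 0 1 (F u i0) r z t.
rewrite Ex Ez Exz.
have -> : eta / (- t) = 4 * (eta / 4 / (- t)) by field; rewrite lt_eqF.
exact: sum4 axr orr Szz arz.
Qed.

End StrainRate.

Section Limit.
Context {R : realType}.

Lemma flow_of_solution (u : ST R -> R3 R) (pi : ST R -> R) (f : ST R -> R3 R) (h C : R) :
  suitable_weak_solution u pi f -> smooth_solution u pi f -> axisymmetric u ->
  (Mforce f < +oo)%E -> 0 < h < 1 / 2 -> 0 < C -> axi_bounds u h C ->
  exists M, axi_flow u pi f h C M.
Proof.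
move=> [_ [mom div]] sm axi /force_bounds[M M0 HM] hr C0 bds; have [su sp _] := sm.
exists M; split=> //.
- exact: (divergence_pointwise sm div).
- by move=> i p; exact: (momentum_pointwise sm i mom div).
Qed.

Lemma G_le (u : ST R -> R3 R) (rho t c : R) : 0 <= c ->
  (forall X, B rho X -> Gsum u t X <= c) -> (G u rho t <= c%:E)%E.
Proof.
move=> c0 H; rewrite /G unlock; case: ifP => _; last by rewrite lee_fin.
apply/ess_sup_inf.ess_supP; apply/nearW => X /=; rewrite /patch; case: ifP => [XB|_].
  rewrite /= lee_fin ger0_norm; first by apply: H; exact: set_mem.
  by rewrite /Gsum !addr_ge0.
by rewrite abse0 lee_fin.
Qed.

Lemma strain_limit (u : ST R -> R3 R) (rho : R) : 0 < rho < 1 ->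
  (forall q eta : R, 0 < q < 1 -> 0 < eta ->
    exists2 t1, -1 < t1 < 0 & forall (X : R3 R) t, t1 <= t -> t < 0 ->
    normsq (X, t) <= q -> Gsum u t X <= eta / (- t)) ->
  ((- t)%:E * G u rho t)%E @[t --> (0 : R)^'-] --> 0%E.
Proof.
move=> /andP[r0 r1] H.
have q01 : 0 < rho ^+ 2 < 1 by rewrite exprn_gt0// exprn_ilt1// ltW.
have bound eta : 0 < eta -> \forall t \near (0 : R)^'-,
    (0 <= (- t)%:E * G u rho t <= eta%:E)%E.
  move=> eta0; have [t1 /andP[t1m t10] Ht] := H (rho ^+ 2) eta q01 eta0.
  near=> t.
  have t0 : t < 0 by near: t; exact: nbhs_left_lt.
  have tt : t1 <= t by apply: ltW; near: t; exact: nbhs_left_gt.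
  have tn0 : 0 < - t by rewrite oppr_gt0.
  have G0 : (0 <= G u rho t)%E by exact: Lnorm_ge0.
  rewrite mule_ge0//=; last by rewrite lee_fin ltW.
  have : (G u rho t <= (eta / (- t))%:E)%E.
    apply: G_le; first by rewrite divr_ge0// ltW.
    move=> X XB; apply: Ht => //; move: XB.
    rewrite /B/= /norm3 /dot sum3 /comp3/= -!expr2 -/(normsq (X, t)) => Xr.
    rewrite -(sqr_sqrtr (normsq_ge0 (X, t))) ler_sqr ?nnegrE ?sqrtr_ge0 ?(ltW r0)//.
    exact: ltW.
  move=> GE; apply: le_trans (lee_wpmul2l _ GE) _; first by rewrite lee_fin ltW.
  by rewrite -EFinM lee_fin mulrC divfK// gt_eqF.
have fin : \forall t \near (0 : R)^'-, ((- t)%:E * G u rho t)%E \is a fin_num.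
  have := bound 1 ltr01; apply: filterS => t /andP[t0 t1].
  by rewrite ge0_fin_numE//; apply: le_lt_trans t1 _; exact: ltry.
apply/fine_cvgP; split=> //; apply/cvgrPdist_le => e e0.
near=> t; rewrite sub0r normrN /=.
have /andP[t0 t1] : (0 <= (- t)%:E * G u rho t <= e%:E)%E by near: t; exact: bound.
have tf : ((- t)%:E * G u rho t)%E \is a fin_num by near: t; exact: fin.
by rewrite ger0_norm ?fine_ge0// -lee_fin fineK.
Unshelve. all: by end_near. Qed.


End Limit.

Theorem proposition1p5 (R : realType)
    (u : ST R -> R3 R) (pi : ST R -> R) (f : ST R -> R3 R) (h : R)
    (u_suitable : suitable_weak_solution u pi f)
    (u_smooth : smooth_solution u pi f)
    (u_axi : axisymmetric u)
    (f_bounded : (Mforce f < +oo)%E)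
    (h_range : 0 < h < 1 / 2)
    (u_bounds : exists C_axi : R, 0 < C_axi /\ axi_bounds u h C_axi) :
  forall rho : R, 0 < rho < 1 ->
    ((- t)%:E * G u rho t)%E @[t --> 0^'-] --> 0%E.
Proof.
have [C [C0 bds]] := u_bounds.
have [M fl] := flow_of_solution u_suitable u_smooth u_axi f_bounded h_range C0 bds.
move=> rho rho01; apply: strain_limit => // q eta q01 eta0; exact: (strain_rate fl q01 eta0).
Qed.
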